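(* Let $\mathcal{F}$ denote the set of upper semi-continuous, log-concave probability densities on $\mathbb{R}$, let $f_0\in\mathcal{F}$, let $X_1,\dots,X_n$ be i.i.d. with density $f_0$, and let $(\Pi_n)$ be a sequence of prior probability distributions supported on $\mathcal{F}$. Consider a sequence $\varepsilon_n\to 0$ such that $n^{-2/5}\lesssim \varepsilon_n\lesssim n^{-3/8-\rho}$ for some $\rho>0$, and suppose there exists a constant $C>0$ such that $$\Pi_n\Big(f\in\mathcal{F}:\ \int_{\mathbb{R}} f_0\Big(\log\frac{f_0}{f}\Big)\le \varepsilon_n^2,\quad \int_{\mathbb{R}} f_0\Big(\log\frac{f_0}{f}\Big)^2\le \varepsilon_n^2\Big)\ \ge\ \exp(-Cn\varepsilon_n^2).$$ Then for all sufficiently large $M$, $$\Pi_n\big(f\in\mathcal{F}: h(f,f_0)\ge M\varepsilon_n\mid X_1,\dots,X_n\big)\to 0$$ in $P_{f_0}^n$-probability as $n\to\infty$.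
   Context: A density $f$ on $\mathbb{R}$ is log-concave if $\log f:\mathbb{R}\to[-\infty,\infty)$ is concave. The Hellinger distance is given by $h^2(p,q)=\int(\sqrt p-\sqrt q)^2\,dx$. $P_{f_0}^n$ is the joint law of i.i.d. $X_1,\dots,X_n$ with density $f_0$ with respect to Lebesgue measure. Given a prior $\Pi_n$ (a probability measure on $\mathcal{F}$), the posterior is given by Bayes' formula $$\Pi_n(B\mid X_1,\dots,X_n)=\frac{\int_B\prod_{i=1}^n f(X_i)\,d\Pi_n(f)}{\int_{\mathcal{F}}\prod_{i=1}^n f(X_i)\,d\Pi_n(f)}$$ whenever the denominator is positive. $x_n\lesssim y_n$ means $x_n\le Ky_n$ for a constant $K>0$ not depending on $n$. *)

(* Defs.v *)
From HB Require Import structures.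
From mathcomp Require Import all_boot all_order all_algebra.
From mathcomp Require Import all_classical all_reals all_analysis.
From mathcomp Require Import measurable_realfun.

Set Implicit Arguments.
Unset Strict Implicit.
Unset Printing Implicit Defensive.

Import Order.TTheory GRing.Theory Num.Theory.
Import numFieldNormedType.Exports.

Local Open Scope classical_set_scope.
Local Open Scope ring_scope.

Section log_concave_densities.
Variable R : realType.
Implicit Types f : R -> R.

(* As [lne] sends 0 to [-oo], this is concavity of log f : R -> [-oo, +oo);
   the library convention 0 * -oo = 0 covers t = 0 and t = 1. *)
Definition log_concave f : Prop := forall x y t : R, 0 <= t <= 1 ->
  (t%:E * lne (f x)%:E + (1 - t)%:E * lne (f y)%:E
     <= lne (f (t * x + (1 - t) * y))%:E)%E.

Definition upper_semicontinuous f : Prop :=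
  lower_semicontinuous (fun x : R => (- f x)%:E).

Definition is_density f : Prop :=
  [/\ measurable_fun setT f, forall x, 0 <= f x &
      (\int[lebesgue_measure]_x (f x)%:E = 1)%E].

Record lc_density := LcDensity {
  lc_fun :> R -> R ;
  lc_is_density : is_density lc_fun ;
  lc_log_concave : log_concave lc_fun ;
  lc_usc : upper_semicontinuous lc_fun }.

End log_concave_densities.

(* Measurable types must be pointed: the chosen point is uniform on [0, 1]. *)
Section lc_density_point.
Variable R : realType.

Let u : R -> R := uniform_pdf 0 1.

Let uE x : u x = if 0 <= x <= 1 then 1 else 0.
Proof. by rewrite /u /uniform_pdf subr0 invr1. Qed.

Let u_density : is_density u.
Proof.
split.
- exact: measurable_uniform_pdf.
- by move=> x; exact: uniform_pdf_ge0.
- exact: integral_uniform_pdf1.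
Qed.

Let u_log_concave : log_concave u.
Proof.
move=> x y t /andP[t0 t1].
have lu z : (lne (u z)%:E <= 0)%E.
  rewrite uE; case: ifPn => _; first by rewrite lne1.
  by rewrite /= lexx leNye.
have t1' : 0 <= 1 - t by rewrite subr_ge0.
case: (boolP (0 <= t * x + (1 - t) * y <= 1)) => [h|h].
  rewrite [in leRHS]uE h lne1.
  by apply: adde_le0; apply: mule_ge0_le0 => //; rewrite lee_fin.
have H z s : (0 <= s)%R -> ~~ (0 <= z <= 1) -> s != 0 ->
    (s%:E * lne (u z)%:E = -oo)%E.
  move=> s0 hz sn0; rewrite uE (negbTE hz) /= lexx.
  by rewrite gt0_muleNy// lte_fin lt0r sn0.
have [t00|tn0] := eqVneq t 0.
  move: h; rewrite t00 !(mul0r, mul0e, add0e, add0r, subr0, mul1r) => h.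
  by rewrite mul1e.
have [t10|tn1] := eqVneq (1 - t) 0.
  have t11 : t = 1 by apply/esym/eqP; rewrite -subr_eq0 t10.
  move: h; rewrite t10 t11 !(mul0r, mul0e, adde0, addr0, mul1r) => h.
  by rewrite mul1e.
have fin z s : (0 <= s)%R -> (s%:E * lne (u z)%:E <= 0)%E.
  by move=> s0; apply: mule_ge0_le0.
case: (boolP (0 <= x <= 1)) => [hx|hx]; last first.
  by rewrite (H _ _ t0 hx tn0) addNye leNye.
case: (boolP (0 <= y <= 1)) => [hy|hy]; last first.
  by rewrite (H _ _ t1' hy tn1) addeNy leNye.
case/negP: h; move: hx hy => /andP[x0 x1] /andP[y0 y1].
rewrite addr_ge0 ?mulr_ge0//=.
by rewrite -[leRHS](subrKC t) lerD// ler_piMr.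
Qed.

Let u_usc : upper_semicontinuous u.
Proof.
move=> x a /=; rewrite lte_fin uE; case: ifPn => [_ ha|hx].
  exists setT; first exact: filterT.
  move=> y _; rewrite lte_fin (lt_le_trans ha)// lerN2 uE.
  by case: ifP => // _; rewrite ler01.
rewrite oppr0 => ha; exists (~` `[0, 1]%classic).
  apply: open_nbhs_nbhs; split; last by rewrite /= in_itv/=; exact/negP.
  by apply: closed_openC; exact: interval_closed.
move=> y /= /negP; rewrite in_itv/= => hy.
by rewrite lte_fin uE (negbTE hy) oppr0.
Qed.

Definition lc_uniform := LcDensity u_density u_log_concave u_usc.

End lc_density_point.

HB.instance Definition _ (R : realType) := gen_eqMixin (lc_density R).
HB.instance Definition _ (R : realType) := gen_choiceMixin (lc_density R).
HB.instance Definition _ (R : realType) :=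
  isPointed.Build (lc_density R) (lc_uniform R).

(* The sigma-algebra on the set of densities is the one generated by the
   evaluations f |-> f x; it coincides with the Borel sigma-algebra of the
   Hellinger metric. *)
Section lc_density_measurable.
Variable R : realType.

Definition lc_evaluations : set (set (lc_density R)) :=
  \bigcup_(x in [set: R])
    preimage_set_system setT (fun f : lc_density R => f x) measurable.

HB.instance Definition _ := @isMeasurable.Build
  (sigma_display lc_evaluations) (lc_density R)
  <<s lc_evaluations >> (@sigma_algebra0 _ setT lc_evaluations)
  (@sigma_algebraC _ lc_evaluations)
  (@sigma_algebra_bigcup _ setT lc_evaluations).

End lc_density_measurable.

Section law_of_density.
Variables (R : realType) (f : lc_density R).
Local Open Scope ereal_scope.

Definition lc_law (A : set R) : \bar R :=
  \int[lebesgue_measure]_(x in A) (f x)%:E.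

Let f0 x : 0 <= (f x)%:E.
Proof. by rewrite lee_fin; case: (lc_is_density f). Qed.

Let mf (D : set R) : measurable_fun D (EFin \o (f : R -> R)).
Proof.
by apply/measurable_EFinP; apply: measurable_funTS; case: (lc_is_density f).
Qed.

Let lc_law0 : lc_law set0 = 0.
Proof. by rewrite /lc_law integral_set0. Qed.

Let lc_law_ge0 A : 0 <= lc_law A.
Proof. by apply: integral_ge0 => x _. Qed.

Let lc_law_sigma_additive : semi_sigma_additive lc_law.
Proof.
move=> F mF tF mUF; rewrite /lc_law ge0_integral_bigcup//; last exact: mf.
by apply: is_cvg_ereal_nneg_natsum_cond => n _ _; exact: integral_ge0.
Qed.

HB.instance Definition _ := isMeasure.Build _ _ _ lc_law
  lc_law0 lc_law_ge0 lc_law_sigma_additive.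

Let lc_law_setT : lc_law setT = 1.
Proof. by case: (lc_is_density f). Qed.

HB.instance Definition _ :=
  Measure_isProbability.Build _ _ _ lc_law lc_law_setT.

End law_of_density.

Section product_law.
Context d (T : measurableType d) (R : realType) (P : probability T R).
Local Open Scope ereal_scope.

Definition cons_pair n (p : T * n.-tuple T) : n.+1.-tuple T :=
  [tuple of p.1 :: p.2].

Lemma measurable_cons_pair n : measurable_fun setT (@cons_pair n).
Proof. exact: measurable_cons. Qed.

Section step.
Variables (n : nat) (Q : probability (n.-tuple T) R).

Definition cons_law : set (n.+1.-tuple T) -> \bar R :=
  pushforward (P \x Q) (@cons_pair n).

Let cons_law0 : cons_law set0 = 0.
Proof. by rewrite /cons_law /pushforward preimage_set0 measure0. Qed.

Let cons_law_ge0 A : 0 <= cons_law A.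
Proof. by rewrite /cons_law /pushforward. Qed.

Let cons_law_sigma_additive : semi_sigma_additive cons_law.
Proof.
pose m : {measure set _ -> \bar R} :=
  measure_function_pushforward__canonical__measure_function_Measure
    (P \x Q) (measurable_cons_pair (n := n)).
exact: (@measure_semi_sigma_additive _ _ _ m).
Qed.

HB.instance Definition _ := isMeasure.Build _ _ _ cons_law
  cons_law0 cons_law_ge0 cons_law_sigma_additive.

Let cons_law_setT : cons_law setT = 1.
Proof.
rewrite /cons_law /pushforward preimage_setT -setXTT product_measure1E//.
by rewrite -[RHS]mule1; congr (_ * _); exact: probability_setT.
Qed.

HB.instance Definition _ :=
  Measure_isProbability.Build _ _ _ cons_law cons_law_setT.

End step.

Fixpoint iid_law (n : nat) : probability (n.-tuple T) R :=
  match n with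
  | 0%N => dirac [tuple]
  | m.+1 => cons_law (iid_law m)
  end.

Lemma iid_law_rect n (A : 'I_n -> set T) : (forall i, measurable (A i)) ->
  iid_law n [set x | forall i, A i (tnth x i)] = \prod_(i < n) P (A i).
Proof.
elim: n A => [|n ih] A mA.
  by rewrite big_ord0 /= diracE mem_set//= => -[].
rewrite big_ord_recl /= /cons_law /pushforward.
rewrite (_ : _ @^-1` _ =
    A ord0 `*` [set x : n.-tuple T | forall i, A (lift ord0 i) (tnth x i)]).
  rewrite product_measure1E//; last first.
    rewrite (_ : mkset _ =
        \bigcap_(i in [set: 'I_n]) ((@tnth _ T ^~ i) @^-1` A (lift ord0 i))).
      apply: fin_bigcap_measurable => // i _.
      by rewrite -[X in measurable X]setTI; exact: measurable_tnth.
    by apply/seteqP; split => x /= h i => [_|]; exact: h.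
  congr (_ * _); apply: (ih (fun i => A (lift ord0 i))) => i; exact: mA.
apply/seteqP; split => -[x y] /=.
  move=> h; split; first by have := h ord0; rewrite tnth0.
  by move=> i; have := h (lift ord0 i); rewrite tnthS.
by move=> [h0 h] i; case: (unliftP ord0 i) => [j ->|->]; rewrite ?tnthS ?tnth0.
Qed.

End product_law.

Section divergences.
Variable R : realType.
Implicit Types f g : R -> R.

Definition hellinger f g : R :=
  Num.sqrt (\int[lebesgue_measure]_x (Num.sqrt (f x) - Num.sqrt (g x)) ^+ 2)%R.

(* In both integrands the library conventions c / 0 = +oo for c > 0 and
   0 * (+-oo) = 0 make the value +oo where g = 0 < f, and 0 where f = 0. *)
Definition kl_div f g : \bar R :=
  (\int[lebesgue_measure]_x ((f x)%:E * lne ((f x)%:E / (g x)%:E)))%E.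

Definition kl_div2 f g : \bar R :=
  (\int[lebesgue_measure]_x ((f x)%:E * lne ((f x)%:E / (g x)%:E) ^+ 2))%E.

End divergences.

Section bayes.
Variable R : realType.

Definition likelihood n (x : n.-tuple R) (f : lc_density R) : R :=
  \prod_(i < n) f (tnth x i).

(* As in [mnormalize], the prior is returned when the evidence is 0 or +oo. *)
Definition posterior (Pi : probability (lc_density R) R) n (x : n.-tuple R)
    (B : set (lc_density R)) : \bar R :=
  let evidence := (\int[Pi]_f (likelihood x f)%:E)%E in
  if (evidence == 0%E) || (evidence == +oo%E) then Pi B
  else ((\int[Pi]_(f in B) (likelihood x f)%:E) / evidence)%E.

Definition lesssim (x y : nat -> R) : Prop :=
  exists2 K : R, 0 < K & forall n, (0 < n)%N -> x n <= K * y n.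

End bayes.

(* Main.v *)
(** With N = n eps_n^2, tests and a lower bound on the evidence are combined.

    Tests.  After a normalization of f on each half-line, ln f is coded
    adaptively: the half-line is cut at the points where the slope of ln f drops
    below - 2 ^ i, and on each piece the Faber-Schauder coefficients of the
    concave function ln f are rounded.  As these coefficients have a fixed sign
    and a bounded sum, the exponential Markov inequality for counting shows that
    exp (O(eps ^ (-1/2))) codes suffice for Hellinger precision eps, and the
    assumption n ^ (-2/5) <= K eps_n is exactly what makes this exp (O(N)).
    Birge's two-point tests applied to one representative per code reject all
    bounded and concentrated densities at distance M eps_n; every other
    log-concave density is rejected by one of finitely many indicator tests.

    Evidence.  For f in the Kullback-Leibler neighbourhood, a truncated Chernoff
    bound gives likelihood ratios of at least exp (- 2 N) with probability
    tending to 1, and averaging over the prior transfers this to the evidence. *)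

Require Import Defs.
From HB Require Import structures.
From mathcomp Require Import all_boot all_order all_algebra.
From mathcomp Require Import all_classical all_reals all_analysis.
From mathcomp Require Import measurable_realfun.
From mathcomp Require Import ring lra.

Set Implicit Arguments.
Unset Strict Implicit.
Unset Printing Implicit Defensive.

Import Order.TTheory GRing.Theory Num.Theory.
Import numFieldNormedType.Exports.

Local Open Scope classical_set_scope.
Local Open Scope ring_scope.

(** The obstacle to coding [ln f] is that it is unbounded below, so that no uniform rounding of it
    over a half-line is possible. What counts in the Hellinger metric is [f] times the squared error
    of [ln f]. As the error enters squared, Hellinger precision eps allows errors of order eps in
    [ln f], and a concave function costs the inverse square root of its precision. Where [f] has
    decayed exponentially the tolerance may grow geometrically, which makes the costs of the cells a
    convergent series although the number of cells grows with the precision. Pieces on which the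
    slope is about - 2 ^ i are cut into cells of length 2 ^ - (i + 1), so that all cells rescale to
    one class of Lipschitz functions.

    There is no room for a logarithmic factor in the leading term of the entropy, and rounding the
    coefficients independently of each other would lose one. Terms polynomial in the logarithm of
    the precision are harmless.

    On the side of the posterior, infinite evidence has to be excluded as well as small evidence,
    since [posterior] returns the prior in both degenerate cases. *)

(** * Entropy as the logarithm of a number of codes *)

Section entropy.
Variable R : realType.

(** Codes are used rather than covering balls: they combine by pairing, pull back along any map, and
    a representative of a code can be taken inside [S] without a triangle inequality. *)
Definition entropy_le (X : Type) (S : set X) (E : X -> X -> Prop) (a : R) :=
  exists (N : nat) (c : X -> nat),
    [/\ N%:R <= expR a, forall f, S f -> (c f < N)%N &
        forall f g, S f -> S g -> c f = c g -> E f g].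

Lemma entropy_le_sub (X : Type) (S S' : set X) (E E' : X -> X -> Prop) (a a' : R) :
  entropy_le S' E' a' -> S `<=` S' -> a' <= a ->
  (forall f g, S f -> S g -> E' f g -> E f g) -> entropy_le S E a.
Proof.
move=> [N [c [Na cN cE]]] SS' aa' EE'; exists N, c; split.
- by rewrite (le_trans Na)// ler_expR.
- by move=> f /SS'/cN.
- by move=> f g Sf Sg cfg; apply: EE' => //; apply: cE => //; exact: SS'.
Qed.

Lemma entropy_le_triv (X : Type) (S : set X) (E : X -> X -> Prop) (a : R) :
  0 <= a -> (forall f g, S f -> S g -> E f g) -> entropy_le S E a.
Proof.
move=> a0 ES; exists 1%N, (fun=> 0%N); split=> // [|f g Sf Sg _]; last exact: ES.
by rewrite -[X in X <= _]expR0 ler_expR.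
Qed.

(** The two codes become the digits of one number in base [N2]. *)
Lemma entropy_le_and (X : Type) (S : set X) (E1 E2 : X -> X -> Prop) (a1 a2 : R) :
  entropy_le S E1 a1 -> entropy_le S E2 a2 ->
  entropy_le S (fun f g => E1 f g /\ E2 f g) (a1 + a2).
Proof.
move=> [N1 [c1 [Na1 cN1 cE1]]] [N2 [c2 [Na2 cN2 cE2]]].
exists (N1 * N2)%N, (fun f => (c1 f * N2 + c2 f)%N); split.
- by rewrite natrM expRD ler_pM.
- move=> f Sf; have := cN1 _ Sf; have := cN2 _ Sf => h2 h1.
  rewrite (@leq_trans ((c1 f).+1 * N2)%N)//; last by rewrite leq_mul2r h1 orbT.
  by rewrite mulSn addnC ltn_add2r.
- move=> f g Sf Sg h.
  have N2f := cN2 _ Sf; have N2g := cN2 _ Sg.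
  have N2gt0 : (0 < N2)%N by exact: leq_ltn_trans N2f.
  split.
    apply: cE1 => //; move: (congr1 (fun x => x %/ N2)%N h).
    by rewrite !divnMDl// !divn_small// !addn0.
  apply: cE2 => //; move: (congr1 (fun x => x %% N2)%N h).
  by rewrite !modnMDl !modn_small.
Qed.

Lemma entropy_le_forall (X : Type) (S : set X) (n : nat)
    (E : nat -> X -> X -> Prop) (a : nat -> R) :
  (forall i, (i < n)%N -> entropy_le S (E i) (a i)) ->
  entropy_le S (fun f g => forall i, (i < n)%N -> E i f g) (\sum_(i < n) a i).
Proof.
elim: n => [|n ih] h; first by apply: entropy_le_triv; rewrite ?big_ord0.
rewrite big_ord_recr /=.
have h1 := entropy_le_and (ih (fun i lin => h i (ltnW lin))) (h n (ltnSn n)).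
apply: entropy_le_sub h1 _ _ _ => // f g Sf Sg [h1 h2] i.
by rewrite ltnS leq_eqVlt => /predU1P[->//|]; exact: h1.
Qed.

Lemma entropy_le_preimage (X Y : Type) (h : X -> Y) (S : set X) (S' : set Y)
    (E : Y -> Y -> Prop) (a : R) :
  (forall f, S f -> S' (h f)) -> entropy_le S' E a ->
  entropy_le S (fun f g => E (h f) (h g)) a.
Proof.
move=> SS' [N [c [Na cN cE]]]; exists N, (c \o h); split => //.
  by move=> f /SS'/cN.
by move=> f g Sf Sg; apply: cE; exact: SS'.
Qed.

(** A code is the index of a class containing [f] followed by the code of [f] in that class, so a
    union of [k] classes adds only [ln k]. *)
Lemma entropy_le_cover (X : Type) (k : nat) (S : set X) (Si : nat -> set X)
    (E : X -> X -> Prop) (a : R) :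
  (forall f, S f -> exists2 i, (i < k)%N & Si i f) ->
  (forall i, (i < k)%N -> entropy_le (Si i) E a) ->
  entropy_le S E (a + ln k%:R).
Proof.
move=> Scov hE.
(* For [k = 0] the class [S] is empty and zero codes suffice. *)
case: k Scov hE => [|k] Scov hE.
  exists 0%N, (fun=> 0%N); split; first exact: expR_ge0.
  - by move=> f /Scov[].
  - by move=> f g /Scov[].
have /choice [N hN] : forall i, exists N, (i < k.+1)%N -> exists c : X -> nat,
    [/\ N%:R <= expR a, forall f, Si i f -> (c f < N)%N &
        forall f g, Si i f -> Si i g -> c f = c g -> E f g].
  move=> i; have [ik|] := boolP (i < k.+1)%N; last by exists 0%N.
  by have [N [c h]] := hE i ik; exists N => _; exists c.
have /choice [c hc] : forall i, exists c : X -> nat, (i < k.+1)%N ->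
    [/\ (N i)%:R <= expR a, forall f, Si i f -> (c f < N i)%N &
        forall f g, Si i f -> Si i g -> c f = c g -> E f g].
  move=> i; have [ik|] := boolP (i < k.+1)%N; last by exists (fun=> 0%N).
  by have [c h] := hN i ik; exists c => _.
have /choice [p hp] : forall f, exists i, S f -> (i < k.+1)%N /\ Si i f.
  move=> f; have [/Scov[i ik Sif]|] := pselect (S f); first by exists i.
  by exists 0%N.
pose M := (\max_(i < k.+1) N i)%N.
have cM f : S f -> (c (p f) f < M)%N.
  move=> Sf; have [pk Spf] := hp _ Sf; have [_ h _] := hc _ pk.
  by apply: (leq_trans (h _ Spf)); apply: (@leq_bigmax _ (fun i : 'I_k.+1 => N i) (Ordinal pk)).
exists (k.+1 * M)%N, (fun f => (p f * M + c (p f) f)%N); split.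
- rewrite natrM expRD lnK ?posrE// mulrC ler_pM//.
  have [i ->] : {i : 'I_k.+1 | M = N i} by apply: (@bigop.eq_bigmax _ (fun i : 'I_k.+1 => N i)); rewrite card_ord.
  by have [] := hc i (ltn_ord i).
- move=> f Sf; have [pk _] := hp _ Sf.
  rewrite (@leq_trans ((p f).+1 * M)%N)//; last by rewrite leq_mul2r pk orbT.
  by rewrite mulSn addnC ltn_add2r cM.
- move=> f g Sf Sg h; have Mf := cM _ Sf; have Mg := cM _ Sg.
  have M0 : (0 < M)%N by exact: leq_ltn_trans Mf.
  have pfg : p f = p g.
    by move: (congr1 (fun x => x %/ M)%N h); rewrite !divnMDl// !divn_small// !addn0.
  have [pk Spf] := hp _ Sf; have [_ Spg] := hp _ Sg.
  have [_ _] := hc _ pk; apply => //; first by rewrite pfg.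
  by move: h; rewrite pfg => /addnI.
Qed.

Lemma truncn_eq_dist (x y : R) : 0 <= x -> 0 <= y ->
  Num.truncn x = Num.truncn y -> `|x - y| <= 1.
Proof.
move=> x0 y0 xy; have := truncn_itv x0; have := truncn_itv y0; rewrite xy -natr1.
by move=> /andP[? ?] /andP[? ?]; rewrite ler_norml; apply/andP; split; lra.
Qed.

(** The shift by [B] makes the argument of [Num.truncn] nonnegative, where truncation is rounding
    down. *)
Lemma entropy_le_value (X : Type) (S : set X) (h : X -> R) (B q : R) :
  0 <= B -> 0 < q -> (forall f, S f -> `|h f| <= B) ->
  entropy_le S (fun f g => `|h f - h g| <= q) (ln (2 * B / q + 1)).
Proof.
move=> B0 q0 hB; pose u f := (h f + B) / q.
have u0 f : S f -> 0 <= u f.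
  by move=> /hB; rewrite ler_norml => /andP[? _]; rewrite divr_ge0//; [lra|exact: ltW].
have q0' := ltW q0.
exists (Num.truncn (2 * B / q)).+1, (fun f => Num.truncn (u f)); split.
- rewrite lnK ?posrE ?ltr_wpDl// ?divr_ge0// ?mulr_ge0//.
  by rewrite -natr1 lerD2r truncn_le divr_ge0 ?mulr_ge0.
- move=> f /hB; rewrite ler_norml => /andP[_ hf]; rewrite ltnS le_truncn//.
  by rewrite ler_pM2r ?invr_gt0//; lra.
- move=> f g Sf Sg /(truncn_eq_dist (u0 _ Sf) (u0 _ Sg)).
  rewrite /u -mulrBl opprD addrACA subrr addr0 normrM (gtr0_norm (_ : 0 < q^-1)) ?invr_gt0//.
  by rewrite ler_pdivrMr// mul1r.
Qed.

(* Exponential Markov inequality for the counting measure. *)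
Lemma card_bounded_sum_le (a b : nat) (m tau : R) : 0 < tau ->
  #|[set v : {ffun 'I_a -> 'I_b} | (\sum_k v k)%:R <= m :> R]%SET|%:R
    <= expR (tau * m) * (1 - expR (- tau))^-1 ^+ a.
Proof.
move=> tau0; have t1 : expR (- tau) < 1 by rewrite -[X in _ < X]expR0 ltr_expR oppr_lt0.
rewrite -sum1_card natr_sum.
apply: (@le_trans _ _ (\sum_(v : {ffun 'I_a -> 'I_b})
    expR (tau * m) * \prod_(k < a) expR (- tau) ^+ v k)).
  rewrite big_mkcond/= ler_sum// => v _; case: ifPn => [|_]; last first.
    by rewrite mulr_ge0 ?expR_ge0// prodr_ge0// => i _; rewrite exprn_ge0// expR_ge0.
  rewrite inE => vm; rewrite -expr_sum -expRM_natr -expRD -[X in X <= _]expR0 ler_expR.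
  by rewrite mulNr subr_ge0 ler_pM2l.
rewrite -mulr_sumr ler_wpM2l ?expR_ge0//.
rewrite -(bigA_distr_bigA (fun (i : 'I_a) (j : 'I_b) => expR (- tau) ^+ j)).
rewrite prodr_const card_ord.
have s0 : 0 <= \sum_(j < b) expR (- tau) ^+ j.
  by rewrite sumr_ge0// => i _; rewrite exprn_ge0// expR_ge0.
apply: lerXn2r; rewrite ?nnegrE ?invr_ge0 ?subr_ge0 ?(ltW t1)//.
rewrite -[leRHS]mul1r ler_pdivlMr ?subr_gt0//.
have -> : (\sum_(j < b) expR (- tau) ^+ j) * (1 - expR (- tau)) = 1 - expR (- tau) ^+ b.
  rewrite mulrC -[RHS]opprB subrX1 -mulNr opprB; congr (_ * _).
by rewrite gerBl exprn_ge0// expR_ge0.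
Qed.

(** Rounding every coordinate down to a multiple of [q] leaves integer vectors with sum at most [m],
    which [card_bounded_sum_le] counts. The parameter [tau] stays free, because the good choice
    depends on the size of the average coordinate compared with [q]. *)
Lemma entropy_le_vector (X : Type) (S : set X) (a : nat) (h : X -> nat -> R)
    (m q tau : R) : 0 < q -> 0 < tau ->
  (forall f k, S f -> (k < a)%N -> 0 <= h f k) ->
  (forall f, S f -> \sum_(k < a) h f k <= m * q) ->
  entropy_le S (fun f g => forall k, (k < a)%N -> `|h f k - h g k| <= q)
    (tau * m - a%:R * ln (1 - expR (- tau))).
Proof.
move=> q0 tau0 h0 hm; pose u f k := h f k / q.
have t1 : 0 < 1 - expR (- tau) by rewrite subr_gt0 -[X in _ < X]expR0 ltr_expR oppr_lt0.
have u0 f k : S f -> (k < a)%N -> 0 <= u f k.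
  by move=> Sf ka; rewrite divr_ge0 ?h0// ltW.
have um f : S f -> \sum_(k < a) u f k <= m.
  by move=> /hm; rewrite -mulr_suml ler_pdivrMr.
pose b := (Num.truncn m).+1.
pose A := [set v : {ffun 'I_a -> 'I_b} | (\sum_k v k)%:R <= m :> R]%SET.
pose c f : {ffun 'I_a -> 'I_b} := [ffun k : 'I_a => inord (Num.truncn (u f k))].
have cE f (k : 'I_a) : S f -> c f k = Num.truncn (u f k) :> nat.
  move=> Sf; rewrite ffunE inordK// ltnS le_truncn// (le_trans _ (um _ Sf))//.
  by rewrite (bigD1 k)//= lerDl sumr_ge0// => i _; rewrite u0.
have cA f : S f -> c f \in A.
  move=> Sf; rewrite inE (le_trans _ (um _ Sf))// natr_sum ler_sum// => k _.
  by rewrite cE// truncn_le u0.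
exists #|A|, (fun f => index (c f) (enum A)); split.
- rewrite (le_trans (card_bounded_sum_le _ _ _ tau0))// expRD -mulrN expRM_natl -lnV ?posrE//.
  by rewrite lnK ?posrE// invr_gt0.
- by move=> f /cA; rewrite cardE index_mem mem_enum.
- move=> f g Sf Sg fg k ka.
  have {}fg : c f = c g.
    have := congr1 (nth (c f) (enum A)) fg.
    by rewrite !nth_index// mem_enum cA.
  have := cE f (Ordinal ka) Sf; rewrite fg cE//= => /esym /(truncn_eq_dist (u0 _ _ Sf ka) (u0 _ _ Sg ka)).
  rewrite /u -mulrBl normrM (gtr0_norm (_ : 0 < q^-1)) ?invr_gt0//.
  by rewrite ler_pdivrMr// mul1r.
Qed.

End entropy.

(** * Concave Lipschitz functions on the unit interval *)

Section unit_concave.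
Variable R : realType.
Implicit Types chi : R -> R.

(** Midpoints are enough: only second differences on dyadic grids occur. *)
Definition midconcave_itv (a b : R) chi := forall u v, a <= u <= b -> a <= v <= b ->
  chi u + chi v <= 2 * chi ((u + v) / 2).

Definition lipschitz_itv (C a b : R) chi := forall u v, a <= u <= b -> a <= v <= b ->
  `|chi u - chi v| <= C * `|u - v|.

Let pt (j k : nat) : R := k%:R / 2 ^+ j.

Let pt01 j k : (k <= 2 ^ j)%N -> 0 <= pt j k <= 1.
Proof.
move=> kj; rewrite /pt divr_ge0// ?exprn_ge0//= ler_pdivrMr ?exprn_gt0// mul1r.
by rewrite -natrX ler_nat.
Qed.

Let ptS j k : pt j.+1 k.*2 = pt j k.
Proof.
have : (2 : R) ^+ j != 0 by rewrite expf_neq0.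
by move=> ?; rewrite /pt -muln2 natrM exprS; field.
Qed.

Let ptmid j k : pt j.+1 k.*2.+1 = (pt j k + pt j k.+1) / 2.
Proof.
rewrite -(ptS j k) -(ptS j k.+1) doubleS /pt -!natr1.
have : (2 : R) ^+ j.+1 != 0 by rewrite expf_neq0.
by move=> ?; field.
Qed.

(* Faber-Schauder coefficients *)
Let fs chi (j k : nat) : R :=
  chi (pt j.+1 k.*2.+1) - (chi (pt j k) + chi (pt j k.+1)) / 2.

Let incr chi (j k : nat) : R := chi (pt j k.+1) - chi (pt j k).

Let fsE chi j k : fs chi j k = (incr chi j.+1 k.*2 - incr chi j.+1 k.*2.+1) / 2.
Proof. by rewrite /fs /incr -doubleS !ptS; field. Qed.

Let fs_ge0 chi j k : midconcave_itv 0 1 chi -> (k < 2 ^ j)%N -> 0 <= fs chi j k.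
Proof.
move=> mc kj; rewrite /fs ptmid.
have := mc _ _ (pt01 (ltnW kj)) (pt01 kj); lra.
Qed.

Let incr_noninc chi j k : midconcave_itv 0 1 chi -> (k.+2 <= 2 ^ j)%N ->
  incr chi j k.+1 <= incr chi j k.
Proof.
move=> mc kj; rewrite /incr.
have := mc _ _ (pt01 (ltnW (ltnW kj))) (pt01 kj).
have -> : (pt j k + pt j k.+2) / 2 = pt j k.+1.
  have : (2 : R) ^+ j != 0 by rewrite expf_neq0.
  by move=> ?; rewrite /pt -[k.+2%:R]natr1 -[k.+1%:R]natr1; field.
lra.
Qed.

Let incr_le chi j k : lipschitz_itv 1 0 1 chi -> (k < 2 ^ j)%N ->
  `|incr chi j k| <= (2 ^+ j)^-1.
Proof.
move=> lc kj; rewrite (le_trans (lc _ _ (pt01 kj) (pt01 (ltnW kj))))//.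
by rewrite mul1r /pt -mulrBl -natr1 addrAC subrr add0r mul1r ger0_norm.
Qed.

(** A coefficient is half the drop between two consecutive increments of level [j.+1]. Every second
    drop is skipped, but all drops are nonnegative, so the sum is at most half the difference of the
    first and the last increment, each bounded by the Lipschitz condition. *)
Let sum_fs_le chi j : midconcave_itv 0 1 chi -> lipschitz_itv 1 0 1 chi ->
  \sum_(k < 2 ^ j) fs chi j k <= (2 ^+ j.+1)^-1.
Proof.
move=> mc lc.
have H n : (0 < n <= 2 ^ j)%N ->
    \sum_(k < n) fs chi j k <= (incr chi j.+1 0 - incr chi j.+1 n.*2.-1) / 2.
  elim: n => // n ih /= nj; rewrite big_ord_recr/=.
  have [n0|n0] := posnP n; first by rewrite n0 big_ord0 add0r fsE double0.
  apply: (le_trans (lerD (ih _) (lexx _))); first by rewrite n0 ltnW.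
  rewrite fsE -mulrDl ler_pM2r ?invr_gt0//.
  have := @incr_noninc chi j.+1 n.*2.-1 mc.
  rewrite prednK ?double_gt0//= => h.
  have : incr chi j.+1 n.*2 <= incr chi j.+1 n.*2.-1.
    by apply: h; rewrite expnS mul2n (leq_trans _ (_ : n.+1.*2 <= _)%N) ?leq_double// doubleS ltnW.
  lra.
have j0 : (0 < 2 ^ j)%N by rewrite expn_gt0.
apply: (le_trans (H _ _)); first by rewrite j0 leqnn.
have k1 : (0 < 2 ^ j.+1)%N by rewrite expn_gt0.
have k2 : ((2 ^ j).*2.-1 < 2 ^ j.+1)%N by rewrite expnS mul2n prednK// double_gt0.
have := incr_le lc k1; have := incr_le lc k2.
by rewrite !ler_norml => /andP[? ?] /andP[? ?]; lra.
Qed.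

(** A new grid point of the next level takes the average of its neighbours plus one coefficient, and
    old points keep their values; so each level adds at most its own tolerance to the error. *)
Let reconstruct chi chi' (q : nat -> R) (e : R) (n : nat) :
  `|chi 0 - chi' 0| <= e -> `|chi 1 - chi' 1| <= e -> (forall j, 0 <= q j) ->
  (forall j, (j < n)%N -> forall k, (k < 2 ^ j)%N -> `|fs chi j k - fs chi' j k| <= q j) ->
  forall k, (k <= 2 ^ n)%N ->
    `|chi (pt n k) - chi' (pt n k)| <= e + \sum_(j < n) q j.
Proof.
move=> e0 e1 q0; elim: n => [|n ih] h k kn.
  rewrite big_ord0 addr0; move: kn; rewrite expn0 /pt expr0 divr1.
  by case: k => [|[|]].
rewrite big_ord_recr/= addrA.
have {}ih := ih (fun j jn => h j (ltnW jn)).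
move: kn; rewrite -(odd_double_half k); case: (odd k) => /= kn.
  rewrite add1n in kn *.
  have kn' : (k./2 < 2 ^ n)%N by rewrite -ltn_double -(mul2n (2 ^ n)) -expnS.
  have := h n (ltnSn n) _ kn'.
  have := ih _ (ltnW kn'); have := ih _ kn'.
  rewrite /fs !ler_norml => /andP[? ?] /andP[? ?] /andP[? ?].
  by apply/andP; split; lra.
rewrite add0n in kn *; rewrite !ptS.
have kn' : (k./2 <= 2 ^ n)%N by rewrite -leq_double -(mul2n (2 ^ n)) -expnS.
by rewrite (le_trans (ih _ kn'))// lerDl q0.
Qed.

Let reconstruct_all chi chi' (e : R) (n : nat) :
  lipschitz_itv 1 0 1 chi -> lipschitz_itv 1 0 1 chi' ->
  (forall k, (k <= 2 ^ n)%N -> `|chi (pt n k) - chi' (pt n k)| <= e) ->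
  forall t, 0 <= t <= 1 -> `|chi t - chi' t| <= e + 2 / 2 ^+ n.
Proof.
move=> lc lc' h t /andP[t0 t1].
have n0 : 0 < (2 : R) ^+ n by rewrite exprn_gt0.
have tn0 : 0 <= t * 2 ^+ n by rewrite mulr_ge0// ltW.
pose k := Num.truncn (t * 2 ^+ n).
have kn : (k <= 2 ^ n)%N.
  rewrite -(@ler_nat R) (@le_trans _ _ (t * 2 ^+ n))//; first by rewrite truncn_le.
  by rewrite natrX ler_piMl// ltW.
have dt : `|t - pt n k| <= (2 ^+ n)^-1.
  have /andP[h1 h2] := truncn_itv tn0; rewrite -/k in h1 h2.
  rewrite ger0_norm; last by rewrite subr_ge0 /pt ler_pdivrMr.
  rewrite lerBlDr /pt -[X in X + _]mul1r -mulrDl ler_pdivlMr//.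
  by rewrite nat1r ltW.
have t01 : 0 <= t <= 1 by rewrite t0.
have := lc _ _ t01 (pt01 kn); have := lc' _ _ t01 (pt01 kn); have := h _ kn.
rewrite !mul1r !ler_norml => /andP[? ?] /andP[? ?] /andP[? ?].
set r := (_^-1) in dt *.
by apply/andP; split; lra.
Qed.

Let ln_pow_le (a : R) (i : nat) : 0 < a -> ln a <= 2 -> ln (2 * a ^+ i) <= 1 + 2 * i%:R.
Proof.
move=> a0 la; rewrite lnM ?posrE ?exprn_gt0// lnXn// lerD//.
  by have := @le_ln1Dx R 1; rewrite (_ : 1 + 1 = 2)//; apply; lra.
by rewrite -[ln a *+ i]mulr_natr ler_wpM2r.
Qed.

(** The level [j] lies [i] below the critical level [J = j + i]. With [tau = 3 ^- i] the first term
    equals [2 ^ J (8/9) ^ i / 2]. Since [1 - expR (- tau) >= tau / 2], each of the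
    [2 ^ j = 2 ^ J / 2 ^ i] coefficients adds at most [1 + 2 i]. *)
Let level_numeric_low (j i : nat) :
  3^-1 ^+ i * ((2 ^+ j.+1)^-1 / ((4 ^+ (j + i))^-1 * (3 / 4) ^+ i))
    - (2 ^ j)%:R * ln (1 - expR (- (3^-1 ^+ i))) <= 4 * 2 ^+ (j + i) * (8 / 9) ^+ i :> R.
Proof.
set tau := 3^-1 ^+ i.
have tau0 : 0 < tau by rewrite exprn_gt0.
have tau1 : tau <= 1 by rewrite exprn_ile1//; lra.
have two0 : 0 < (2 : R) ^+ j by rewrite exprn_gt0.
have -> : tau * ((2 ^+ j.+1)^-1 / ((4 ^+ (j + i))^-1 * (3 / 4) ^+ i)) =
    2 ^+ (j + i) * (8 / 9) ^+ i / 2.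
  rewrite /tau (_ : 4 = 2 * 2 :> R); last by ring.
  rewrite (_ : 8 = 2 * 2 * 2 :> R); last by ring.
  rewrite (_ : 9 = 3 * 3 :> R); last by ring.
  rewrite !exprMn !exprVn !exprMn !exprD exprS.
  have := @expf_neq0 R 2 i; have := @expf_neq0 R 3 i; have := @expf_neq0 R 2 j.
  by move=> h1 h2 h3; field; rewrite h1 ?h2 ?h3.
have ltau : - ln (1 - expR (- tau)) <= 1 + 2 * i%:R.
  apply: (@le_trans _ _ (- ln (tau / 2))).
    rewrite lerN2 ler_ln ?posrE ?divr_gt0//; last first.
      by rewrite subr_gt0 -[X in _ < X]expR0 ltr_expR oppr_lt0.
    have : expR (- tau) <= (1 + tau)^-1.
      by rewrite expRN lef_pV2 ?posrE ?expR_gt0 ?expR_ge1Dx// addr_gt0.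
    have : (1 + tau)^-1 <= 1 - tau / 2.
      rewrite -[X in X <= _]mul1r ler_pdivrMr ?addr_gt0//; nra.
    lra.
  rewrite -lnV ?posrE ?divr_gt0// invfM invrK /tau exprVn invrK mulrC.
  apply: ln_pow_le => //; have -> : (3 : R) = 1 + 2 by ring.
  by apply: le_ln1Dx; lra.
have bern : 1 + 2 * i%:R <= 3 * (16 / 9) ^+ i :> R.
  elim: (i) => [|n ih]; first by rewrite expr0; lra.
  rewrite -natr1 exprS; have : 1 <= (16 / 9 : R) ^+ n by rewrite exprn_ege1//; lra.
  by move=> ?; lra.
have -> : 4 * 2 ^+ (j + i) * (8 / 9) ^+ i = 2 ^+ (j + i) * (8 / 9) ^+ i / 2
    + 2 ^+ j * (7 / 2 * (16 / 9) ^+ i) :> R.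
  have e : 16 / 9 = 2 * (8 / 9) :> R by field.
  by rewrite exprD e [(2 * (8 / 9)) ^+ i]exprMn; field.
rewrite lerD2l -mulrN natrX ler_wpM2l ?(ltW two0)//.
have : 0 <= (16 / 9 : R) ^+ i by rewrite exprn_ge0//; lra.
lra.
Qed.

(** The level lies [i] above the critical level [J]. With [expR tau = 2 * 4 ^ i] the [2 ^ (J + i)]
    coefficients add at most [2 ^ J / 2 ^ i] through the logarithm, and the bounded sum adds
    [tau 2 ^ J (2/3) ^ i / 2], where [tau] is at most linear in [i]. *)
Let level_numeric_high (J i : nat) :
  ln (2 * 4 ^+ i) * ((2 ^+ (J + i).+1)^-1 / ((4 ^+ J)^-1 * (3 / 4) ^+ i))
    - (2 ^ (J + i))%:R * ln (1 - expR (- ln (2 * 4 ^+ i)))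
    <= 4 * 2 ^+ J * (8 / 9) ^+ i :> R.
Proof.
have two0 : 0 < (2 : R) ^+ J by rewrite exprn_gt0.
have twoi : 1 <= (2 : R) ^+ i by rewrite exprn_ege1//; lra.
have four : (4 : R) ^+ i = 2 ^+ i * 2 ^+ i.
  by rewrite -exprMn; congr (_ ^+ _); ring.
have -> : (2 ^+ (J + i).+1)^-1 / ((4 ^+ J)^-1 * (3 / 4) ^+ i) =
    2 ^+ J * (2 / 3) ^+ i / 2 :> R.
  rewrite (_ : 4 = 2 * 2 :> R); last by ring.
  rewrite !exprMn !exprVn !exprMn exprS !exprD.
  have := @expf_neq0 R 2 i; have := @expf_neq0 R 3 i; have := @expf_neq0 R 2 J.
  by move=> h1 h2 h3; field; rewrite h1 ?h2 ?h3.
rewrite expRN lnK ?posrE ?mulr_gt0 ?exprn_gt0//.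
set t := (2 * 4 ^+ i)^-1.
have t0 : 0 < t by rewrite invr_gt0 mulr_gt0// exprn_gt0.
have t2 : t <= 1 / 2.
  rewrite /t div1r lef_pV2 ?posrE ?mulr_gt0 ?exprn_gt0//.
  by rewrite four; nra.
have h1t : 0 < 1 - t by lra.
have lt : - ln (1 - t) <= 2 * t.
  rewrite -lnV ?posrE// -[leRHS]expRK ler_ln ?posrE ?expR_gt0 ?invr_gt0//.
  apply: le_trans (expR_ge1Dx _).
  rewrite -[X in X <= _]mul1r ler_pdivrMr//.
  by nra.
have lt2 : (2 ^ (J + i))%:R * - ln (1 - t) <= 2 ^+ J * (2^-1 ^+ i) :> R.
  rewrite natrX exprD -mulrA ler_wpM2l ?(ltW two0)//.
  apply: (@le_trans _ _ (2 ^+ i * (2 * t))); first by rewrite ler_wpM2l// exprn_ge0.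
  rewrite /t four exprVn le_eqVlt; apply/orP; left; apply/eqP.
  by have := @expf_neq0 R 2 i; move=> h; field; rewrite h.
have bern : 1 + 2 * i%:R <= 6 * (4 / 3) ^+ i :> R.
  elim: (i) => [|n ih]; first by rewrite expr0; lra.
  rewrite -[n.+1%:R]natr1 exprS; have : 1 <= (4 / 3 : R) ^+ n by rewrite exprn_ege1//; lra.
  by move=> ?; lra.
have ltau : ln (2 * 4 ^+ i) <= 1 + 2 * i%:R :> R.
  apply: ln_pow_le => //; have -> : (4 : R) = 2 ^+ 2 by ring.
  rewrite lnXn// mulr2n; have := @le_ln1Dx R 1; rewrite (_ : 1 + 1 = 2)//.
  have h : (-1 : R) < 1 by lra.
  by move=> /(_ h) ?; lra.
have {}ltau : ln (2 * 4 ^+ i) * (2 ^+ J * (2 / 3) ^+ i / 2) <= 3 * (2 ^+ J * (8 / 9) ^+ i) :> R.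
  have -> : 3 * (2 ^+ J * (8 / 9) ^+ i) = 6 * (4 / 3) ^+ i * (2 ^+ J * (2 / 3) ^+ i / 2) :> R.
    have e : 8 / 9 = (4 / 3) * (2 / 3) :> R by field.
    by rewrite e [(4 / 3 * (2 / 3)) ^+ i]exprMn; field.
  apply: ler_wpM2r; last exact: le_trans bern.
  have : 0 <= (2 / 3 : R) ^+ i by rewrite exprn_ge0//; lra.
  by move=> ?; rewrite divr_ge0// mulr_ge0// ltW.
have h : (2^-1 : R) ^+ i <= (8 / 9) ^+ i by apply: lerXn2r; rewrite ?nnegrE; lra.
by rewrite -mulrN; nra.
Qed.

(** This is [|J - j|]: one of the truncated subtractions vanishes. *)
Let dev (J j : nat) : nat := (J - j + (j - J))%N.

Let unit_class (B : R) : set (R -> R) := [set chi | [/\ midconcave_itv 0 1 chi,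
  lipschitz_itv 1 0 1 chi & `|chi 0| <= B]].

(** Level [j] has [2 ^ j] coefficients with average at most [4 ^- j / 2], which is comparable to the
    tolerance at [j = J]. Below [J] there are few coefficients; above [J] most of them round to 0.
    Tightening the tolerance by 3/4 per level away from [J] makes the errors summable, while the
    cost still decays by 8/9 per level. *)
Let level_entropy (B : R) (J j : nat) :
  @entropy_le R _ (unit_class B) (fun chi chi' => forall k, (k < 2 ^ j)%N ->
      `|fs chi j k - fs chi' j k| <= (4 ^+ J)^-1 * (3 / 4) ^+ dev J j)
    (4 * 2 ^+ J * (8 / 9) ^+ dev J j).
Proof.
set q := _ * _.
have q0 : 0 < q by rewrite mulr_gt0 ?invr_gt0 ?exprn_gt0//; lra.
have h0 chi k : unit_class B chi -> (k < 2 ^ j)%N -> 0 <= fs chi j k.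
  by move=> [mc _ _] kj; exact: fs_ge0.
have hm chi : unit_class B chi -> \sum_(k < 2 ^ j) fs chi j k <= (2 ^+ j.+1)^-1 / q * q.
  by move=> [mc lc _]; rewrite divfK ?gt_eqF//; exact: sum_fs_le.
rewrite /q /dev in q0 hm *; case: (leqP j J) => jJ.
  have tau0 : 0 < 3^-1 ^+ (J - j) :> R by rewrite exprn_gt0.
  apply: entropy_le_sub (entropy_le_vector q0 tau0 h0 hm) _ _ _ => //.
  rewrite (eqP jJ) addn0; have := level_numeric_low j (J - j); rewrite subnKC//.
have tau0 : 0 < ln (2 * 4 ^+ (j - J)) :> R.
  rewrite ln_gt0//; have : 1 <= (4 : R) ^+ (j - J) by rewrite exprn_ege1//; lra.
  by lra.
apply: entropy_le_sub (entropy_le_vector q0 tau0 h0 hm) _ _ _ => //.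
have := level_numeric_high J (j - J); rewrite subnKC ?(ltnW jJ)//.
by move: jJ => /ltnW; rewrite -subn_eq0 => /eqP ->; rewrite add0n.
Qed.

Lemma geometric_sum_le (x : R) (n : nat) : 0 <= x < 1 -> \sum_(i < n) x ^+ i <= (1 - x)^-1.
Proof.
move=> /andP[x0 x1]; rewrite -[leRHS]mul1r ler_pdivlMr ?subr_gt0//.
have -> : (\sum_(i < n) x ^+ i) * (1 - x) = 1 - x ^+ n.
  by rewrite mulrC -[RHS]opprB subrX1 -mulNr opprB.
by rewrite gerBl exprn_ge0.
Qed.

Let sum_dev (x : R) (J n : nat) : 0 <= x < 1 ->
  \sum_(j < n) x ^+ dev J j <= 2 * (1 - x)^-1.
Proof.
move=> x01; have /andP[x0 x1] := x01.
apply: (@le_trans _ _ (\sum_(0 <= j < J + n) x ^+ dev J j)).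
  rewrite -(big_mkord xpredT (fun j => x ^+ dev J j)) (big_cat_nat _ (leq_addl J n))//=.
  by rewrite lerDl sumr_ge0// => i _; rewrite exprn_ge0.
rewrite (big_cat_nat _ (leq_addr n J))//= mulr2n mulrDl !mul1r lerD//.
  rewrite big_nat_rev/= big_mkord add0n (le_trans _ (geometric_sum_le J x01))// ler_sum// => i _.
  rewrite /dev subKn// (_ : J - i.+1 - J = 0)%N ?addn0; last first.
    by apply/eqP; rewrite subn_eq0 leq_subr.
  by rewrite ler_wiXn2l ?(ltW x1).
rewrite -{1}[J]add0n big_addn addKn big_mkord (le_trans _ (geometric_sum_le n x01))// ler_sum// => i _.
by rewrite /dev addnK (_ : J - (i + J) = 0)%N//; apply/eqP; rewrite subn_eq0 leq_addl.
Qed.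

(** Coding the levels below [2 J] reaches a grid of step [4 ^- J], between whose points the two
    functions drift apart by at most [2 * 4 ^- J]. With [4 ^- J] at the endpoints and [8 * 4 ^- J]
    from the levels this makes 11. The cost is [72 = 4 * 18], where 18 bounds the two geometric
    series of ratio 8/9. *)
Lemma unit_class_entropy (B : R) (J : nat) : 0 <= B ->
  @entropy_le R _ (unit_class B)
    (fun chi chi' => forall t, 0 <= t <= 1 -> `|chi t - chi' t| <= 11 * (4 ^+ J)^-1)
    (72 * 2 ^+ J + 2 * ln (2 * (B + 1) * 4 ^+ J + 1)).
Proof.
move=> B0; have q0 : 0 < (4 ^+ J)^-1 :> R by rewrite invr_gt0 exprn_gt0.
have B1 : 0 <= B + 1 by rewrite addr_ge0.
have v0 : @entropy_le R _ (unit_class B) (fun chi chi' => `|chi 0 - chi' 0| <= (4 ^+ J)^-1)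
    (ln (2 * (B + 1) * 4 ^+ J + 1)).
  have h := @entropy_le_value R _ (unit_class B) (fun chi => chi 0) (B + 1) _ B1 q0.
  rewrite invrK in h; apply: h => chi [_ _ chiB].
  by rewrite (le_trans chiB)// lerDl.
have v1 : @entropy_le R _ (unit_class B) (fun chi chi' => `|chi 1 - chi' 1| <= (4 ^+ J)^-1)
    (ln (2 * (B + 1) * 4 ^+ J + 1)).
  have h := @entropy_le_value R _ (unit_class B) (fun chi => chi 1) (B + 1) _ B1 q0.
  rewrite invrK in h; apply: h => chi [_ lc chiB].
  have := lc 1 0; rewrite !lexx !ler01 => /(_ isT isT).
  rewrite subr0 normr1 mulr1 => h; rewrite -[chi 1](subrK (chi 0)) (le_trans (ler_normD _ _))//.
  by rewrite addrC lerD.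
have := entropy_le_forall (fun j (_ : (j < J.*2)%N) => level_entropy B J j).
move=> /(entropy_le_and (entropy_le_and v0 v1)) h.
apply: entropy_le_sub h _ _ _ => //.
  rewrite addrC lerD//; last by lra.
  have r89 : 0 <= (8 / 9 : R) < 1 by apply/andP; split; lra.
  have := sum_dev J J.*2 r89; have -> : 2 / (1 - 8 / 9) = 18 :> R by field.
  have : 0 <= (2 : R) ^+ J by rewrite exprn_ge0.
  rewrite -mulr_sumr => h1 h2; have := ler_wpM2l h1 h2.
  by rewrite -[4 * _ * _]mulrA; set y := 2 ^+ J * \sum_(_ < _) _; lra.
move=> chi chi' [mc lc _] [mc' lc' _] [[h0 h1] hfs] t t01.
have q0' j : 0 <= (4 ^+ J)^-1 * (3 / 4) ^+ dev J j :> R.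
  by rewrite mulr_ge0 ?(ltW q0)// exprn_ge0//; lra.
apply: le_trans (reconstruct_all lc lc' (reconstruct h0 h1 q0' hfs) t01) _.
rewrite -mulr_sumr.
have -> : (2 : R) ^+ J.*2 = 4 ^+ J.
  by rewrite -mul2n exprM; congr (_ ^+ _); ring.
have : (4 ^+ J)^-1 * \sum_(j < J.*2) (3 / 4 : R) ^+ dev J j <= (4 ^+ J)^-1 * 8.
  have r34 : 0 <= (3 / 4 : R) < 1 by apply/andP; split; lra.
  by rewrite ler_wpM2l ?(ltW q0)//; have := sum_dev J J.*2 r34;
    have -> : 2 / (1 - 3 / 4) = 8 :> R by field.
by set r := (_ ^-1); lra.
Qed.

(** Division by [C] reduces to Lipschitz constant 1. The least [J] with [11 C / eta <= 4 ^ J]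
    satisfies [4 ^ J <= 44 C / eta + 1], so that [2 ^ J] has the order of [Num.sqrt (C / eta)]. *)
Lemma concave_lipschitz_entropy (C B eta : R) : 0 < C -> 0 <= B -> 0 < eta ->
  @entropy_le R _ [set chi : R -> R | [/\ midconcave_itv 0 1 chi,
      lipschitz_itv C 0 1 chi & `|chi 0| <= B]]
    (fun chi chi' => forall t, 0 <= t <= 1 -> `|chi t - chi' t| <= eta)
    (72 * (7 * Num.sqrt (C / eta) + 1)
     + 2 * ln (2 * (B / C + 1) * (44 * (C / eta) + 1) + 1)).
Proof.
move=> C0 B0 eta0; set x := C / eta.
have x0 : 0 < x by rewrite divr_gt0.
have exJ : exists J, 11 * x <= 4 ^+ J.
  have [n hn] : exists n : nat, 11 * x <= n%:R.
    by exists (Num.truncn (11 * x)).+1; rewrite ltW// truncnS_gt.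
  exists n; rewrite (le_trans hn)// -natrX ler_nat ltnW//; exact: ltn_expl.
pose J := ex_minn exJ.
have [J1 J2] : 11 * x <= 4 ^+ J /\ 4 ^+ J <= 44 * x + 1.
  rewrite /J; case: ex_minnP => -[|n] hn mn; split=> //; first by rewrite expr0; lra.
  have : ~~ (11 * x <= 4 ^+ n) by apply/negP => /mn; rewrite ltnn.
  by rewrite -ltNge exprS => ?; lra.
have J3 : 2 ^+ J <= 7 * Num.sqrt x + 1.
  rewrite -(@ler_pXn2r _ 2)// ?nnegrE ?exprn_ge0// ?addr_ge0 ?mulr_ge0 ?sqrtr_ge0//.
  have -> : (2 ^+ J) ^+ 2 = 4 ^+ J :> R by rewrite -exprM mulnC exprM; congr (_ ^+ _); ring.
  rewrite (le_trans J2)// sqrrD1 exprMn sqr_sqrtr ?(ltW x0)//.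
  by have := sqrtr_ge0 x; have := ltW x0; lra.
have h := @unit_class_entropy (B / C) J (divr_ge0 B0 (ltW C0)).
have h' := @entropy_le_preimage R _ _ (fun chi t => chi t / C) _ _ _ _ _ h.
apply: (entropy_le_sub (h' [set chi : R -> R | [/\ midconcave_itv 0 1 chi,
      lipschitz_itv C 0 1 chi & `|chi 0| <= B]] _)) => //.
- move=> chi [mc lc cB]; split.
  + move=> u v u01 v01; have := mc _ _ u01 v01.
    by rewrite -mulrDl mulrA ler_pM2r ?invr_gt0.
  + move=> u v u01 v01; have := lc _ _ u01 v01.
    by rewrite mul1r -mulrBl normrM (gtr0_norm (_ : 0 < C^-1)) ?invr_gt0// ler_pdivrMr// mulrC.
  + by rewrite normrM (gtr0_norm (_ : 0 < C^-1)) ?invr_gt0// ler_pM2r ?invr_gt0.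
- have BC : 0 <= B / C by rewrite divr_ge0// ltW.
  have J0 : 0 < (4 : R) ^+ J by rewrite exprn_gt0.
  rewrite lerD//; first by lra.
  rewrite ler_pM2l// ler_ln ?posrE; [|nra|nra].
  by rewrite lerD2r ler_pM2l//; lra.
- move=> chi chi' [mc lc cB] [mc' lc' cB'] H t t01.
  have := H t t01; rewrite -mulrBl normrM (gtr0_norm (_ : 0 < C^-1)) ?invr_gt0//.
  rewrite ler_pdivrMr// => /le_trans; apply.
  rewrite mulrAC ler_pdivrMr ?exprn_gt0//.
  by move: J1; rewrite /x mulrA ler_pdivrMr// => ?; lra.
Qed.

End unit_concave.

(** * Log-concave functions on a half-line and their breakpoints *)

Section half_line.
Variable R : realType.
Implicit Types f g : R -> R.

(** Real logarithms are easier to compute with than [lne], but [ln] is 0 on nonpositive numbers;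
    hence the positivity premises and the positivity in the conclusion. *)
Definition ln_concave f := forall u v t : R, 0 <= t <= 1 -> 0 < f u -> 0 < f v ->
  0 < f (t * u + (1 - t) * v) /\
  t * ln (f u) + (1 - t) * ln (f v) <= ln (f (t * u + (1 - t) * v)).

(** The chord inequality is cleared of denominators, so that it also makes sense for [u = x]. *)
Lemma ln_concave3 f u v x : ln_concave f -> u <= v <= x -> 0 < f u -> 0 < f x ->
  0 < f v /\ (x - v) * ln (f u) + (v - u) * ln (f x) <= (x - u) * ln (f v).
Proof.
move=> fc /andP[uv vx] fu fx.
have [ux|ux|ux] := ltgtP u x; last 2 first.
- by move: (le_trans uv vx); rewrite leNgt ux.
- have vu : v = u by apply/eqP; rewrite eq_le uv ux vx.
  by rewrite -ux vu subrr !mul0r addr0.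
have d0 : 0 < x - u by rewrite subr_gt0.
have t01 : 0 <= (x - v) / (x - u) <= 1.
  by rewrite divr_ge0 ?subr_ge0 ?(ltW ux)//= ler_pdivrMr// mul1r; lra.
have [] := fc u x _ t01 fu fx.
have -> : (x - v) / (x - u) * u + (1 - (x - v) / (x - u)) * x = v.
  by field; rewrite gt_eqF.
move=> fv h; split=> //.
have := ler_wpM2l (ltW d0) h.
by congr (_ <= _); field; rewrite gt_eqF.
Qed.

Lemma sqrt_sub_sq_le_max (p q : R) : 0 <= p -> 0 <= q ->
  (Num.sqrt p - Num.sqrt q) ^+ 2 <= Num.max p q.
Proof.
move=> p0 q0; have := sqr_sqrtr p0; have := sqr_sqrtr q0.
have := sqrtr_ge0 p; have := sqrtr_ge0 q.
rewrite le_max; have [pq|/ltW pq] := leP p q.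
  by move: (pq); rewrite -ler_sqrt// => *; apply/orP; right; nra.
by move: (pq); rewrite -ler_sqrt// => *; apply/orP; left; nra.
Qed.

(** For [q <= p] and [d = ln p - ln q] the left side is [p (1 - expR (- d / 2)) ^ 2]. The square on
    [eta] is what allows errors of [ln f] as large as the Hellinger precision. *)
Lemma sqrt_sub_sq_le_ln (p q M eta : R) : 0 < p -> 0 < q -> p <= M -> q <= M ->
  `|ln p - ln q| <= eta -> (Num.sqrt p - Num.sqrt q) ^+ 2 <= M * eta ^+ 2.
Proof.
move=> + + + + +; wlog qp : p q / q <= p.
  move=> H p0 q0 pM qM d; have [pq|/ltW pq] := leP p q; last exact: H.
  by rewrite -opprB sqrrN; apply: H => //; rewrite distrC.
move=> p0 q0 pM qM; set d := ln p - ln q => hd.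
have d0 : 0 <= d by rewrite subr_ge0 ler_ln.
have sq : Num.sqrt q = Num.sqrt p * expR (- d / 2).
  have -> : q = p * expR (- d / 2) ^+ 2.
    rewrite -expRM_natl (_ : 2%:R * (- d / 2) = ln q - ln p); last by rewrite /d; field.
    by rewrite expRB !lnK ?posrE// mulrCA divff ?mulr1// gt_eqF.
  by rewrite sqrtrM ?(ltW p0)// sqrtr_sqr ger0_norm ?expR_ge0.
have e1 := expR_ge1Dx (- d / 2).
have e2 : expR (- d / 2) <= 1 by rewrite -[leRHS]expR0 ler_expR; lra.
rewrite sq -{1}[Num.sqrt p]mulr1 -mulrBr exprMn sqr_sqrtr ?(ltW p0)//.
rewrite ger0_norm// in hd.
by apply: ler_pM; rewrite ?sqr_ge0 ?(ltW p0)//; nra.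
Qed.

Variables (L c0 Lam : R) (L1 : 1 <= L) (c0_gt0 : 0 < c0) (c01 : c0 <= 1) (Lam0 : 0 <= Lam).

(** The last condition caps the slope of [ln f] from above by [Lam]. No lower bound on the slope is
    imposed, since [f] may vanish from some point on; the breakpoints take care of that. *)
Definition half_line_class : set (R -> R) := [set f | [/\
  ln_concave f,
  forall x, 0 <= x -> 0 <= f x <= L * expR (- x),
  c0 <= f 0 &
  forall u v, 0 <= u -> u <= v -> f v <= f u * expR (Lam * (v - u)) ]].

Section breakpoints.
Variables (T : nat).

(** The slope condition is multiplicative, so that zeros of [f] need no separate treatment; the cap
    [T * 2 ^ i] makes a largest [k] exist. *)
Let good f i k := `[< forall u v, 0 <= u -> u <= v -> v <= k%:R / 2 ^+ i ->
  f u <= f v * expR (2 ^+ i * (v - u)) >] && (k <= T * 2 ^ i)%N.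

Let ex_good f i : exists k, good f i k.
Proof.
exists 0%N; apply/andP; split => //; apply/asboolP => u v u0 uv; rewrite mul0r => v0.
have -> : v = u by apply/eqP; rewrite eq_le uv (le_trans v0).
by rewrite subrr mulr0 expR0 mulr1.
Qed.

Let good_bounded f i k : good f i k -> (k <= T * 2 ^ i)%N.
Proof. by case/andP. Qed.

(* Up to breakpoint [i] the slope of [ln f] is at least [- 2 ^ i], and at most
   [- 2 ^ i] one grid step [2 ^- i] later. *)
Definition breakpoint f i : nat :=
  if i is 0%N then 0%N else ex_maxn (ex_good f i) (@good_bounded f i).

Definition breakpointR f i : R := (breakpoint f i)%:R / 2 ^+ i.

Let two_gt0 i : 0 < (2 : R) ^+ i. Proof. by rewrite exprn_gt0. Qed.

Lemma breakpoint_le f i : (breakpoint f i <= T * 2 ^ i)%N.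
Proof. by case: i => //= i; case: ex_maxnP => k /good_bounded. Qed.

Lemma breakpointR_ge0 f i : 0 <= breakpointR f i.
Proof. by rewrite divr_ge0// ltW. Qed.

Lemma breakpointR_le f i : breakpointR f i <= T%:R.
Proof. by rewrite /breakpointR ler_pdivrMr// -natrX -natrM ler_nat breakpoint_le. Qed.

Lemma breakpoint_slope f i u v : 0 <= u -> u <= v -> v <= breakpointR f i ->
  f u <= f v * expR (2 ^+ i * (v - u)).
Proof.
rewrite /breakpointR; case: i => [|i] u0 uv /=.
  rewrite mul0r => v0; have -> : v = u by apply/eqP; rewrite eq_le uv (le_trans v0).
  by rewrite subrr mulr0 expR0 mulr1.
by case: ex_maxnP => k /andP[/asboolP h _] _ vk; exact: h.
Qed.

(** At level 0 the envelope [L * expR (- x)] is already the claim. At a higher level, maximality of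
    the breakpoint yields two points, at most one grid step past it, between which [f] drops faster
    than the rate; by concavity the steep slope persists up to [x]. The factor [expR 1] pays for the
    grid step. *)
Lemma breakpoint_decay f i x : half_line_class f -> breakpointR f i <= x -> x < T%:R ->
  f x <= L * expR 1 * expR (- (2 ^+ i * (x - breakpointR f i))).
Proof.
move=> [fc fL f0 flam] yx xT.
have L0 : 0 <= L by rewrite (le_trans _ L1).
have e1 : 1 <= expR 1 :> R by rewrite -[X in X <= _]expR0 ler_expR.
have x0 : 0 <= x by rewrite (le_trans _ yx)// breakpointR_ge0.
have fL' z : 0 <= z -> f z <= L.
  move=> z0; have /andP[_ /le_trans] := fL _ z0; apply.
  by rewrite ler_piMr// -[leRHS]expR0 ler_expR oppr_le0.
case: i yx => [|i] yx.
  have /andP[_ /le_trans] := fL _ x0; apply.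
  rewrite expr0 mul1r /breakpointR mul0r subr0 ler_wpM2r ?expR_ge0//.
  by rewrite ler_peMr.
set y := breakpointR f i.+1 in yx *; set lam := 2 ^+ i.+1.
have lam0 : 0 < lam by exact: two_gt0.
have [h|h] := leP (lam * (x - y)) 1.
  rewrite (le_trans (fL' _ x0))// -mulrA ler_peMr// -expRD -[X in X <= _]expR0 ler_expR.
  by rewrite subr_ge0.
have yE : (breakpoint f i.+1).+1%:R / lam = y + lam^-1.
  by rewrite /y /breakpointR -natr1 mulrDl mul1r.
have y1x : y + lam^-1 < x.
  by rewrite -ltrBDl -[X in X < _]mul1r ltr_pdivrMr// [ltRHS]mulrC.
(* The next grid point is not good, either because of the slope or because it exceeds [T]; the
   latter would push [x] beyond [T]. *)
have : ~~ good f i.+1 (breakpoint f i.+1).+1.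
  by rewrite [breakpoint _ _]/=; case: ex_maxnP => k _ kmax; apply/negP => /kmax; rewrite ltnn.
rewrite negb_and => /orP[|]; last first.
  rewrite -ltnNge => kT; suff : T%:R < x by rewrite ltNge (ltW xT).
  apply: le_lt_trans y1x; rewrite -yE ler_pdivlMr// /lam -natrX -natrM.
  by rewrite ler_nat ltnW.
move=> /asboolPn /existsNP[u] /existsNP[v] /not_implyP[u0] /not_implyP[uv] /not_implyP[vk] /negP.
rewrite -ltNge yE in vk * => hlt.
have fu : 0 < f u.
  apply: le_lt_trans hlt; rewrite mulr_ge0 ?expR_ge0//.
  by have /andP[] := fL _ (le_trans u0 uv).
have uLtv : u < v.
  rewrite lt_neqAle uv andbT; apply/eqP => uv'.
  by move: hlt; rewrite uv' subrr mulr0 expR0 mulr1 ltxx.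
have [fx|fx] := leP (f x) 0.
  by rewrite (le_trans fx)// !mulr_ge0// expR_ge0.
have uvx : u <= v <= x by rewrite uv (le_trans vk)// ltW.
have [fv h3] := ln_concave3 fc uvx fu fx.
have hln : ln (f v) + lam * (v - u) < ln (f u).
  by rewrite -[X in _ + X]expRK -lnM ?posrE ?expR_gt0// ltr_ln ?posrE ?mulr_gt0 ?expR_gt0.
have : ln (f x) <= ln (f u) - lam * (x - u).
  have vx : v <= x by rewrite (le_trans vk)// ltW.
  have d1 : 0 < v - u by rewrite subr_gt0.
  have d2 : 0 <= x - v by rewrite subr_ge0.
  rewrite -(ler_pM2l d1).
  have d3 : 0 <= x - u by lra.
  by have := ler_wpM2l d3 (ltW hln); lra.
rewrite -ler_expR expRB !lnK ?posrE// => /le_trans; apply.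
rewrite -expRN -mulrA; apply: ler_pM; rewrite ?expR_ge0 ?(ltW fu) ?fL'//.
rewrite -expRD ler_expR.
have : lam * u <= lam * (y + lam^-1) by rewrite ler_pM2l// (le_trans uv).
by rewrite mulrDr divff ?gt_eqF//; lra.
Qed.

End breakpoints.
End half_line.

(** * Cells between consecutive breakpoints *)

Section cells.
Variable R : realType.
Implicit Types f g : R -> R.
Variables (L c0 Lam : R) (L1 : 1 <= L) (c0_gt0 : 0 < c0) (c01 : c0 <= 1) (Lam0 : 0 <= Lam).
Variable T : nat.

Let H := half_line_class L c0 Lam.
Let y f i := breakpointR T f i.

Let two_gt0 i : 0 < (2 : R) ^+ i. Proof. by rewrite exprn_gt0. Qed.

Let H_ge0 f x : H f -> 0 <= x -> 0 <= f x.
Proof. by move=> [_ h _ _] /h/andP[]. Qed.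

Let H_leL f x : H f -> 0 <= x -> f x <= L.
Proof.
move=> [_ h _ _] x0; have /andP[_ /le_trans] := h _ x0; apply.
by rewrite ler_piMr ?(le_trans _ L1)// -[leRHS]expR0 ler_expR oppr_le0.
Qed.

Let zone_lower f i v : H f -> 0 <= v -> v <= y f i ->
  c0 * expR (- (2 ^+ i * v)) <= f v.
Proof.
move=> Hf v0 vy; have [_ _ f0 _] := Hf.
have := breakpoint_slope (lexx 0) v0 vy; rewrite subr0 => h.
rewrite expRN ler_pdivrMr ?expR_gt0//.
exact: le_trans h.
Qed.

Let zone_pos f i v : H f -> 0 <= v -> v <= y f i -> 0 < f v.
Proof.
by move=> Hf v0 vy; apply: lt_le_trans (zone_lower Hf v0 vy); rewrite mulr_gt0 ?expR_gt0.
Qed.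

Let zone_lipschitz f i u v : H f -> 0 <= u -> 0 <= v -> u <= y f i -> v <= y f i ->
  `|ln (f u) - ln (f v)| <= (2 ^+ i + Lam) * `|u - v|.
Proof.
move=> Hf; wlog uv : u v / u <= v.
  move=> W u0 v0 uy vy; have [uv|/ltW uv] := leP u v; first exact: W.
  by rewrite distrC (distrC u); exact: W.
move=> u0 v0 uy vy.
have fu := zone_pos Hf u0 uy; have fv := zone_pos Hf v0 vy.
rewrite (distrC u) (ger0_norm (_ : 0 <= v - u)) ?subr_ge0//.
have uv0 : 0 <= v - u by rewrite subr_ge0.
have h1 : ln (f u) <= ln (f v) + 2 ^+ i * (v - u).
  rewrite -[X in _ + X]expRK -lnM ?posrE ?expR_gt0// ler_ln ?posrE ?mulr_gt0 ?expR_gt0//.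
  exact: (breakpoint_slope u0 uv vy).
have h2 : ln (f v) <= ln (f u) + Lam * (v - u).
  rewrite -[X in _ + X]expRK -lnM ?posrE ?expR_gt0// ler_ln ?posrE ?mulr_gt0 ?expR_gt0//.
  by have [_ _ _ h] := Hf; exact: h.
have := mulr_ge0 (ltW (two_gt0 i)) uv0; have := mulr_ge0 Lam0 uv0.
by rewrite ler_norml mulrDl => ? ?; apply/andP; split; lra.
Qed.

(* The value 0 marks a cell that passes the next breakpoint. *)
Definition cell f (i m : nat) (t : R) : R :=
  if y f i + m.+1%:R / 2 ^+ i.+1 <= y f i.+1
  then ln (f (y f i + (m%:R + t) / 2 ^+ i.+1)) else 0.

Let cell_pt f i m t : y f i + m.+1%:R / 2 ^+ i.+1 <= y f i.+1 -> 0 <= t <= 1 ->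
  0 <= y f i + (m%:R + t) / 2 ^+ i.+1 /\ y f i + (m%:R + t) / 2 ^+ i.+1 <= y f i.+1.
Proof.
move=> h /andP[t0 t1]; split.
  by rewrite addr_ge0 ?breakpointR_ge0// divr_ge0 ?addr_ge0// ltW.
rewrite (le_trans _ h)// lerD2l ler_pM2r ?invr_gt0//.
by rewrite -natr1 lerD2l.
Qed.

(** Up to breakpoint [i.+1] the slope of [ln f] lies between [- 2 ^ (i + 1)] and [Lam], and the
    cells have length [2 ^- (i + 1)]. After rescaling to the unit interval the Lipschitz constant is
    [1 + Lam] in every zone. *)
Lemma cell_class f i m : H f ->
  [/\ midconcave_itv 0 1 (cell f i m), lipschitz_itv (1 + Lam) 0 1 (cell f i m) &
      `|cell f i m 0| <= ln L - ln c0 + 2 ^+ i.+1 * T%:R].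
Proof.
move=> Hf; have [fc _ _ _] := Hf; have tw := two_gt0 i.+1.
have lnL : 0 <= ln L by rewrite ln_ge0.
have lnc : ln c0 <= 0 by exact: ln_le0.
rewrite /cell; case: ifPn => hm; last first.
  split.
  - by move=> u v _ _; rewrite addr0 mulr0.
  - by move=> u v _ _; rewrite subrr normr0 mulr_ge0// addr_ge0.
  - by rewrite normr0 addr_ge0 ?subr_ge0 ?(le_trans lnc)// mulr_ge0// ltW.
split.
- move=> u v u01 v01.
  have [u0 uy] := cell_pt hm u01; have [v0 vy] := cell_pt hm v01.
  have half : 0 <= (1 / 2 : R) <= 1 by apply/andP; split; lra.
  have [_] := fc _ _ _ half (zone_pos Hf u0 uy) (zone_pos Hf v0 vy).
  set a := ln _; set b := ln _.
  have -> : 1 / 2 * (y f i + (m%:R + u) / 2 ^+ i.+1)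
      + (1 - 1 / 2) * (y f i + (m%:R + v) / 2 ^+ i.+1)
      = y f i + (m%:R + (u + v) / 2) / 2 ^+ i.+1.
    by field; rewrite gt_eqF.
  by lra.
- move=> u v u01 v01.
  have [u0 uy] := cell_pt hm u01; have [v0 vy] := cell_pt hm v01.
  apply: le_trans (zone_lipschitz Hf u0 v0 uy vy) _.
  have -> : y f i + (m%:R + u) / 2 ^+ i.+1 - (y f i + (m%:R + v) / 2 ^+ i.+1)
      = (u - v) / 2 ^+ i.+1 by field; rewrite gt_eqF.
  rewrite normrM (gtr0_norm (_ : 0 < (2 ^+ i.+1)^-1)) ?invr_gt0//.
  rewrite mulrA mulrAC ler_wpM2r// mulrDl divff ?gt_eqF// lerD2l.
  by rewrite ler_piMr// invf_le1// exprn_ege1//; lra.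
- have h01 : 0 <= (0 : R) <= 1 by rewrite lexx ler01.
  have [] := cell_pt hm h01; set v := y f i + _ => v0 vy.
  have fv := zone_pos Hf v0 vy.
  have h1 : ln (f v) <= ln L by rewrite ler_ln ?posrE ?(lt_le_trans _ L1)// H_leL.
  have h2 : ln c0 - 2 ^+ i.+1 * v <= ln (f v).
    have := zone_lower Hf v0 vy.
    by rewrite -ler_ln ?posrE ?mulr_gt0 ?expR_gt0// lnM ?posrE ?expR_gt0// expRK.
  have h3 : 2 ^+ i.+1 * v <= 2 ^+ i.+1 * T%:R.
    by rewrite ler_pM2l// (le_trans vy)// breakpointR_le.
  have h4 : 0 <= 2 ^+ i.+1 * v by rewrite mulr_ge0// ltW.
  by rewrite ler_norml; apply/andP; split; lra.
Qed.

(** Growth factor of the tolerance: it is squared from one cell or zone to the next. Being above 1,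
    it makes the costs of the cells summable. Being at most [expR (1 / 16)], it is outweighed by the
    decay of [f] inside a zone, and [theta ^ 4 / 2 < 1] makes the errors of the zones summable. *)
Let theta : R := 17 / 16.

Variables (N M : nat) (omega : R).

(** The sources of error are, in order, rounding in zone [i], points past the [M] coded cells of a
    zone, points past [T], and the last zone [N], in which nothing is coded. *)
Let amp (i : nat) : R := L * expR 1 * (omega ^+ 2 * theta ^+ (4 * i)
  + expR (- (M%:R / 4)) + expR (- (T%:R / 2)) + (i == N)%:R).

Let amp_ge0 i : 0 <= amp i.
Proof.
rewrite /amp mulr_ge0 ?mulr_ge0 ?expR_ge0 ?(le_trans _ L1)// !addr_ge0 ?expR_ge0//.
by rewrite mulr_ge0 ?sqr_ge0// exprn_ge0// /theta; lra.
Qed.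

Let quarter (m : nat) (z : R) : m%:R <= 2 * z -> (4 * m)%:R / 16 <= z / 2.
Proof. by rewrite natrM; lra. Qed.

Let theta_expR m : theta ^+ m <= expR (m%:R / 16).
Proof.
rewrite -[m%:R / 16]mulrC expRM_natr; apply: lerXn2r; rewrite ?nnegrE ?expR_ge0//.
  by rewrite /theta; lra.
by apply: le_trans (expR_ge1Dx _); rewrite /theta; lra.
Qed.

(** A point [x] below [T] is charged to the last zone [i <= N] that starts before it. There both
    functions decay like [expR (- z)] with [z = 2 ^ i (x - y f i)]: one half of the exponent pays
    for the growing tolerance or the missing code, the other half is kept for integration. *)
Lemma half_line_dominated f g x : H f -> H g -> 0 <= x ->
  (forall i, (i < N)%N -> breakpoint T f i.+1 = breakpoint T g i.+1) ->
  (forall i, (i < N)%N -> forall m, (m < M)%N -> forall t, 0 <= t <= 1 ->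
    `|cell f i m t - cell g i m t| <= omega * theta ^+ (2 * (i + m))) ->
  (Num.sqrt (f x) - Num.sqrt (g x)) ^+ 2 <=
    \sum_(i < N.+1) amp i * expR (- (2 ^+ i / 2 * `|x - y f i|)).
Proof.
move=> Hf Hg x0 fgbp fgcell.
have L0 : 0 <= L by rewrite (le_trans _ L1).
have Le0 : 0 <= L * expR 1 by rewrite mulr_ge0// expR_ge0.
have th0 n : 0 <= theta ^+ n by rewrite exprn_ge0// /theta; lra.
suff [i iN hi] : exists2 i, (i < N.+1)%N & (Num.sqrt (f x) - Num.sqrt (g x)) ^+ 2 <=
    amp i * expR (- (2 ^+ i / 2 * `|x - y f i|)).
  apply: (le_trans hi); rewrite (bigD1 (Ordinal iN))//= lerDl sumr_ge0// => j _.
  by rewrite mulr_ge0// expR_ge0.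
have maxle B : f x <= B -> g x <= B -> (Num.sqrt (f x) - Num.sqrt (g x)) ^+ 2 <= B.
  move=> fB gB; rewrite (le_trans (sqrt_sub_sq_le_max _ _)) ?H_ge0//.
  by rewrite ge_max fB gB.
have [Tx|xT] := leP T%:R x.
  (* Beyond [T] the envelope suffices; it is charged to zone 0, which starts at 0. *)
  exists 0%N => //; rewrite /y /breakpointR/= mul0r subr0 expr0 (ger0_norm x0).
  apply: (@le_trans _ _ (L * expR (- x))).
    by apply: maxle; [have [_ h _ _] := Hf|have [_ h _ _] := Hg]; have /andP[] := h _ x0.
  apply: (@le_trans _ _ (L * expR 1 * expR (- (T%:R / 2)) * expR (- (1 / 2 * x)))).
    rewrite -!mulrA ler_wpM2l// -!expRD ler_expR; lra.
  rewrite ler_wpM2r ?expR_ge0// ler_wpM2l// -addrA addrC -addrA lerDl.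
  by rewrite addr_ge0// addr_ge0 ?expR_ge0// mulr_ge0// sqr_ge0.
have exI : exists i, (i <= N)%N && (y f i <= x).
  by exists 0%N; rewrite /y /breakpointR/= mul0r x0.
have bI i : (i <= N)%N && (y f i <= x) -> (i <= N)%N by case/andP.
case: (ex_maxnP exI bI) => i /andP[iN yx] imax {exI bI}.
exists i => //; set z := 2 ^+ i * (x - y f i).
have z0 : 0 <= z by rewrite mulr_ge0 ?subr_ge0// ltW.
have -> : 2 ^+ i / 2 * `|x - y f i| = z / 2.
  by rewrite ger0_norm ?subr_ge0// /z; field.
have yfg j : (j <= N)%N -> y f j = y g j.
  by case: j => [//|j] jN; rewrite /y /breakpointR fgbp.
have fdec : f x <= L * expR 1 * expR (- z) by exact: (breakpoint_decay L1 Hf yx xT).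
have gdec : g x <= L * expR 1 * expR (- z).
  rewrite /z yfg//; apply: (breakpoint_decay L1 Hg _ xT).
  by rewrite -[breakpointR _ _ _]/(y g i) -yfg.
have term_le B : B * expR (- z) <= (omega ^+ 2 * theta ^+ (4 * i)
    + expR (- (M%:R / 4)) + expR (- (T%:R / 2)) + (i == N)%:R) * expR (- (z / 2)) ->
    L * expR 1 * expR (- z) * B <= amp i * expR (- (z / 2)).
  move=> h; rewrite /amp -[leLHS]mulrA -[leRHS]mulrA [expR (- z) * B]mulrC.
  exact: ler_wpM2l.
have ez : expR (- z) = expR (- (z / 2)) * expR (- (z / 2)) by rewrite -expRD; congr expR; lra.
have om0 : 0 <= omega ^+ 2 * theta ^+ (4 * i) by rewrite mulr_ge0// sqr_ge0.
have eM0 := expR_ge0 (- (M%:R / 4) : R); have eT0 := expR_ge0 (- (T%:R / 2) : R).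
have [/eqP iEN|iNN] := boolP (i == N).
  rewrite (le_trans (maxle _ fdec gdec))// -[leLHS]mulr1; apply: term_le.
  have -> : (i == N)%:R = 1 :> R by rewrite iEN eqxx.
  rewrite mul1r ez ler_wpM2r ?expR_ge0//.
  have : expR (- (z / 2)) <= 1 by rewrite -[leRHS]expR0 ler_expR; lra.
  by lra.
have {}iN : (i < N)%N by rewrite ltn_neqAle iNN.
have xy1 : x < y f i.+1.
  by rewrite ltNge; apply/negP => h; have := imax i.+1; rewrite iN h ltnn => /(_ isT).
have u0 : 0 <= (x - y f i) * 2 ^+ i.+1 by rewrite mulr_ge0 ?subr_ge0// ltW.
pose m := Num.truncn ((x - y f i) * 2 ^+ i.+1).
have /andP[m1 m2] := truncn_itv u0; rewrite -/m in m1 m2.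
have zm : m%:R <= 2 * z by rewrite (le_trans m1)// /z exprS; lra.
have [Mm|mM] := leqP M m.
  rewrite (le_trans (maxle _ fdec gdec))// -[leLHS]mulr1; apply: term_le.
  rewrite mul1r ez ler_wpM2r ?expR_ge0//.
  have : expR (- (z / 2)) <= expR (- (M%:R / 4)).
    rewrite ler_expR; have : M%:R <= m%:R :> R by rewrite ler_nat.
    lra.
  by have : 0 <= (i == N)%:R :> R by []; lra.
(* Both breakpoints are multiples of [2 ^- (i + 1)], so the cell of a point before [y f i.+1] ends
   no later than that, and [cell] does not take its default value. *)
have mcell : y f i + m.+1%:R / 2 ^+ i.+1 <= y f i.+1.
  have k1 : y f i = ((breakpoint T f i) * 2)%:R / 2 ^+ i.+1.
    by rewrite /y /breakpointR natrM exprS; field; rewrite gt_eqF.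
  rewrite k1 -mulrDl /y /breakpointR ler_pM2r ?invr_gt0// -natrD ler_nat.
  rewrite addnS.
  have : m%:R < (breakpoint T f i.+1)%:R - (breakpoint T f i * 2)%:R :> R.
    rewrite (le_lt_trans m1)// -ltr_pdivlMr// mulrBl -k1 ltrD2r.
    exact: xy1.
  by rewrite ltrBrDl -natrD ltr_nat.
pose t := (x - y f i) * 2 ^+ i.+1 - m%:R.
have t01 : 0 <= t <= 1.
  by rewrite subr_ge0 m1/= lerBlDr nat1r ltW.
have xE : y f i + (m%:R + t) / 2 ^+ i.+1 = x.
  by rewrite /t; field; rewrite gt_eqF.
have := fgcell _ iN _ mM _ t01.
rewrite /cell -!yfg ?(ltnW iN)// mcell xE => hcell.
have fx : 0 < f x by apply: (@zone_pos f i.+1) => //; exact: ltW.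
have gx : 0 < g x by apply: (@zone_pos g i.+1) => //; rewrite -yfg// ltW.
rewrite (le_trans (sqrt_sub_sq_le_ln fx gx fdec gdec hcell))//; apply: term_le.
rewrite ez exprMn -exprM mulrA ler_wpM2r ?expR_ge0//.
have -> : (2 * (i + m) * 2 = 4 * i + 4 * m)%N by rewrite mulnAC -mulnDr.
have -> : omega ^+ 2 * theta ^+ (4 * i + 4 * m) * expR (- (z / 2)) =
    omega ^+ 2 * theta ^+ (4 * i) * (theta ^+ (4 * m) * expR (- (z / 2))).
  by rewrite exprD !mulrA.
have : theta ^+ (4 * m) * expR (- (z / 2)) <= 1.
  rewrite expRN ler_pdivrMr ?expR_gt0// mul1r (le_trans (theta_expR _))// ler_expR.
  exact: quarter.
move=> /(ler_wpM2l om0); rewrite mulr1 => /le_trans; apply.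
by rewrite -!addrA lerDl addr_ge0// addr_ge0.
Qed.

End cells.

(** * Entropy on a half-line *)

Section half_line_entropy.
Variable R : realType.
Implicit Types f g : R -> R.

Lemma entropy_le_nat (X : Type) (S : set X) (h : X -> nat) (n : nat) :
  (forall u, S u -> (h u <= n)%N) ->
  @entropy_le R X S (fun u v => h u = h v) (ln n.+1%:R).
Proof.
move=> hn; exists n.+1, h; split => //.
by rewrite lnK// posrE.
Qed.

(* [2 * a i / l i] is the integral over [R] of the [i]-th exponential. *)
Definition exp_dominated (S : set R) (e : R) (d : R -> R) :=
  exists n (a l y : nat -> R),
    [/\ forall i, 0 <= a i /\ 0 < l i, \sum_(i < n) 2 * a i / l i <= e &
        forall x, S x -> d x <= \sum_(i < n) a i * expR (- (l i * `|x - y i|))].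

Definition sqrt_dist f g (x : R) : R := (Num.sqrt (f x) - Num.sqrt (g x)) ^+ 2.

Variables (L c0 Lam : R) (L1 : 1 <= L) (c0_gt0 : 0 < c0) (c01 : c0 <= 1) (Lam0 : 0 <= Lam).

Let H := half_line_class L c0 Lam.

(** [24 = 4 * 6]: in [sum_amp], integration gives the factor [4 * (L * expR 1)], and the remaining
    sum is at most [6 * omega ^ 2]. *)
Let A : R := 24 * (L * expR 1).

Let Le1 : 1 <= L * expR 1.
Proof.
by have := @expR_ge1Dx R 1; have := L1; have := expR_ge0 (1 : R); nra.
Qed.

Let A1 : 1 <= A. Proof. by rewrite /A; have := Le1; lra. Qed.

Let A0 : 0 < A. Proof. exact: lt_le_trans A1. Qed.

Section scale.
(** [w] stands for eps ^ (-1/2): the squared Hellinger precision is [w ^- 4], and the entropy will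
    be linear in [w]. *)
Variables (w : R) (w1 : 1 <= w).

Let w0 : 0 < w. Proof. exact: lt_le_trans w1. Qed.

(** Tolerance of [ln f] in the first cell. It has the order [w ^- 2] of the Hellinger precision; the
    factor [A ^- 2] absorbs the constant of [sum_amp]. *)
Let omega : R := ((w * A) ^+ 2)^-1.

Let wA1 : 1 <= w * A. Proof. by rewrite -[leLHS]mulr1 ler_pM. Qed.

Let wA0 : 0 < w * A. Proof. exact: lt_le_trans wA1. Qed.

Let omega0 : 0 < omega. Proof. by rewrite invr_gt0 exprn_gt0. Qed.

(** [2 ^ N] has the order of [omega ^- 2], so that what is left uncoded stays below the rounding
    error, while the number of zones is only logarithmic in [w]. *)
Variables (N : nat) (N1 : 2 * (w * A) ^+ 4 <= 2 ^+ N) (N2 : 2 ^+ N <= 4 * (w * A) ^+ 4).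

Let theta : R := 17 / 16.

(** With [4 * N] cells per zone and the cut-off [T = 2 * N], both exponentials equal
    [expR (- N)]. *)
Let amp (i : nat) : R := L * expR 1 * (omega ^+ 2 * theta ^+ (4 * i)
  + expR (- ((4 * N)%:R / 4)) + expR (- ((2 * N)%:R / 2)) + (i == N)%:R).

Let expN_le : expR (- N%:R) <= (2 ^+ N)^-1 :> R.
Proof.
rewrite expRN lef_pV2 ?posrE ?expR_gt0 ?exprn_gt0//.
rewrite -[N%:R]mul1r expRM_natr; apply: lerXn2r; rewrite ?nnegrE ?expR_ge0//.
by have := @expR_ge1Dx R 1; lra.
Qed.

Let omega2 : (2 ^+ N)^-1 <= omega ^+ 2 / 2.
Proof.
have -> : omega ^+ 2 / 2 = (2 * (w * A) ^+ 4)^-1.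
  by rewrite /omega exprVn -exprM [RHS]invfM mulrC.
have W : 0 < (w * A) ^+ 4 by rewrite exprn_gt0.
by rewrite lef_pV2 // posrE; [rewrite exprn_gt0|rewrite mulr_gt0].
Qed.

Let sum_pick (F : nat -> R) : \sum_(i < N.+1) (i == N :> nat)%:R * F i = F N.
Proof.
rewrite big_ord_recr/= eqxx mul1r big1 ?add0r// => i _.
by rewrite (ltn_eqF (ltn_ord i)) mul0r.
Qed.

(** Integration contributes [2 ^- i] in zone [i]. The rounding terms thus form a geometric series of
    ratio [theta ^ 4 / 2], and the uncoded last zone adds only [2 ^- N]. *)
Let sum_amp : \sum_(i < N.+1) 2 * amp i / (2 ^+ i / 2) <= (w ^+ 4)^-1.
Proof.
have e4 : (4 * N)%:R / 4 = N%:R :> R by rewrite natrM; field.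
have e2 : (2 * N)%:R / 2 = N%:R :> R by rewrite natrM; field.
have E0 := expR_ge0 (- N%:R : R).
pose x : R := theta ^+ 4 / 2.
have x01 : 0 <= x < 1 by rewrite /x /theta; apply/andP; split; lra.
have h01 : 0 <= (1 / 2 : R) < 1 by apply/andP; split; lra.
have -> : \sum_(i < N.+1) 2 * amp i / (2 ^+ i / 2) = 4 * (L * expR 1) *
   (omega ^+ 2 * \sum_(i < N.+1) x ^+ i
    + 2 * expR (- N%:R) * \sum_(i < N.+1) (1 / 2) ^+ i + (2 ^+ N)^-1).
  rewrite -(sum_pick (fun i => (2 ^+ i)^-1)) !mulr_sumr -!big_split/= mulr_sumr.
  apply: eq_bigr => i _; rewrite /amp e4 e2 /x exprM [(theta ^+ 4 / 2) ^+ i]expr_div_n [(1 / 2) ^+ i]expr_div_n expr1n.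
  have : (2 : R) ^+ i != 0 by rewrite expf_neq0.
  set q := (theta ^+ 4) ^+ i; set p := 2 ^+ i; set b := (_ == _)%:R; set W := omega ^+ 2.
  set E := expR (- _); set LE := L * _; move: q p b W E LE => q p b W E LE p0.
  by field.
have s1 : omega ^+ 2 * \sum_(i < N.+1) x ^+ i <= omega ^+ 2 * 3.
  rewrite ler_wpM2l ?sqr_ge0// (le_trans (geometric_sum_le _ x01))//.
  by rewrite -[leLHS]mul1r ler_pdivrMr /x /theta; lra.
have s2 : 2 * expR (- N%:R) * \sum_(i < N.+1) (1 / 2 : R) ^+ i <= 2 * expR (- N%:R) * 2.
  rewrite ler_wpM2l ?mulr_ge0// (le_trans (geometric_sum_le _ h01))//.
  by rewrite -[leLHS]mul1r ler_pdivrMr; lra.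
apply: (@le_trans _ _ (A * omega ^+ 2)).
  have LE0 : 0 <= 4 * (L * expR 1) by rewrite mulr_ge0// (le_trans _ Le1).
  rewrite (_ : A * omega ^+ 2 = 4 * (L * expR 1) * (6 * omega ^+ 2)); last by rewrite /A; ring.
  by apply: ler_wpM2l => //; have := expN_le; have := omega2; lra.
have -> : A * omega ^+ 2 = (w ^+ 4)^-1 * (A ^+ 3)^-1.
  have wn := gt_eqF w0; have An := gt_eqF A0.
  by rewrite /omega; move: A An => a an; field; rewrite wn an.
rewrite ler_piMr ?invr_ge0 ?exprn_ge0 ?(ltW w0)//.
by rewrite invf_le1 ?exprn_gt0// exprn_ege1.
Qed.

Let C : R := 1 + Lam.
Let C1 : 1 <= C. Proof. by rewrite lerDl. Qed.
Let C0 : 0 < C. Proof. exact: lt_le_trans C1. Qed.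
Let B (i : nat) : R := ln L - ln c0 + 2 ^+ i.+1 * (2 * N)%:R.
Let B0 i : 0 <= B i.
Proof.
have lnL : 0 <= ln L by rewrite ln_ge0.
have lnc : ln c0 <= 0 by exact: ln_le0.
by rewrite addr_ge0 ?subr_ge0 ?(le_trans lnc)// mulr_ge0// exprn_ge0.
Qed.

Let eta i m : R := omega * theta ^+ (2 * (i + m)).
Let theta1 n : 1 <= theta ^+ n.
Proof. by rewrite exprn_ege1// /theta; lra. Qed.
Let eta0 i m : 0 < eta i m.
Proof. by rewrite mulr_gt0// (lt_le_trans _ (theta1 _)). Qed.

Let cost i m : R := 72 * (7 * Num.sqrt (C / eta i m) + 1)
     + 2 * ln (2 * (B i / C + 1) * (44 * (C / eta i m) + 1) + 1).

Lemma half_line_entropy_sum : entropy_le H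
  (fun f g => exp_dominated [set x | 0 <= x] (w ^+ 4)^-1 (sqrt_dist f g))
  (\sum_(i < N) ln (2 * N * 2 ^ i.+1).+1%:R + \sum_(i < N) \sum_(m < 4 * N) cost i m).
Proof.
have h1 := entropy_le_forall (fun i (_ : (i < N)%N) =>
  @entropy_le_nat _ H (fun f => breakpoint (2 * N) f i.+1) _
    (fun f _ => breakpoint_le (2 * N) f i.+1)).
have hc i m := concave_lipschitz_entropy C0 (B0 i) (eta0 i m).
have h2 := entropy_le_forall (fun i (_ : (i < N)%N) =>
  entropy_le_forall (fun m (_ : (m < 4 * N)%N) =>
  entropy_le_preimage (h := fun f => cell (2 * N) f i m)
    (fun f Hf => cell_class L1 c0_gt0 c01 Lam0 (2 * N) i m Hf) (hc i m))).
apply: (entropy_le_sub (entropy_le_and h1 h2)) => // f g Hf Hg [hb hcell].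
exists N.+1, amp, (fun i => 2 ^+ i / 2), (fun i => breakpointR (2 * N) f i); split.
- move=> i; split; last by rewrite divr_gt0// exprn_gt0.
  rewrite mulr_ge0 ?(le_trans _ Le1)// !addr_ge0 ?expR_ge0// mulr_ge0 ?sqr_ge0//.
  by rewrite (le_trans _ (theta1 _)).
- exact: sum_amp.
- move=> x x0; apply: (half_line_dominated L1 c0_gt0 Hf Hg x0) => //.
Qed.

Let Q : R := 2 ^+ N.
Let Q1 : 1 <= Q. Proof. by rewrite exprn_ege1//; lra. Qed.
Let NQ : N%:R <= Q.
Proof. by rewrite /Q -natrX ler_nat ltnW// ltn_expl. Qed.
Let omegaQ : omega^-1 <= Q.
Proof.
rewrite invrK (le_trans _ N1)//.
have : 1 <= (w * A) ^+ 2 by rewrite exprn_ege1.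
by rewrite (_ : 4 = 2 * 2)%N// exprM; nra.
Qed.
Let lnQ : ln Q <= N%:R.
Proof.
rewrite /Q lnXn// -[leLHS]mulr_natl ler_piMr//.
by have -> : (2 : R) = 1 + 1 by []; apply: le_ln1Dx; lra.
Qed.

Let K0 : R := ln L - ln c0 + 3.
Let K00 : 3 <= K0.
Proof.
have lnL : 0 <= ln L by rewrite ln_ge0.
by have lnc : ln c0 <= 0 by [exact: ln_le0]; rewrite /K0; lra.
Qed.
Let K1 : R := 90 * C * K0 + 1.

(** The square root of the inverse tolerance gives the geometric factors in [i] and [m]. Inside the
    logarithm everything is at most a constant times a power of [Q = 2 ^ N], whence the term linear
    in [N]. *)
Let cost_le i m : (i < N)%N -> cost i m <=
  504 * (C * (w * A)) * (theta^-1 ^+ i * theta^-1 ^+ m) + (72 + 2 * (K1 + 3 * N%:R)).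
Proof.
move=> iN; have Ceta : C / eta i m <= C * Q.
  rewrite ler_pM2l// (le_trans _ omegaQ)// lef_pV2 ?posrE//.
  by rewrite ler_peMr// ltW.
have hs : Num.sqrt (C / eta i m) <= C * (w * A) * (theta^-1 ^+ i * theta^-1 ^+ m).
  rewrite -exprD exprVn.
  set r := theta ^+ (i + m); have r1 : 1 <= r by exact: theta1.
  have r0 : 0 < r by exact: lt_le_trans r1.
  have -> : C / eta i m = C * ((w * A) * r^-1) ^+ 2.
    rewrite /eta mulnC exprM -/r /omega; move: r0 wA0; set W := w * A.
    by move: W r {r1} => W r r0 W0; field; rewrite !gt_eqF.
  have u0 : 0 <= (w * A) * r^-1 by rewrite mulr_ge0 ?invr_ge0 ?(ltW r0) ?(ltW wA0).
  rewrite sqrtrM ?(ltW C0)// sqrtr_sqr ger0_norm// -[leRHS]mulrA ler_wpM2r//.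
  rewrite -[leRHS](ger0_norm (ltW C0)) -sqrtr_sqr ler_sqrt ?sqr_ge0//.
  by rewrite expr2 ler_peMl// ltW.
have hB : B i / C + 1 <= K0 * Q ^+ 2.
  have BC : B i / C <= B i by rewrite ler_pdivrMr// ler_peMr.
  have : 2 ^+ i.+1 * (2 * N)%:R <= 2 * Q ^+ 2.
    rewrite natrM mulrCA ler_pM2l// expr2; apply: ler_pM => //.
    by rewrite /Q; apply: ler_weXn2l => //; lra.
  rewrite /B /K0 in BC *; move=> h; have q2 : 1 <= Q ^+ 2 by rewrite exprn_ege1.
  have lnL : 0 <= ln L by rewrite ln_ge0.
  have lnc : ln c0 <= 0 by exact: ln_le0.
  by nra.
have hl : ln (2 * (B i / C + 1) * (44 * (C / eta i m) + 1) + 1) <= K1 + 3 * N%:R.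
  have b0 : 0 <= B i / C by rewrite divr_ge0// ltW.
  have e0 : 0 <= C / eta i m by rewrite divr_ge0// ltW.
  move: (C / eta i m) Ceta e0 {hs} => v Ceta e0.
  move: (B i / C) b0 hB => u b0 hB.
  apply: (@le_trans _ _ (ln (K1 * Q ^+ 3))).
    have Q3 : 1 <= Q ^+ 3 by rewrite exprn_ege1.
    have K1p : 0 < K1 by rewrite /K1; have := C1; have := K00; nra.
    have P0 : 0 < 2 * (u + 1) * (44 * v + 1) + 1.
      rewrite ltr_wpDl// mulr_ge0//; first by rewrite mulr_ge0// addr_ge0.
      by rewrite addr_ge0// mulr_ge0.
    have Q30 : 0 < Q ^+ 3 by exact: lt_le_trans Q3.
    have KQ : 0 < K1 * Q ^+ 3 by exact: mulr_gt0.
    rewrite ler_ln//.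
    apply: (@le_trans _ _ (2 * (K0 * Q ^+ 2) * (45 * (C * Q)) + Q ^+ 3)).
      rewrite lerD// ler_pM ?mulr_ge0 ?addr_ge0 ?mulr_ge0// ?ler_pM2l//.
      by have : 1 <= C * Q by [rewrite -[leLHS]mulr1 ler_pM]; lra.
    by rewrite /K1 le_eqVlt; apply/orP; left; apply/eqP; ring.
  have K1p : 0 < K1 by rewrite /K1; have := C1; have := K00; nra.
  have Qp : 0 < Q by exact: lt_le_trans Q1.
  rewrite lnM ?posrE ?exprn_gt0// lnXn// -[ln Q *+ 3]mulr_natl lerD ?ler_pM2l//.
  have -> : K1 = 1 + (K1 - 1) by ring.
  by rewrite (le_trans (le_ln1Dx _)); lra.
by rewrite /cost; lra.
Qed.

Let sum_theta n : \sum_(i < n) theta^-1 ^+ i <= 17.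
Proof.
have h : 0 <= theta^-1 < 1.
  by rewrite /theta invf_div; apply/andP; split; lra.
apply: (le_trans (geometric_sum_le _ h)).
by rewrite -[leLHS]mul1r /theta invf_div ler_pdivrMr; lra.
Qed.

(** The leading terms sum to at most [(1 - 16/17)^-1 = 17] in each index, whence [289 = 17 ^ 2], and
    [504 = 72 * 7] comes from a single cell. The logarithms of all [4 N ^ 2] cells and of the
    breakpoints add at most a cubic polynomial in [N]. *)
Lemma half_line_entropy_sum_le :
  \sum_(i < N) ln (2 * N * 2 ^ i.+1).+1%:R + \sum_(i < N) \sum_(m < 4 * N) cost i m
  <= 504 * 289 * C * A * w + (1000 + 8 * K1) * (N%:R + 1) ^+ 3.
Proof.
have n0 : 0 <= N%:R :> R by [].
have K1p : 0 <= K1 by rewrite /K1; have := C1; have := K00; nra.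
have h1 : \sum_(i < N) ln (2 * N * 2 ^ i.+1).+1%:R <= N%:R * (2 + 2 * N%:R) :> R.
  rewrite [leRHS]mulr_natl -[X in _ *+ X]card_ord -sumr_const ler_sum// => i _.
  have Qp : 0 < Q by exact: lt_le_trans Q1.
  apply: (@le_trans _ _ (ln (3 * Q ^+ 2))).
    rewrite ler_ln ?posrE ?mulr_gt0 ?exprn_gt0// -natr1 !natrM natrX.
    have : 2 ^+ i.+1 <= Q :> R by apply: ler_weXn2l => //; lra.
    have : 0 <= 2 ^+ i.+1 :> R by rewrite exprn_ge0.
    move=> u0 u1; have : N%:R * 2 ^+ i.+1 <= Q * Q by apply: ler_pM.
    by have := Q1; nra.
  rewrite lnM ?posrE ?exprn_gt0// lnXn// -[ln Q *+ 2]mulr_natl lerD ?ler_pM2l//.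
  by have -> : (3 : R) = 1 + 2 by [ring]; apply: le_ln1Dx; lra.
have h2 : \sum_(i < N) \sum_(m < 4 * N) cost i m <=
    504 * (C * (w * A)) * 289 + N%:R * (4 * N%:R) * (72 + 2 * (K1 + 3 * N%:R)).
  apply: (@le_trans _ _ (\sum_(i < N) \sum_(m < 4 * N)
     (504 * (C * (w * A)) * (theta^-1 ^+ i * theta^-1 ^+ m) + (72 + 2 * (K1 + 3 * N%:R))))).
    by rewrite ler_sum// => i _; rewrite ler_sum// => m _; apply: cost_le.
  under eq_bigr do rewrite big_split/= -mulr_sumr -mulr_sumr sumr_const card_ord.
  rewrite big_split/= sumr_const card_ord -mulr_sumr -mulr_suml lerD//.
    have t0 : 0 <= theta^-1 by rewrite invr_ge0 /theta; lra.
    have G0 : 0 <= 504 * (C * (w * A)).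
      by apply: mulr_ge0; [exact: ler0n|apply: mulr_ge0; apply: ltW].
    apply: ler_wpM2l => //; apply: (@le_trans _ _ (17 * 17)); last by lra.
    by apply: ler_pM; rewrite ?sum_theta// sumr_ge0// => j _; rewrite exprn_ge0.
  move: (72 + _) => X; rewrite -[X *+ _ *+ _]mulr_natr -[X *+ _]mulr_natr natrM.
  by rewrite le_eqVlt; apply/orP; left; apply/eqP; ring.
apply: (le_trans (lerD h1 h2)).
have -> : 504 * (C * (w * A)) * 289 = 504 * 289 * C * A * w by ring.
rewrite addrCA lerD2l; move: n0 K1p; move: (N%:R) K1 => n K n0 K0p.
have n2 : 0 <= n ^+ 2 by rewrite exprn_ge0.
have n3 : 0 <= n ^+ 3 by rewrite exprn_ge0.
have := mulr_ge0 K0p n0; have := mulr_ge0 K0p n2; have := mulr_ge0 K0p n3.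
by lra.
Qed.

End scale.

Lemma half_line_entropy : exists2 D : R, 0 <= D & forall w, 1 <= w ->
  entropy_le H
    (fun f g => exp_dominated [set x | 0 <= x] (w ^+ 4)^-1 (sqrt_dist f g)) (D * w).
Proof.
pose C : R := 1 + Lam; pose K1 : R := 90 * C * (ln L - ln c0 + 3) + 1.
have ln2 : 0 < ln 2 :> R by rewrite ln_gt0//; lra.
(* [expR (s * N)] is the fourth root of [2 ^ N] and thus of order [w]; the cubic polynomial in [N]
   is absorbed by it. *)
pose s : R := ln 2 / 4; have s0 : 0 < s by rewrite divr_gt0.
have C0 : 0 <= C by rewrite addr_ge0.
have K10 : 0 <= K1.
  have lnL : 0 <= ln L by rewrite ln_ge0.
  have lnc : ln c0 <= 0 by exact: ln_le0.
  by rewrite addr_ge0// !mulr_ge0//; lra.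
have [G1 [G10 G1E]] : exists G1 : R, 0 <= G1 /\ G1 = 504 * 289 * C * A.
  exists (504 * 289 * C * A); split; last reflexivity.
  apply: mulr_ge0; last exact: (ltW A0).
  by apply: mulr_ge0; last exact: C0; apply: mulr_ge0; exact: ler0n.
have [G2 [G20 G2E]] : exists G2 : R, 0 <= G2 /\ G2 = 1000 + 8 * K1.
  exists (1000 + 8 * K1); split; last reflexivity.
  by apply: addr_ge0; [exact: ler0n|apply: mulr_ge0; [exact: ler0n|exact: K10]].
have S0 : 0 <= 27 / s ^+ 3 * expR s * (4 * A).
  apply: mulr_ge0; last by apply: mulr_ge0; [exact: ler0n|exact: (ltW A0)].
  apply: mulr_ge0; last exact: expR_ge0.
  by apply: divr_ge0; [exact: ler0n|rewrite exprn_ge0// ltW].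
exists (G1 + G2 * (27 / s ^+ 3 * expR s * (4 * A))).
  by apply: addr_ge0 => //; exact: mulr_ge0.
move=> w w1; have w0 : 0 <= w by rewrite (le_trans _ w1).
have wA1 : 1 <= w * A by rewrite -[leLHS]mulr1 ler_pM.
have wA0 : 0 <= w * A by rewrite (le_trans _ wA1).
have exN : exists N, 2 * (w * A) ^+ 4 <= 2 ^+ N.
  exists (Num.truncn (2 * (w * A) ^+ 4)).+1; rewrite (le_trans (ltW (truncnS_gt _)))//.
  by rewrite -natrX ler_nat ltnW// ltn_expl.
pose N := ex_minn exN.
have [N1 N2] : 2 * (w * A) ^+ 4 <= 2 ^+ N /\ 2 ^+ N <= 4 * (w * A) ^+ 4.
  have wA4 : 1 <= (w * A) ^+ 4 by rewrite exprn_ege1.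
  rewrite /N; case: ex_minnP => -[|n] hn mn; split=> //.
    by rewrite expr0; move: ((w * A) ^+ 4) wA4 => W; lra.
  have : ~~ (2 * (w * A) ^+ 4 <= 2 ^+ n) by apply/negP => /mn; rewrite ltnn.
  rewrite -ltNge [2 ^+ n.+1]exprS; move: (2 ^+ n) ((w * A) ^+ 4) => p W ?; lra.
apply: (entropy_le_sub (half_line_entropy_sum w1 N1)) => //.
have := half_line_entropy_sum_le w1 N1.
rewrite -[504 * 289 * _ * _]G1E -[1000 + 8 * _]G2E => /le_trans; apply.
rewrite mulrDl lerD2l -mulrA; apply: ler_wpM2l => //.
(* The cube of [u <= expR u] at [u = s (N + 1) / 3]. *)
have cube : (N%:R + 1) ^+ 3 <= 27 / s ^+ 3 * expR (s * (N%:R + 1)).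
  have n1 : 0 <= N%:R + 1 :> R by rewrite addr_ge0.
  have u0 : 0 <= s * (N%:R + 1) / 3 by rewrite divr_ge0// mulr_ge0// ltW.
  have hu : s * (N%:R + 1) / 3 <= expR (s * (N%:R + 1) / 3).
    by rewrite (le_trans _ (expR_ge1Dx _))// lerDr.
  have -> : expR (s * (N%:R + 1)) = expR (s * (N%:R + 1) / 3) ^+ 3.
    by rewrite -expRM_natl; congr expR; field.
  have -> : (N%:R + 1) ^+ 3 = 27 / s ^+ 3 * (s * (N%:R + 1) / 3) ^+ 3.
    by field; rewrite gt_eqF.
  rewrite ler_wpM2l//; first by rewrite divr_ge0// exprn_ge0// ltW.
  by apply: lerXn2r; rewrite ?nnegrE ?expR_ge0.
apply: (le_trans cube).
have -> : 27 / s ^+ 3 * expR s * (4 * A) * w = 27 / s ^+ 3 * (expR s * (4 * (A * w))).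
  by move: (27 / s ^+ 3) => v; move: (A) => a; ring.
apply: ler_wpM2l; first by apply: divr_ge0; [exact: ler0n|rewrite exprn_ge0// ltW].
have -> : expR (s * (N%:R + 1)) = expR s * expR (s * N%:R).
  by rewrite -expRD; congr expR; ring.
apply: ler_wpM2l; first exact: expR_ge0.
have Aw0 : 0 <= 4 * (A * w).
  by apply: mulr_ge0; [exact: ler0n|apply: mulr_ge0 => //; exact: (ltW A0)].
rewrite -(@ler_pXn2r _ 4)// ?nnegrE ?expR_ge0//.
rewrite -expRM_natl (_ : 4%:R * (s * N%:R) = ln 2 * N%:R); last by rewrite /s; field.
rewrite expRM_natr lnK ?posrE// (le_trans N2)//.
rewrite (_ : (4 * (A * w)) ^+ 4 = 4 ^+ 4 * (w * A) ^+ 4); last by ring.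
by rewrite ler_wpM2r ?exprn_ge0//; lra.
Qed.

End half_line_entropy.

(** * Integrals of two-sided exponentials *)

Section laplace.
Variable R : realType.
Let mu := @lebesgue_measure R.

Lemma integral_expR_half_line (l : R) : 0 < l ->
  (\int[mu]_(x in `[0%R, +oo[) (expR (- (l * x)))%:E = (l^-1)%:E)%E.
Proof.
move=> l0; pose F x := - (l^-1 * expR (- (l * x))).
have cE : continuous (fun x : R => expR (- (l * x))).
  move=> z; apply: continuous_comp; last exact: continuous_expR.
  by apply: cvgN; apply: cvgM; [exact: cvg_cst|exact: cvg_id].
have cF : continuous F.
  by move=> z; apply: cvgN; apply: cvgM; [exact: cvg_cst|exact: cE].
have dE (x : R) : is_derive x 1 F (expR (- (l * x))).
  rewrite /F; apply: is_derive_eq.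
  by rewrite /GRing.scale/=; field; rewrite gt_eqF.
rewrite (@ge0_continuous_FTC2y _ _ F 0 0)//.
- by rewrite /F mulr0 oppr0 expR0 mulr1 -EFinB sub0r opprK.
- exact: continuous_subspaceT.
- rewrite -oppr0; apply: cvgN; rewrite -(mulr0 (l^-1)); apply: cvgMr.
  rewrite (_ : (fun x => expR (- (l * x))) = (fun z => expR (- z)) \o (fun z => l * z))//.
  apply: (@cvg_comp _ _ _ _ _ _ (pinfty_nbhs R)); last exact: cvgr_expR.
  exact: gt0_cvgMry.
- by apply: cvg_at_right_filter; exact: cF.
- by move=> x _; rewrite derive1E; have [_ ->] := dE x.
Qed.

Lemma continuous_laplace (l y : R) : continuous (fun x : R => expR (- (l * `|x - y|))).
Proof.
move=> z; apply: continuous_comp; last exact: continuous_expR.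
apply: cvgN; apply: cvgM; first exact: cvg_cst.
by apply: cvg_norm; apply: cvgB; [exact: cvg_id|exact: cvg_cst].
Qed.

Lemma measurable_laplace (l y : R) :
  measurable_fun setT (fun x : R => expR (- (l * `|x - y|))).
Proof. by apply: continuous_measurable_fun; exact: continuous_laplace. Qed.

Lemma integral_laplace (l y : R) : 0 < l ->
  (\int[mu]_x (expR (- (l * `|x - y|)))%:E = (2 / l)%:E)%E.
Proof.
move=> l0; pose G (x : R) := expR (- (l * `|x|)).
have cG : continuous G.
  have -> : G = (fun x => expR (- (l * `|x - 0|))) by apply/funext => x; rewrite subr0.
  exact: continuous_laplace.
have G0 x : 0 <= G x by exact: expR_ge0.
pose F (x : R) := x - y.
have dF (x : R) : is_derive x 1 F 1 by rewrite /F; apply: is_derive_eq; rewrite subr0.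
have F1 : (F^`())%classic = fun=> 1 by apply/funext => x; rewrite derive1E; have [_ ->] := dF x.
transitivity (\int[mu]_x (G x)%:E)%E.
  rewrite (@increasing_ge0_integration_by_substitutionT _ F G)//; rewrite ?F1.
  - by apply: eq_integral => x _; rewrite /= mulr1.
  - by move=> a b; rewrite /F ltrD2r.
  - by move=> x; exact: cst_continuous.
  - exact: is_cvg_cst.
  - exact: is_cvg_cst.
  - by apply: cvg_addrr_Ny.
  - by apply: cvg_addrr.
rewrite ge0_symfun_integralT//; last by move=> x; rewrite /G/= normrN.
rewrite -set_itvcy EFinM; congr (_ * _)%E.
rewrite -integral_expR_half_line//; apply: eq_integral => x.
by rewrite inE/= in_itv/= andbT => x0; rewrite /G ger0_norm.
Qed.

End laplace.

(** * Entropy of bounded and concentrated densities *)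

Section bounded_class.
Variable R : realType.
Let mu := @lebesgue_measure R.
Implicit Types f g : R -> R.

Lemma ln_concave_affine f (a b : R) : ln_concave f -> ln_concave (fun x => f (a + b * x)).
Proof.
move=> fc u v t t01 fu fv; have := fc _ _ t t01 fu fv.
rewrite (_ : t * (a + b * u) + (1 - t) * (a + b * v) = a + b * (t * u + (1 - t) * v))//.
by ring.
Qed.

Lemma ln_concave_ge f (m a b x : R) : ln_concave f -> 0 < m -> m <= f a -> m <= f b ->
  a <= x <= b -> m <= f x.
Proof.
move=> fc m0 fa fb axb.
have fa0 := lt_le_trans m0 fa; have fb0 := lt_le_trans m0 fb.
have /andP[ax xb] := axb.
have [fx] := ln_concave3 fc axb fa0 fb0.
have [ab|ab] := ltP a b; last first.
  by have -> : x = a by apply/eqP; rewrite eq_le ax (le_trans xb).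
have la : ln m <= ln (f a) by rewrite ler_ln.
have lb : ln m <= ln (f b) by rewrite ler_ln.
move=> h; rewrite -ler_ln// -(ler_pM2l (_ : 0 < b - a)) ?subr_gt0//.
have h1 : (b - x) * ln m <= (b - x) * ln (f a) by rewrite ler_wpM2l// subr_ge0.
have h2 : (x - a) * ln m <= (x - a) * ln (f b) by rewrite ler_wpM2l// subr_ge0.
lra.
Qed.

Let itv_length (a b : R) : a <= b -> mu `[a, b]%classic = (b - a)%:E.
Proof. by rewrite le_eqVlt => /predU1P[->|ab]; rewrite /mu lebesgue_measure_itv/= lte_fin ?ltxx ?subrr// ab EFinB. Qed.

(** Between two points of height [m] a log-concave function is at least [m], and the total mass is
    1. *)
Lemma density_ge_on_segment f (m a b : R) : measurable_fun setT f -> (forall x, 0 <= f x) ->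
  (\int[mu]_x (f x)%:E = 1)%E -> ln_concave f -> 0 < m -> a <= b -> m <= f a -> m <= f b ->
  m * (b - a) <= 1.
Proof.
move=> mf f0 f1 fc m0 ab fa fb; rewrite -lee_fin.
apply: (@le_trans _ _ (\int[mu]_(x in `[a, b]%classic) (f x)%:E)%E); last first.
  rewrite -f1; apply: ge0_subset_integral => //; first exact/measurable_EFinP.
  by move=> x _; rewrite lee_fin.
rewrite EFinM -(itv_length ab) -integral_cst//.
apply: ge0_le_integral => //; first by move=> x _; rewrite lee_fin ltW.
  by apply/measurable_EFinP; exact: measurable_funTS.
by move=> x /=; rewrite in_itv/= lee_fin => axb; exact: ln_concave_ge fa fb axb.
Qed.

Variables (T L : R) (T1 : 1 <= T) (L1 : 1 <= L).

Definition bounded_class : set (R -> R) := [set f : R -> R | [/\ measurable_fun setT f, ln_concave f,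
  forall x, 0 <= f x <= L, (\int[mu]_x (f x)%:E = 1)%E &
  ((3 / 4)%:E <= \int[mu]_(x in `[(- T)%R, T]%classic) (f x)%:E)%E]].

Let tau : R := (8 * T)^-1.
Let T0 : 0 < T. Proof. exact: lt_le_trans T1. Qed.
Let L0 : 0 < L. Proof. exact: lt_le_trans L1. Qed.
Let tau0 : 0 < tau. Proof. by rewrite invr_gt0 mulr_gt0. Qed.
Let tau1 : tau <= 1. Proof. by rewrite invf_le1 ?mulr_gt0//; have := T1; lra. Qed.
Let delta : R := (32 * L)^-1.
Let delta0 : 0 < delta. Proof. by rewrite invr_gt0 mulr_gt0. Qed.

(** Values below [tau] carry at most [2 T tau = 1/4] of the mass on [[-T, T]]. If all points of
    height at least [tau] were within [4 delta] of one point, they would carry at most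
    [8 delta L = 1/4]. Together this is less than 3/4. *)
Let wide_level f : bounded_class f -> exists x y,
  [/\ - T <= x, y <= T, tau <= f x, tau <= f y & x + 4 * delta <= y].
Proof.
move=> [mf fc fL f1 fT]; apply: contrapT => nxy.
have near_ z x : -T <= z <= T -> -T <= x <= T -> tau <= f z -> tau <= f x ->
    z - 4 * delta <= x <= z + 4 * delta.
  move=> /andP[z1 z2] /andP[x1 x2] fz fx; apply/andP; split.
    by rewrite leNgt; apply/negP => h; apply: nxy; exists x, z; split=> //; lra.
  by rewrite leNgt; apply/negP => h; apply: nxy; exists z, x; split=> //; lra.
have [z hz] : exists z, forall x, -T <= x <= T -> tau <= f x ->
    z - 4 * delta <= x <= z + 4 * delta.
  have [[z zT fz]|hz] := pselect (exists2 z, -T <= z <= T & tau <= f z).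
    by exists z => x xT fx; exact: near_.
  by exists 0 => x xT fx; exfalso; apply: hz; exists x.
pose I := `[z - 4 * delta, z + 4 * delta]%classic.
have mI : measurable I by exact: measurable_itv.
have mLI D : measurable_fun D (fun x => L * \1_I x : R).
  by apply: measurable_funM; [exact: measurable_cst|exact: measurable_indic].
have KT : -T <= T by have := T0; lra.
have dd : z - 4 * delta <= z + 4 * delta by have := delta0; lra.
have : (\int[mu]_(x in `[(- T)%R, T]%classic) (f x)%:E <=
    \int[mu]_(x in `[(- T)%R, T]%classic) (tau%:E + (L * \1_I x)%:E))%E.
  apply: ge0_le_integral => //.
  - by move=> x _; rewrite lee_fin; have /andP[] := fL x.
  - by apply/measurable_EFinP; exact: measurable_funTS.
  - by apply: emeasurable_funD; [exact: measurable_cst|apply/measurable_EFinP; exact: mLI].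
  - move=> x /=; rewrite in_itv/= -EFinD lee_fin => xT.
    have [fx|fx] := leP tau (f x); last first.
      by rewrite (le_trans (ltW fx))// lerDl mulr_ge0// ltW.
    rewrite indicE mem_set; last by rewrite /I/= in_itv/=; exact: hz.
    by rewrite mulr1; have /andP[_ h] := fL x; have := tau0; lra.
rewrite ge0_integralD//; last 3 first.
- by move=> x _; rewrite lee_fin ltW.
- by move=> x _; rewrite lee_fin mulr_ge0// ltW.
- by apply/measurable_EFinP; exact: mLI.
rewrite integral_cst//; under [X in (_ + X)%E]eq_integral do rewrite EFinM.
rewrite ge0_integralZl_EFin//; last 2 first.
- by apply/measurable_EFinP; exact: measurable_indic.
- exact: ltW.
rewrite integral_indic// [X in (tau%:E * X)%E](_ : _ = (T - - T)%:E); last exact: itv_length.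
move=> h.
have h2 : (mu (I `&` `[(- T)%R, T]) <= (8 * delta)%:E)%E.
  apply: (@le_trans _ _ (mu I)).
    by apply: le_measure; rewrite ?inE; [exact: measurableI|exact: mI|exact: subIsetl].
  by rewrite /I itv_length// lee_fin; lra.
have : ((3 / 4)%:E <= (tau * (T - - T))%:E + L%:E * (8 * delta)%:E)%E.
  apply: (le_trans fT); apply: (le_trans h); rewrite EFinM leeD2l//.
  by rewrite lee_pmul2l// lte_fin.
rewrite -EFinM -EFinD lee_fin.
have -> : tau * (T - - T) = 1 / 4 by rewrite /tau; field; rewrite gt_eqF.
have -> : L * (8 * delta) = 1 / 4 by rewrite /delta; field; rewrite gt_eqF.
by lra.
Qed.

Let center (k : nat) : R := - T + k%:R * delta.

Let ncenter : nat := (Num.truncn (2 * T / delta)).+3.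

(** The center and its neighbours at distance [delta] all have height at least [tau]. As the centers
    run through a grid, finitely many normalizations serve the whole class. *)
Let centered (k : nat) : set (R -> R) := bounded_class `&`
  [set f | tau <= f (center k) /\ tau <= f (center k - delta) /\ tau <= f (center k + delta)].

Let bounded_class_centered f : bounded_class f ->
  exists2 k, (k < ncenter)%N & centered k f.
Proof.
move=> Gf; have [x [y [Tx yT fx fy xy]]] := wide_level Gf.
have [_ fc _ _ _] := Gf.
have u0 : 0 <= (x + T) / delta by rewrite divr_ge0 ?(ltW delta0)//; lra.
pose k := Num.truncn ((x + T) / delta).
have /andP[k1 k2] := truncn_itv u0; rewrite -/k in k1 k2.
rewrite ler_pdivlMr// in k1; rewrite ltr_pdivrMr// -natr1 in k2.
have d0 := delta0.
have cE : center k.+2 = - T + k%:R * delta + 2 * delta.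
  by rewrite /center -addn2 natrD; ring.
(* [x] lies between the grid points [k] and [k.+1], so the grid points [k.+1], [k.+2] and [k.+3] lie
   between [x] and [x + 4 * delta]. *)
exists k.+2.
  have di : 0 < delta^-1 by rewrite invr_gt0; exact: delta0.
  by rewrite /ncenter !ltnS le_truncn// (ler_pM2r di); lra.
split=> //; split; [|split]; apply: (ln_concave_ge fc tau0 fx fy); rewrite cE;
  by apply/andP; split; lra.
Qed.

(** At distance [R0] from the center the height is at most [tau / expR 1]: otherwise the segment in
    between would carry mass at least 2. *)
Let R0 : R := 2 * expR 1 / tau.
Let R00 : 0 < R0. Proof. by rewrite divr_gt0 ?mulr_gt0 ?expR_gt0. Qed.
Let Le1 : 1 <= L * expR 1.
Proof.
by have := @expR_ge1Dx R 1; have := L1; have := expR_ge0 (1 : R); nra.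
Qed.
Let Lam : R := (ln L - ln tau) / (delta / R0).
Let lnLtau : 0 <= ln L - ln tau.
Proof. by rewrite subr_ge0 ler_ln ?posrE// (le_trans tau1). Qed.
Let Lam0 : 0 <= Lam.
Proof. by rewrite divr_ge0// divr_ge0// ltW. Qed.

(** The signs [s = 1] and [s = -1] give the two half-lines. By the choice of [R0], [ln F] has lost
    at least 1 at the point 1, so concavity gives [ln (F x) <= ln (F 0) - x] beyond it; the factor
    [expR 1] covers the part before. The point one [delta] behind the center, of height at least
    [tau], caps the upward slope of [ln F] by [Lam]. *)
Let half_line_of (s : R) (k : nat) f : s ^+ 2 = 1 -> centered k f ->
  half_line_class (L * expR 1) tau Lam (fun x => f (center k + s * R0 * x)).
Proof.
move=> s2 [[mf fc fL f1 fT] [fck [fcl fcr]]].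
have F0 x : 0 <= f x by have /andP[] := fL x.
have FL x : f x <= L by have /andP[] := fL x.
have sE : s = 1 \/ s = -1.
  by have /eqP := s2; rewrite sqrf_eq1 => /orP[]/eqP; [left|right].
set F := fun x => _; have Fc : ln_concave F by exact: ln_concave_affine.
have FF x : 0 <= F x by exact: F0.
have FFL x : F x <= L by exact: FL.
have F0E : F 0 = f (center k) by rewrite /F mulr0 addr0.
have Ftau : tau <= F 0 by rewrite F0E.
have Fpos0 : 0 < F 0 by exact: lt_le_trans Ftau.
have F1 : F 1 <= tau / expR 1.
  rewrite leNgt; apply/negP => F1.
  have m0 : 0 < tau / expR 1 by rewrite divr_gt0// expR_gt0.
  have tm : tau / expR 1 <= f (center k).
    rewrite (le_trans _ fck)// ler_pdivrMr ?expR_gt0// ler_peMr ?(ltW tau0)//.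
    by rewrite -[leLHS]expR0 ler_expR.
  have : tau / expR 1 * R0 <= 1.
    move: F1; rewrite /F mulr1; case: sE => -> /ltW F1.
      have h : center k <= center k + 1 * R0 by rewrite lerDl mul1r ltW.
      have := density_ge_on_segment mf F0 f1 fc m0 h tm F1.
      by rewrite mul1r addrAC subrr add0r.
    have h : center k + -1 * R0 <= center k by rewrite gerDl mulN1r oppr_le0 ltW.
    have := density_ge_on_segment mf F0 f1 fc m0 h F1 tm.
    by rewrite mulN1r opprB addrC subrK.
  rewrite /R0 (_ : tau / expR 1 * (2 * expR 1 / tau) = 2); first by lra.
  by field; rewrite !gt_eqF ?expR_gt0.
split=> //.
- move=> x x0; rewrite FF/=.
  have [x1|x1] := leP x 1.
    rewrite (le_trans (FFL _))// -mulrA ler_peMr ?(ltW L0)// -expRD -[leLHS]expR0 ler_expR.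
    by lra.
  have [Fx|Fx] := leP (F x) 0.
    by rewrite (le_trans Fx)// mulr_ge0 ?expR_ge0// (le_trans _ Le1).
  have h01 : (0 : R) <= 1 <= x by rewrite ler01 ltW.
  have [F1pos] := ln_concave3 Fc h01 Fpos0 Fx.
  rewrite !subr0 mul1r => h.
  have : ln (F 1) <= ln (F 0) - 1.
    rewrite -[X in _ - X](expRK 1) -ln_div ?posrE ?expR_gt0// ler_ln ?posrE ?divr_gt0 ?expR_gt0//.
    by rewrite (le_trans F1)// ler_pM2r// invr_gt0 expR_gt0.
  rewrite -(ler_pM2l (_ : 0 < x)); last by lra.
  move=> h2; have h3 : ln (F x) <= ln L - x.
    have : ln (F 0) <= ln L by rewrite ler_ln// posrE.
    by lra.
  move: h3; rewrite -ler_expR expRB !lnK ?posrE// => /le_trans; apply.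
  rewrite -expRN ler_wpM2r ?expR_ge0// ler_peMr ?(ltW L0)//.
  by rewrite -[leLHS]expR0 ler_expR.
- move=> u v u0 uv.
  have eta0 : 0 < delta / R0 by rewrite divr_gt0.
  have Feta : tau <= F (- (delta / R0)).
    rewrite /F mulrN -mulrA [R0 * _]mulrC divfK ?gt_eqF//.
    by case: sE => ->; rewrite ?mul1r ?mulN1r ?opprK.
  have Fetapos : 0 < F (- (delta / R0)) by exact: lt_le_trans Feta.
  have [Fv|Fv] := leP (F v) 0.
    by rewrite (le_trans Fv)// mulr_ge0 ?expR_ge0.
  have huv : - (delta / R0) <= u <= v by rewrite uv andbT; lra.
  have [Fu] := ln_concave3 Fc huv Fetapos Fv.
  have LamE : Lam = (ln L - ln tau) / (delta / R0) by [].
  move: (delta / R0) eta0 Feta LamE {huv Fetapos} => e e0 Feta LamE.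
  have le_ : ln tau <= ln (F (- e)) by rewrite ler_ln// posrE// (lt_le_trans tau0).
  have lu : ln (F u) <= ln L by rewrite ler_ln// posrE.
  move=> h; rewrite -ler_ln ?posrE ?mulr_gt0 ?expR_gt0// lnM ?posrE ?expR_gt0// expRK.
  have [huv|huv] := leP (ln (F v)) (ln (F u)).
    by rewrite (le_trans huv)// lerDl mulr_ge0// subr_ge0.
  rewrite -lerBlDl -(ler_pM2l e0).
  have -> : e * (Lam * (v - u)) = (ln L - ln tau) * (v - u).
    by rewrite LamE; field; rewrite gt_eqF.
  have hv0 : 0 <= v - u by rewrite subr_ge0.
  have h1 := ler_wpM2l hv0 le_; have h2 := ler_wpM2l hv0 lu.
  have h3 : u * 0 <= u * (ln (F v) - ln (F u)) by rewrite ler_wpM2l// subr_ge0 ltW.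
  by rewrite mulr0 in h3; lra.
Qed.

Let integral_laplace_sum (n : nat) (a l y : nat -> R) : (forall i, 0 <= a i /\ 0 < l i) ->
  (\int[mu]_x (\sum_(i < n) a i * expR (- (l i * `|x - y i|)))%:E
    = (\sum_(i < n) 2 * a i / l i)%:E)%E.
Proof.
move=> al.
have me i := measurable_laplace (l i) (y i).
under eq_integral do rewrite -sumEFin.
rewrite ge0_integral_sum//; last 2 first.
- by move=> i; apply/measurable_EFinP/measurable_funM; [exact: measurable_cst|exact: me].
- by move=> i x _; rewrite lee_fin mulr_ge0 ?expR_ge0//; case: (al i).
rewrite -sumEFin; apply: eq_bigr => i _; have [ai li] := al i.
under eq_integral do rewrite EFinM.
rewrite ge0_integralZl_EFin//; last by apply/measurable_EFinP; exact: me.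
by rewrite integral_laplace// -EFinM; congr EFin; ring.
Qed.

Lemma measurable_sqrt_dist f g : measurable_fun setT f -> measurable_fun setT g ->
  measurable_fun setT (sqrt_dist f g).
Proof.
move=> mf mg; have ms : measurable_fun setT (@Num.sqrt R).
  by apply: continuous_measurable_fun => x; exact: sqrt_continuous.
by apply: measurable_funX; apply: measurable_funB; apply: measurableT_comp.
Qed.

Let absdiv z : R0^-1 * `|z| = `|z / R0|.
Proof.
have r0 : 0 < R0^-1 by rewrite invr_gt0; exact: R00.
by rewrite normrM (gtr0_norm r0) mulrC.
Qed.

(** The half-lines are glued at [c]. Undoing the scaling divides the rates by [R0], so each side
    contributes [R0 * e]. *)
Let sqrt_dist_le c e f g : measurable_fun setT f -> measurable_fun setT g ->
  exp_dominated [set x | 0 <= x] e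
    (sqrt_dist (fun x => f (c + 1 * R0 * x)) (fun x => g (c + 1 * R0 * x))) ->
  exp_dominated [set x | 0 <= x] e
    (sqrt_dist (fun x => f (c + -1 * R0 * x)) (fun x => g (c + -1 * R0 * x))) ->
  (\int[mu]_x (sqrt_dist f g x)%:E <= (2 * R0 * e)%:E)%E.
Proof.
move=> mf mg [n [a [l [y [al ae hd]]]]] [n' [a' [l' [y' [al' ae' hd']]]]].
pose D x := \sum_(i < n) a i * expR (- (l i / R0 * `|x - (c + R0 * y i)|)).
pose D' x := \sum_(i < n') a' i * expR (- (l' i / R0 * `|x - (c - R0 * y' i)|)).
have R0n := gt_eqF R00.
have D0 x : 0 <= D x.
  by rewrite sumr_ge0// => i _; rewrite mulr_ge0 ?expR_ge0//; case: (al i).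
have D'0 x : 0 <= D' x.
  by rewrite sumr_ge0// => i _; rewrite mulr_ge0 ?expR_ge0//; case: (al' i).
have hD x : sqrt_dist f g x <= D x + D' x.
  have [cx|/ltW cx] := leP c x.
    have X0 : 0 <= (x - c) / R0 by rewrite divr_ge0 ?subr_ge0// ltW.
    have := hd _ X0; rewrite /sqrt_dist.
    have -> : c + 1 * R0 * ((x - c) / R0) = x by field; rewrite R0n.
    move=> /le_trans; apply; rewrite -[leLHS]addr0 lerD// ler_sum// => i _.
    rewrite le_eqVlt; apply/orP; left; apply/eqP; congr (_ * expR (- _)).
    rewrite -[RHS]mulrA absdiv; congr (_ * `|_|).
    by field; rewrite R0n.
  have X0 : 0 <= (c - x) / R0 by rewrite divr_ge0 ?subr_ge0// ltW.
  have := hd' _ X0; rewrite /sqrt_dist.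
  have -> : c + -1 * R0 * ((c - x) / R0) = x by field; rewrite R0n.
  move=> /le_trans; apply; rewrite -[leLHS]add0r lerD// ler_sum// => i _.
  rewrite le_eqVlt; apply/orP; left; apply/eqP; congr (_ * expR (- _)).
  rewrite -[RHS]mulrA absdiv -[in RHS]normrN; congr (_ * `|_|).
  by field; rewrite R0n.
have scale (m : nat) (b k : nat -> R) : \sum_(i < m) 2 * b i / k i <= e ->
    (forall i, 0 <= b i /\ 0 < k i) -> \sum_(i < m) 2 * b i / (k i / R0) <= R0 * e.
  move=> he bk; apply: le_trans (ler_wpM2l (ltW R00) he).
  rewrite mulr_sumr ler_sum// => i _; rewrite le_eqVlt; apply/orP; left; apply/eqP.
  by have [_ /gt_eqF kn] := bk i; field; rewrite R0n kn.
have al2 i : 0 <= a i /\ 0 < l i / R0 by have [? ?] := al i; rewrite divr_gt0.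
have al2' i : 0 <= a' i /\ 0 < l' i / R0 by have [? ?] := al' i; rewrite divr_gt0.
have mD : measurable_fun setT D.
  by apply: measurable_sum => i; apply: measurable_funM; [exact: measurable_cst|exact: measurable_laplace].
have mD' : measurable_fun setT D'.
  by apply: measurable_sum => i; apply: measurable_funM; [exact: measurable_cst|exact: measurable_laplace].
apply: (@le_trans _ _ (\int[mu]_x ((D x)%:E + (D' x)%:E))%E).
  apply: ge0_le_integral => //.
  - by move=> x _; rewrite lee_fin sqr_ge0.
  - by apply/measurable_EFinP; exact: measurable_sqrt_dist.
  - by apply: emeasurable_funD; exact/measurable_EFinP.
  - by move=> x _; rewrite -EFinD lee_fin.
rewrite ge0_integralD//; last 4 first.
- by move=> x _; rewrite lee_fin.
- exact/measurable_EFinP.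
- by move=> x _; rewrite lee_fin.
- exact/measurable_EFinP.
rewrite [X in (X + _)%E](@integral_laplace_sum n a (fun i => l i / R0) (fun i => c + R0 * y i) al2).
rewrite [X in (_ + X)%E](@integral_laplace_sum n' a' (fun i => l' i / R0) (fun i => c - R0 * y' i) al2').
rewrite -EFinD lee_fin.
have := scale _ _ _ ae al; have := scale _ _ _ ae' al'.
by move=> h1 h2; rewrite -mulrA mulr2n mulrDl mul1r lerD.
Qed.

Lemma bounded_class_entropy : exists2 D : R, 0 <= D & forall w, 1 <= w ->
  entropy_le bounded_class
    (fun f g => (\int[mu]_x (sqrt_dist f g x)%:E <= ((w ^+ 4)^-1)%:E)%E) (D * w).
Proof.
have [D0 D00 hD] := half_line_entropy Le1 tau0 tau1 Lam0.
(* Gluing multiplies the squared error by [B], so [w * B] is used in place of [w]: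
   [B / (w B) ^ 4 <= w ^- 4]. *)
pose B := 2 * R0.
have B1 : 1 <= B.
  have : 1 <= R0 by rewrite /R0 ler_pdivlMr// mul1r; have := @expR_ge1Dx R 1; have := tau1; lra.
  by rewrite /B; lra.
have B0 : 0 < B by exact: lt_le_trans B1.
have lnn : 0 <= ln ncenter%:R :> R by rewrite ln_ge0// ler1n.
exists (D0 * B + D0 * B + ln ncenter%:R).
  by rewrite addr_ge0// addr_ge0// mulr_ge0// ltW.
move=> w w1; have w0 : 0 < w by exact: lt_le_trans w1.
have wB1 : 1 <= w * B by rewrite -[leLHS]mulr1 ler_pM.
have key : D0 * (w * B) + D0 * (w * B) + ln ncenter%:R <=
    (D0 * B + D0 * B + ln ncenter%:R) * w.
  have : ln ncenter%:R * 1 <= ln ncenter%:R * w by rewrite ler_wpM2l.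
  by rewrite mulr1; lra.
suff h : entropy_le bounded_class
    (fun f g => (\int[mu]_x (sqrt_dist f g x)%:E <= ((w ^+ 4)^-1)%:E)%E)
    (D0 * (w * B) + D0 * (w * B) + ln ncenter%:R) by exact: (entropy_le_sub h).
apply: entropy_le_cover bounded_class_centered _ => k kn.
have h1 := entropy_le_preimage (fun f => @half_line_of 1 k f (expr1n _ 2)) (hD _ wB1).
have m1 : (-1 : R) ^+ 2 = 1 by rewrite sqrrN expr1n.
have h2 := entropy_le_preimage (fun f => @half_line_of (-1) k f m1) (hD _ wB1).
apply: (entropy_le_sub (entropy_le_and h1 h2)) => // f g [[mf _ _ _ _] _] [[mg _ _ _ _] _] [e1 e2].
apply: (le_trans (sqrt_dist_le mf mg e1 e2)); rewrite lee_fin -/B.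
rewrite exprMn invfM mulrCA ler_piMr ?invr_ge0 ?exprn_ge0 ?(ltW w0)//.
by rewrite ler_pdivrMr ?exprn_gt0// mul1r exprS ler_peMr ?(ltW B0)// exprn_ege1.
Qed.

End bounded_class.

(** * Birge's test ratio *)

Section tests.
Variable R : realType.
Let mu := @lebesgue_measure R.
Implicit Types f g : R -> R.

Lemma measurable_invr : measurable_fun setT (@GRing.inv R).
Proof.
have -> : [set: R] = [set x | x != 0] `|` [set 0].
  by apply/seteqP; split => x // _; case: (eqVneq x 0) => ?; [right|left].
have o0 : open [set x : R | x != 0] by exact: open_neq.
apply/measurable_funU => //; first exact: open_measurable.
split; last exact: measurable_fun_set1.
apply: open_continuous_measurable_fun => // x; rewrite inE/= => x0.
exact: inv_continuous.
Qed.

Lemma measurable_funV d (T : measurableType d) (u : T -> R) :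
  measurable_fun setT u -> measurable_fun setT (fun x => (u x)^-1).
Proof. by move=> mu'; exact: measurableT_comp measurable_invr mu'. Qed.

(* The square root of the ratio of [((2 * r + s) / 3) ^ 2] and
   [((r + 2 * s) / 3) ^ 2], the points trisecting the segment between [f0] and
   [f1] in the Hellinger geometry; unlike [f1 / f0] it lies in [1/2, 2]. *)
Definition birge_ratio f0 f1 (x : R) : R :=
  let s := Num.sqrt (f0 x) in let r := Num.sqrt (f1 x) in
  if r + s == 0 then 1 else (2 * r + s) / (r + 2 * s).

Lemma measurable_sqrt_fun f : measurable_fun setT f ->
  measurable_fun setT (fun x => Num.sqrt (f x)).
Proof.
move=> mf; apply: (@measurableT_comp _ _ _ _ _ _ (@Num.sqrt R)) mf.
by apply: continuous_measurable_fun => x; exact: sqrt_continuous.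
Qed.

Lemma birge_ratio_gt0 f0 f1 x : 0 < birge_ratio f0 f1 x.
Proof.
rewrite /birge_ratio; have r0 := sqrtr_ge0 (f1 x); have s0 := sqrtr_ge0 (f0 x).
case: ifPn => // rs; have : 0 < Num.sqrt (f1 x) + Num.sqrt (f0 x).
  by rewrite lt_neqAle eq_sym rs addr_ge0.
by move=> h; rewrite divr_gt0//; lra.
Qed.

Lemma measurable_birge_ratio f0 f1 : measurable_fun setT f0 -> measurable_fun setT f1 ->
  measurable_fun setT (birge_ratio f0 f1).
Proof.
move=> /measurable_sqrt_fun m0 /measurable_sqrt_fun m1; apply: measurable_fun_ifT => //.
- by apply: measurable_fun_eqr => //; exact: measurable_funD.
- apply: measurable_funM.
    by apply: measurable_funD => //; apply: measurable_funM.
  apply: measurable_funV.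
  by apply: measurable_funD => //; apply: measurable_funM.
Qed.

(** The gap between the two sides is [(r - s) ^ 2 * (s / 3) / (r + 2 * s)]. The multiples of [f0]
    and [f1] have equal integrals; placing them on opposite sides keeps every term nonnegative. *)
Let birge_null_pointwise f0 f1 x : 0 <= f0 x -> 0 <= f1 x ->
  f0 x * birge_ratio f0 f1 x + (6^-1 * sqrt_dist f1 f0 x + 6^-1 * f0 x)
    <= f0 x + 6^-1 * f1 x.
Proof.
move=> h0 h1; rewrite /birge_ratio /sqrt_dist.
have r0 := sqrtr_ge0 (f1 x); have s0 := sqrtr_ge0 (f0 x).
have e0 := sqr_sqrtr h0; have e1 := sqr_sqrtr h1.
move: (Num.sqrt (f1 x)) (Num.sqrt (f0 x)) r0 s0 e0 e1 => r s r0 s0 <- <-.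
case: ifPn => [/eqP rs|rs].
  have r_0 : r = 0 by lra.
  have s_0 : s = 0 by lra.
  by rewrite r_0 s_0 subrr !expr0n/= !mulr0 mul0r !addr0.
have rs0 : 0 < r + s by rewrite lt_neqAle eq_sym rs addr_ge0.
have D0 : 0 < r + 2 * s by lra.
rewrite -subr_ge0.
have -> : s ^+ 2 + 6^-1 * r ^+ 2 - (s ^+ 2 * ((2 * r + s) / (r + 2 * s)) +
    (6^-1 * (r - s) ^+ 2 + 6^-1 * s ^+ 2)) =
    (r - s) ^+ 2 * (3^-1 * s) / (r + 2 * s) by field; rewrite gt_eqF.
by rewrite divr_ge0 ?(ltW D0)// mulr_ge0 ?sqr_ge0//; lra.
Qed.

(** The root [q] of [f] is expanded around the root [r] of [f1], with [d = q - r]. The cross term is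
    split into [(s - r) ^ 2 / 24 + 6 d ^ 2]; this leaves [1/6 - 1/24 = 1/8] of the separation and
    costs [6 + 1 = 7] times [d ^ 2]. *)
Let birge_alt_pointwise f0 f1 f x : 0 <= f0 x -> 0 <= f1 x -> 0 <= f x ->
  f x / birge_ratio f0 f1 x + (6^-1 * f1 x + 8^-1 * sqrt_dist f1 f0 x)
    <= f x + (6^-1 * f0 x + 7 * sqrt_dist f f1 x).
Proof.
move=> h0 h1 h; rewrite /birge_ratio /sqrt_dist.
have q0 := sqrtr_ge0 (f x); have r0 := sqrtr_ge0 (f1 x); have s0 := sqrtr_ge0 (f0 x).
have e := sqr_sqrtr h; have e0 := sqr_sqrtr h0; have e1 := sqr_sqrtr h1.
move: (Num.sqrt (f x)) (Num.sqrt (f1 x)) (Num.sqrt (f0 x)) q0 r0 s0 e e0 e1.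
move=> q r s q0 r0 s0 <- <- <-.
case: ifPn => [/eqP rs|rs].
  have r_0 : r = 0 by lra.
  have s_0 : s = 0 by lra.
  rewrite r_0 s_0 subrr !expr0n/= !mulr0 subr0 divr1 !addr0 add0r lerDl.
  by rewrite mulr_ge0// sqr_ge0.
have rs0 : 0 < r + s by rewrite lt_neqAle eq_sym rs addr_ge0.
have D0 : 0 < 2 * r + s by lra.
pose a := r / (2 * r + s); pose t := (s - r) / (2 * r + s); pose d := q - r.
have a0 : 0 <= a by rewrite divr_ge0// ltW.
have a2 : a <= 1 / 2 by rewrite ler_pdivrMr//; lra.
have t1 : t <= 1 by rewrite ler_pdivrMr//; lra.
have e1 : q ^+ 2 / ((2 * r + s) / (r + 2 * s)) = q ^+ 2 + q ^+ 2 * t.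
  by rewrite /t; field; rewrite !gt_eqF//; lra.
have h1' : r ^+ 2 * t <= (s ^+ 2 - r ^+ 2) / 6 - (r - s) ^+ 2 / 6.
  rewrite /t mulrA ler_pdivrMr// -subr_ge0.
  have -> : ((s ^+ 2 - r ^+ 2) / 6 - (r - s) ^+ 2 / 6) * (2 * r + s) - r ^+ 2 * (s - r)
    = (r - s) ^+ 2 * (3^-1 * r) by field.
  by rewrite mulr_ge0 ?sqr_ge0//; lra.
have h2 : 2 * r * d * t <= (s - r) ^+ 2 / 24 + 6 * d ^+ 2.
  have -> : 2 * r * d * t = (2 * a) * (d * (s - r)) by rewrite /a /t; ring.
  have : d * (s - r) <= (s - r) ^+ 2 / 24 + 6 * d ^+ 2.
    by have := sqr_ge0 ((s - r) - 12 * d); nra.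
  have h0' : 0 <= (s - r) ^+ 2 / 24 + 6 * d ^+ 2.
    by have := sqr_ge0 (s - r); have := sqr_ge0 d; lra.
  have a20 : 0 <= 2 * a by lra.
  move=> /(ler_wpM2l a20) /le_trans; apply.
  by rewrite ler_piMl//; lra.
have h3 : d ^+ 2 * t <= d ^+ 2 by rewrite ler_piMr ?sqr_ge0.
have -> : q ^+ 2 / ((2 * r + s) / (r + 2 * s)) = q ^+ 2 + (r ^+ 2 * t + 2 * r * d * t + d ^+ 2 * t).
  by rewrite e1 /d; ring.
have -> : (q - r) ^+ 2 = d ^+ 2 by [].
have -> : (r - s) ^+ 2 = (s - r) ^+ 2 by ring.
move: h1'; have -> : (r - s) ^+ 2 = (s - r) ^+ 2 by ring.
by lra.
Qed.

Let integralZ (k : R) f : 0 <= k -> measurable_fun setT f -> (forall x, 0 <= f x) ->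
  (\int[mu]_x (k * f x)%:E = k%:E * \int[mu]_x (f x)%:E)%E.
Proof.
move=> k0 mf f0; under eq_integral do rewrite EFinM.
by apply: ge0_integralZl_EFin => //; do ?[exact/measurable_EFinP|move=> x _; rewrite lee_fin].
Qed.

Let integralD f g : measurable_fun setT f -> (forall x, 0 <= f x) ->
  measurable_fun setT g -> (forall x, 0 <= g x) ->
  (\int[mu]_x (f x + g x)%:E = \int[mu]_x (f x)%:E + \int[mu]_x (g x)%:E)%E.
Proof.
move=> mf f0 mg g0; under eq_integral do rewrite EFinD.
by apply: ge0_integralD => //; do ?[exact/measurable_EFinP|move=> x _; rewrite lee_fin].
Qed.

Let le_int f g : measurable_fun setT f -> (forall x, 0 <= f x) ->
  measurable_fun setT g -> (forall x, f x <= g x) ->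
  (\int[mu]_x (f x)%:E <= \int[mu]_x (g x)%:E)%E.
Proof.
move=> mf f0 mg fg; apply: ge0_le_integral => //.
- by move=> x _; rewrite lee_fin.
- exact/measurable_EFinP.
- exact/measurable_EFinP.
- by move=> x _; rewrite lee_fin.
Qed.

Lemma birge_null f0 f1 (h2 : R) : is_density f0 -> is_density f1 ->
  (h2%:E <= \int[mu]_x (sqrt_dist f1 f0 x)%:E)%E ->
  (\int[mu]_x (f0 x * birge_ratio f0 f1 x)%:E <= (1 - h2 / 6)%:E)%E.
Proof.
move=> [m0 p0 i0] [m1 p1 i1] hh.
have mB := measurable_birge_ratio m0 m1.
have mS : measurable_fun setT (sqrt_dist f1 f0) by exact: measurable_sqrt_dist.
have sp x : 0 <= sqrt_dist f1 f0 x by exact: sqr_ge0.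
have mfB : measurable_fun setT (fun x => f0 x * birge_ratio f0 f1 x) by exact: measurable_funM.
have fB0 x : 0 <= f0 x * birge_ratio f0 f1 x by rewrite mulr_ge0// ltW// birge_ratio_gt0.
have mc (k : R) (f : R -> R) : measurable_fun setT f -> measurable_fun setT (fun x => k * f x).
  by move=> ?; apply: measurable_funM => //; exact: measurable_cst.
have p6 (k : R) (f : R -> R) : 0 <= k -> (forall x, 0 <= f x) -> forall x, 0 <= k * f x.
  by move=> ? ? x; rewrite mulr_ge0.
have k6 : 0 <= 6^-1 :> R by rewrite invr_ge0.
have mS6 := mc 6^-1 _ mS; have pS6 := p6 _ _ k6 sp.
have m06 := mc 6^-1 _ m0; have p06 := p6 _ _ k6 p0.
have m16 := mc 6^-1 _ m1; have p16 := p6 _ _ k6 p1.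
have mSD := measurable_funD mS6 m06; have pSD x := addr_ge0 (pS6 x) (p06 x).
have := @le_int (fun x => f0 x * birge_ratio f0 f1 x + (6^-1 * sqrt_dist f1 f0 x + 6^-1 * f0 x))
  (fun x => f0 x + 6^-1 * f1 x).
rewrite (integralD mfB fB0 mSD pSD) (integralD mS6 pS6 m06 p06) (integralD m0 p0 m16 p16).
rewrite (integralZ k6 mS sp) (integralZ k6 m0 p0) (integralZ k6 m1 p1) i0 i1 !mule1.
set I := (\int[mu]_x (f0 x * _)%:E)%E.
have I0 : (0 <= I)%E by apply: integral_ge0 => x _; rewrite lee_fin.
move: hh; set H := (\int[mu]_x (sqrt_dist f1 f0 x)%:E)%E.
have H0 : (0 <= H)%E by apply: integral_ge0 => x _; rewrite lee_fin.
move=> hh /(_ (measurable_funD mfB mSD)) /(_ (fun x => addr_ge0 (fB0 x) (pSD x))).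
move=> /(_ (measurable_funD m0 m16)) /(_ (fun x => birge_null_pointwise (p0 x) (p1 x))).
move: I0 H0 hh; case: I => [a| |] //; case: H => [b| |] //= a0 b0 hh.
- by rewrite -EFinM -!EFinD !lee_fin in hh * => ?; lra.
- by rewrite gt0_muley ?lte_fin ?invr_gt0.
- by rewrite gt0_muley ?lte_fin ?invr_gt0.
Qed.

(** The radius is chosen so that the loss [7 * h2 / 112 = h2 / 16] takes half of the gain [h2 / 8];
    the ratio built from [f1] then serves every [f] of the same code. *)
Lemma birge_alt f0 f1 f (h2 : R) : is_density f0 -> is_density f1 -> is_density f ->
  (h2%:E <= \int[mu]_x (sqrt_dist f1 f0 x)%:E)%E ->
  (\int[mu]_x (sqrt_dist f f1 x)%:E <= (h2 / 112)%:E)%E ->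
  (\int[mu]_x (f x / birge_ratio f0 f1 x)%:E <= (1 - h2 / 16)%:E)%E.
Proof.
move=> [m0 p0 i0] [m1 p1 i1] [m p i] hh kk.
have mB := measurable_birge_ratio m0 m1.
have mS : measurable_fun setT (sqrt_dist f1 f0) by exact: measurable_sqrt_dist.
have mS' : measurable_fun setT (sqrt_dist f f1) by exact: measurable_sqrt_dist.
have sp x : 0 <= sqrt_dist f1 f0 x by exact: sqr_ge0.
have sp' x : 0 <= sqrt_dist f f1 x by exact: sqr_ge0.
have mfB : measurable_fun setT (fun x => f x / birge_ratio f0 f1 x).
  apply: measurable_funM => //.
  exact: measurable_funV.
have fB0 x : 0 <= f x / birge_ratio f0 f1 x by rewrite divr_ge0// ltW// birge_ratio_gt0.
have mc (k : R) (u : R -> R) : measurable_fun setT u -> measurable_fun setT (fun x => k * u x).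
  by move=> ?; apply: measurable_funM => //; exact: measurable_cst.
have p6 (k : R) (u : R -> R) : 0 <= k -> (forall x, 0 <= u x) -> forall x, 0 <= k * u x.
  by move=> ? ? x; rewrite mulr_ge0.
have k6 : 0 <= 6^-1 :> R by rewrite invr_ge0.
have k8 : 0 <= 8^-1 :> R by rewrite invr_ge0.
have k7 : 0 <= 7 :> R by [].
have mS8 := mc 8^-1 _ mS; have pS8 := p6 _ _ k8 sp.
have mS7 := mc 7 _ mS'; have pS7 := p6 _ _ k7 sp'.
have m06 := mc 6^-1 _ m0; have p06 := p6 _ _ k6 p0.
have m16 := mc 6^-1 _ m1; have p16 := p6 _ _ k6 p1.
have mL := measurable_funD m16 mS8; have pL x := addr_ge0 (p16 x) (pS8 x).
have mU := measurable_funD m06 mS7; have pU x := addr_ge0 (p06 x) (pS7 x).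
have := @le_int (fun x => f x / birge_ratio f0 f1 x + (6^-1 * f1 x + 8^-1 * sqrt_dist f1 f0 x))
  (fun x => f x + (6^-1 * f0 x + 7 * sqrt_dist f f1 x)).
rewrite (integralD mfB fB0 mL pL) (integralD m16 p16 mS8 pS8).
rewrite (integralD m p mU pU) (integralD m06 p06 mS7 pS7).
rewrite (integralZ k6 m1 p1) (integralZ k8 mS sp) (integralZ k6 m0 p0) (integralZ k7 mS' sp').
rewrite i i0 i1 !mule1.
set I := (\int[mu]_x (f x / _)%:E)%E.
have I0 : (0 <= I)%E by apply: integral_ge0 => x _; rewrite lee_fin.
move: hh kk; set H := (\int[mu]_x (sqrt_dist f1 f0 x)%:E)%E.
set K := (\int[mu]_x (sqrt_dist f f1 x)%:E)%E.
have H0 : (0 <= H)%E by apply: integral_ge0 => x _; rewrite lee_fin.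
have K0 : (0 <= K)%E by apply: integral_ge0 => x _; rewrite lee_fin.
move=> hh kk /(_ (measurable_funD mfB mL)) /(_ (fun x => addr_ge0 (fB0 x) (pL x))).
move=> /(_ (measurable_funD m mU)) /(_ (fun x => birge_alt_pointwise (p0 x) (p1 x) (p x))).
move: I0 H0 hh K0 kk; case: K => [c| |] //; case: I => [a| |] //; case: H => [b| |] //= a0 b0 hh c0 kk.
- by rewrite -!EFinM -!EFinD !lee_fin in hh kk * => ?; lra.
- by rewrite gt0_muley ?lte_fin ?invr_gt0.
- by rewrite gt0_muley ?lte_fin ?invr_gt0.
Qed.

End tests.

(** * Indicator tests for the remaining densities *)

Section far_tests.
Variable R : realType.
Let mu := @lebesgue_measure R.

Lemma lc_ln_concave (f : lc_density R) : ln_concave f.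
Proof.
move=> u v t t01 fu fv; have := lc_log_concave f u v t01.
rewrite /= [f u <= 0]leNgt fu [f v <= 0]leNgt fv/=.
by case: ifPn => // h; rewrite ltNge h -!EFinM -EFinD lee_fin.
Qed.

Lemma lc_law_setC (f : lc_density R) (A : set R) : measurable A ->
  lc_law f (~` A) = (1 - lc_law f A)%E.
Proof. by move=> mA; exact: (probability_setC (lc_law f) mA). Qed.

Lemma lc_law_le1 (f : lc_density R) (A : set R) : measurable A -> (lc_law f A <= 1)%E.
Proof. by move=> mA; exact: (probability_le1 (lc_law f) mA). Qed.

Lemma lc_law_ge0 (f : lc_density R) (A : set R) : (0 <= lc_law f A)%E.
Proof. exact: (measure_ge0 (lc_law f) A). Qed.

(* 22 / 25 balances [P0 A <= 1/8] against [P A >= 1/4]: both expectations of the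
   test are less than 1. *)
Definition indicator_ratio (A : set R) (x : R) : R := 22 / 25 * (1 + \1_A x).

Lemma indicator_ratio_gt0 A x : 0 < indicator_ratio A x.
Proof. by rewrite mulr_gt0// ltr_wpDr. Qed.

Lemma measurable_indicator_ratio A : measurable A -> measurable_fun setT (indicator_ratio A).
Proof.
move=> mA; apply: measurable_funM; first exact: measurable_cst.
by apply: measurable_funD; [exact: measurable_cst|exact: measurable_indic].
Qed.

Let integral_indicator_combination (f : lc_density R) (A : set R) (a b : R) : measurable A ->
  0 <= a -> 0 <= b ->
  (\int[mu]_x (a * f x + b * (f x * \1_A x))%:E = a%:E + b%:E * lc_law f A)%E.
Proof.
move=> mA a0 b0; have [mf f0 f1] := lc_is_density f.
have mfA : measurable_fun setT (fun x => f x * \1_A x).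
  by apply: measurable_funM => //; exact: measurable_indic.
have fA0 x : 0 <= f x * \1_A x by rewrite mulr_ge0.
under eq_integral do rewrite EFinD !EFinM.
rewrite ge0_integralD//; last 4 first.
- by move=> x _; rewrite -EFinM lee_fin mulr_ge0.
- by apply/measurable_EFinP/measurable_funM => //; exact: measurable_cst.
- by move=> x _; rewrite -!EFinM lee_fin mulr_ge0.
- by apply/measurable_EFinP/measurable_funM => //; exact: measurable_cst.
rewrite ge0_integralZl_EFin//; last 2 first.
- by move=> x _; rewrite lee_fin.
- exact/measurable_EFinP.
rewrite f1 mule1; congr (_ + _)%E.
rewrite ge0_integralZl_EFin//; last 2 first.
- by move=> x _; rewrite -EFinM lee_fin.
- exact/measurable_EFinP.
congr (_ * _)%E; rewrite /lc_law [RHS]integral_mkcond; apply: eq_integral => x _.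
by rewrite epatch_indic.
Qed.

Lemma indicator_null (f0 : lc_density R) (A : set R) : measurable A ->
  (lc_law f0 A <= (1 / 8)%:E)%E ->
  (\int[mu]_x (f0 x * indicator_ratio A x)%:E <= (175 / 176)%:E)%E.
Proof.
move=> mA hA; have k0 : 0 <= 22 / 25 :> R by rewrite divr_ge0.
have -> : (\int[mu]_x (f0 x * indicator_ratio A x)%:E =
    \int[mu]_x (22 / 25 * f0 x + 22 / 25 * (f0 x * \1_A x))%:E)%E.
  by apply: eq_integral => x _; congr EFin; rewrite /indicator_ratio; ring.
rewrite integral_indicator_combination//.
apply: (@le_trans _ _ ((22 / 25)%:E + (22 / 25)%:E * (1 / 8)%:E)%E).
  by rewrite leeD2l// lee_pmul2l// lte_fin; lra.
by rewrite -EFinM -EFinD lee_fin; lra.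
Qed.

(** The ratio is 22/25 off [A] and 44/25 on it, so the integral is 25/44 times one plus the mass of
    the complement. As that mass is at most 3/4, this is where 175/176 comes from. *)
Lemma indicator_alt (f : lc_density R) (A : set R) : measurable A ->
  ((1 / 4)%:E <= lc_law f A)%E ->
  (\int[mu]_x (f x / indicator_ratio A x)%:E <= (175 / 176)%:E)%E.
Proof.
move=> mA hA; have k0 : 0 <= 25 / 22 :> R by rewrite divr_ge0.
have k1 : 0 <= 25 / 44 :> R by rewrite divr_ge0.
have [mf f0 f1] := lc_is_density f.
have mC : measurable (~` A) by exact: measurableC.
have -> : (\int[mu]_x (f x / indicator_ratio A x)%:E =
    \int[mu]_x (25 / 44 * f x + 25 / 44 * (f x * \1_(~` A) x))%:E)%E.
  apply: eq_integral => x _; congr EFin; rewrite /indicator_ratio !indicE in_setC.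
  by case: (x \in A) => /=; field.
rewrite integral_indicator_combination//.
have hC : (lc_law f (~` A) <= (3 / 4)%:E)%E.
  rewrite lc_law_setC//.
  move: hA; have : (lc_law f A <= 1)%E by exact: lc_law_le1.
  case: (lc_law f A) => [a| |]//.
  by rewrite !lee_fin => ? ?; lra.
apply: (@le_trans _ _ ((25 / 44)%:E + (25 / 44)%:E * (3 / 4)%:E)%E).
  by rewrite leeD2l// lee_pmul2l// lte_fin; lra.
by rewrite -EFinM -EFinD lee_fin; lra.
Qed.

Let expR1_2 : 2 <= expR 1 :> R.
Proof. by have := @expR_ge1Dx R 1; lra. Qed.

(** If [f] still exceeded [f x / expR 1] at distance [2 expR 1 / f x], the segment in between would
    carry mass at least 2. So [ln f] has lost 1 by then, and concavity continues the descent at no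
    smaller slope. *)
Lemma density_decay (f : R -> R) (x y : R) : is_density f -> ln_concave f -> 0 < f x ->
  2 * expR 1 / f x <= `|y - x| -> f y <= f x * expR (- (f x / (2 * expR 1) * `|y - x|)).
Proof.
move=> [mf f0 f1] fc fx; set r := 2 * expR 1 / f x.
have e0 := expR_gt0 (1 : R).
have r0 : 0 < r by rewrite divr_gt0// mulr_gt0.
have -> : f x / (2 * expR 1) = r^-1 by rewrite invf_div.
move=> ry; have [fy|fy] := leP (f y) 0.
  by rewrite (le_trans fy)// mulr_ge0 ?expR_ge0.
have small z : `|z - x| = r -> f z <= f x / expR 1.
  move=> zr; rewrite leNgt; apply/negP => fz.
  have m0 : 0 < f x / expR 1 by rewrite divr_gt0.
  have mx : f x / expR 1 <= f x.
    by rewrite ler_pdivrMr// ler_peMr ?(ltW fx)//; have := expR1_2; lra.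
  have : f x / expR 1 * r <= 1.
    have [xz|/ltW zx] := leP x z.
      have := density_ge_on_segment mf f0 f1 fc m0 xz mx (ltW fz).
      by rewrite -zr ger0_norm// subr_ge0.
    have := density_ge_on_segment mf f0 f1 fc m0 zx (ltW fz) mx.
    by rewrite -zr distrC ger0_norm// subr_ge0.
  have -> : f x / expR 1 * r = 2 by rewrite /r; field; rewrite !gt_eqF.
  by lra.
have lnsmall z : 0 < f z -> `|z - x| = r -> ln (f z) <= ln (f x) - 1.
  move=> fz /small h; rewrite -[X in _ - X](expRK 1) -ln_div ?posrE// ler_ln ?posrE ?divr_gt0//.
suff : ln (f y) <= ln (f x) - r^-1 * `|y - x|.
  by rewrite -ler_expR expRB !lnK ?posrE// -expRN.
rewrite -(ler_pM2l r0) mulrBr mulrA divff ?gt_eqF// mul1r.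
have [xy|/ltW yx] := leP x y.
  move: ry; rewrite (ger0_norm (_ : 0 <= y - x)) ?subr_ge0// => ry.
  have xzy : x <= x + r <= y by rewrite lerDl (ltW r0)/=; lra.
  have [fz] := ln_concave3 fc xzy fx fy.
  have zr : `|x + r - x| = r by rewrite addrAC subrr add0r gtr0_norm.
  have := lnsmall _ fz zr.
  have : 0 <= y - x by rewrite subr_ge0.
  by move=> h1 h2 h3; have := ler_wpM2l h1 h2; lra.
move: ry; rewrite distrC (ger0_norm (_ : 0 <= x - y)) ?subr_ge0// => ry.
have yzx : y <= x - r <= x by rewrite gerBl (ltW r0) andbT; lra.
have [fz] := ln_concave3 fc yzx fy fx.
have zr : `|x - r - x| = r by rewrite addrAC subrr add0r normrN gtr0_norm.
have := lnsmall _ fz zr.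
have : 0 <= x - y by rewrite subr_ge0.
by move=> h1 h2 h3; have := ler_wpM2l h1 h2; lra.
Qed.

(** Let [l] be half the rate of [density_decay]; the radius satisfies [l * d = 8]. Outside it [f] is
    at most [f x * expR (- 8)] times the two-sided exponential of rate [l], whose total mass
    [8 * expR (- 7)] is below 1/2. *)
Lemma density_concentration (f : lc_density R) (x : R) : 0 < f x ->
  ((1 / 2)%:E <= lc_law f `[(x - 32 * expR 1 / f x)%R, (x + 32 * expR 1 / f x)%R]%classic)%E.
Proof.
move=> fx; have [mf f0 f1] := lc_is_density f.
have e0 := expR_gt0 (1 : R).
set d := 32 * expR 1 / f x; set I := `[_, _]%classic.
pose l := f x / (4 * expR 1).
have l0 : 0 < l by rewrite divr_gt0// mulr_gt0.
pose E := f x * expR (- 8).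
have E0 : 0 <= E by rewrite mulr_ge0 ?expR_ge0.
have mI : measurable I by exact: measurable_itv.
have pw y : f y <= f y * \1_I y + E * expR (- (l * `|y - x|)).
  have [yI|yI] := boolP (y \in I).
    by rewrite indicE yI mulr1 lerDl mulr_ge0// expR_ge0.
  rewrite indicE (negbTE yI) mulr0 add0r.
  have dy : d < `|y - x|.
    rewrite ltNge; apply/negP; rewrite ler_norml => /andP[h1 h2].
    by move/negP: yI; apply; rewrite inE /I/= in_itv/=; apply/andP; split; lra.
  have hr : 2 * expR 1 / f x <= `|y - x|.
    rewrite (le_trans _ (ltW dy))// /d ler_pM2r ?invr_gt0// ler_pM2r//; lra.
  apply: (le_trans (density_decay (lc_is_density f) (@lc_ln_concave f) fx hr)).
  rewrite /E -[leRHS]mulrA ler_wpM2l// -expRD ler_expR.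
  have -> : f x / (2 * expR 1) = 2 * l by rewrite /l; field; rewrite gt_eqF.
  have : l * d <= l * `|y - x| by rewrite ler_wpM2l// ltW.
  have -> : l * d = 8 by rewrite /l /d; field; rewrite !gt_eqF.
  by lra.
have : (1 <= lc_law f I + (E * (2 / l))%:E)%E.
  rewrite -f1; apply: (@le_trans _ _ (\int[mu]_y ((f y * \1_I y)%:E + (E * expR (- (l * `|y - x|)))%:E))%E).
    apply: ge0_le_integral => //.
    - by move=> y _; rewrite lee_fin.
    - exact/measurable_EFinP.
    - apply: emeasurable_funD; apply/measurable_EFinP/measurable_funM; [exact: mf
        |exact: measurable_indic|exact: measurable_cst|exact: measurable_laplace].
    - by move=> y _; rewrite -EFinD lee_fin.
  rewrite ge0_integralD//; last 4 first.
  - by move=> y _; rewrite lee_fin mulr_ge0.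
  - by apply/measurable_EFinP/measurable_funM => //; exact: measurable_indic.
  - by move=> y _; rewrite lee_fin mulr_ge0// expR_ge0.
  - by apply/measurable_EFinP/measurable_funM; [exact: measurable_cst|exact: measurable_laplace].
  rewrite leeD//.
    rewrite /lc_law [leRHS]integral_mkcond; rewrite le_eqVlt; apply/orP; left; apply/eqP.
    by apply: eq_integral => y _; rewrite epatch_indic.
  under eq_integral do rewrite EFinM.
  rewrite ge0_integralZl_EFin//; last first.
    by apply/measurable_EFinP; exact: measurable_laplace.
  by rewrite integral_laplace.
have : E * (2 / l) <= 1 / 2.
  have -> : E * (2 / l) = 8 * (expR 1 * expR (- 8)).
    by rewrite /E /l; field; rewrite !gt_eqF.
  rewrite -expRD; have -> : 1 + - 8 = - 7 :> R by ring.
  rewrite expRN ler_pdivrMr ?expR_gt0//.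
  have -> : (7 : R) = 7%:R * 1 by rewrite mulr1.
  rewrite expRM_natl; have : 2 ^+ 7 <= expR 1 ^+ 7 :> R.
    by apply: lerXn2r; rewrite ?nnegrE ?expR_ge0.
  by rewrite !exprS expr0; lra.
have : (lc_law f I <= 1)%E by exact: lc_law_le1.
have : (0 <= lc_law f I)%E by exact: lc_law_ge0.
case: (lc_law f I) => [a| |]// a0 a1 hE.
by rewrite -EFinD !lee_fin => ?; lra.
Qed.

(** Outside the bounded class, either at least 1/4 of the mass lies off [[-T, T]], or some value
    exceeds [L]. In the second case half of the mass lies within [w] of the peak. Intervals of
    half-width [2 * w] at step [w] catch every peak in reach, and a peak further out puts that mass
    off [[-T, T]]. Under [f0] these sets have mass at most 1/8, for large [T] and, by absolute
    continuity of the integral, for small [w]. *)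
Lemma far_tests (f0 : lc_density R) : exists (T L : R) (N : nat) (A : nat -> set R),
  [/\ 1 <= T /\ 1 <= L, forall j, measurable (A j),
      forall j, (lc_law f0 (A j) <= (1 / 8)%:E)%E &
      forall f : lc_density R, bounded_class T L f \/
        exists2 j, (j < N)%N & ((1 / 4)%:E <= lc_law f (A j))%E].
Proof.
have [mf0 p0 i0] := lc_is_density f0.
have [T T1 hT] : exists2 T : R, 1 <= T & (lc_law f0 (~` `[(- T)%R, T]%classic) <= (1 / 8)%:E)%E.
  pose K (n : nat) : set R := `[- n%:R, n%:R]%classic.
  have ndK : {homo K : n m / (n <= m)%N >-> (n <= m)%O}.
    move=> n m nm; apply/subsetPset => x; rewrite /K/= !in_itv/= => /andP[h1 h2].
    have : n%:R <= m%:R :> R by rewrite ler_nat.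
    by move=> ?; apply/andP; split; lra.
  have Kcup : \bigcup_n K n = setT.
    apply/seteqP; split => // x _; exists (Num.truncn `|x|).+1 => //.
    rewrite /K/= in_itv/= -ler_norml; apply: ltW; exact: truncnS_gt.
  have mK n : measurable (K n) by exact: measurable_itv.
  have cK : lc_law f0 (K n) @[n --> \oo] --> 1%E.
    rewrite -(probability_setT (lc_law f0)) -Kcup.
    by apply: nondecreasing_cvg_mu => //; rewrite Kcup.
  have h78 : nbhs (1%E : \bar R) [set y | ((7 / 8)%:E < y)%E].
    apply: open_nbhs_nbhs; split; first exact: open_ereal_gt_ereal.
    by rewrite /= lte_fin; lra.
  have [n _ hn] := cK _ h78.
  pose m := maxn n 1.
  exists m%:R; first by rewrite ler1n leq_maxr.
  have hm : ((7 / 8)%:E < lc_law f0 (K m))%E := hn m (leq_maxl _ _).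
  rewrite lc_law_setC; last exact: mK.
  move: hm; have : (lc_law f0 (K m) <= 1)%E by exact: lc_law_le1.
  case: (lc_law f0 (K m)) => [a| |]//.
  by rewrite lte_fin !lee_fin => ? ?; lra.
have [w w0 hw] : exists2 w : R, 0 < w &
    forall a : R, (lc_law f0 `[(a - 2 * w)%R, (a + 2 * w)%R]%classic <= (1 / 8)%:E)%E.
  have if0 : mu.-integrable setT (EFin \o f0).
    apply/integrableP; split; first exact/measurable_EFinP.
    under eq_integral do rewrite /= ger0_norm//.
    by rewrite i0 ltry.
  have e8 : 0 < 1 / 8 :> R by [].
  have [d [d0 hd]] := integral_normr_continuous if0 e8.
  exists (d / 8); first by rewrite divr_gt0.
  move=> a; have mI : measurable `[a - 2 * (d / 8), a + 2 * (d / 8)]%classic by exact: measurable_itv.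
  have muI : (mu `[(a - 2 * (d / 8))%R, (a + 2 * (d / 8))%R]%classic < d%:E)%E.
    rewrite /mu lebesgue_measure_itv/= lte_fin ifT; last by lra.
    by rewrite -EFinB lte_fin; lra.
  have := hd _ mI muI; rewrite /Rintegral.
  under eq_integral do rewrite /= ger0_norm//.
  rewrite -[X in fine X]/(lc_law f0 _) => h.
  have h1 : (lc_law f0 `[(a - 2 * (d / 8))%R, (a + 2 * (d / 8))%R]%classic <= 1)%E by exact: lc_law_le1.
  have h0 : (0 <= lc_law f0 `[(a - 2 * (d / 8))%R, (a + 2 * (d / 8))%R]%classic)%E by exact: lc_law_ge0.
  by move: h h0 h1; case: (lc_law _ _) => [b| |]//= h _ _; rewrite lee_fin ltW.
have e0 := expR_gt0 (1 : R).
(* A value above [L] makes the radius in [density_concentration] at most [w]. *)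
pose L : R := 1 + 32 * expR 1 / w.
pose a (j : nat) : R := - T - w + j%:R * w.
pose N := (Num.truncn ((2 * T + 2 * w) / w)).+1.
pose A (j : nat) : set R := if j is j'.+1 then `[a j' - 2 * w, a j' + 2 * w]%classic
  else ~` `[- T, T]%classic.
exists T, L, N.+1, A; split.
- by split=> //; rewrite /L lerDl divr_ge0 ?mulr_ge0 ?ltW.
- by case=> [|j]; [apply: measurableC|]; exact: measurable_itv.
- by case=> [|j] //; exact: hw.
move=> f; have [[j jN hj]|nf] := pselect (exists2 j, (j < N.+1)%N & ((1 / 4)%:E <= lc_law f (A j))%E).
  by right; exists j.
left; have hA j : (j < N.+1)%N -> (lc_law f (A j) < (1 / 4)%:E)%E.
  by move=> jN; rewrite ltNge; apply/negP => h; apply: nf; exists j.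
have [mf pf i_f] := lc_is_density f.
have mA j : measurable (A j).
  by case: j => [|j]; [apply: measurableC|]; exact: measurable_itv.
split=> //.
- exact: lc_ln_concave.
- move=> x; rewrite pf/= leNgt; apply/negP => fL.
  have fx : 0 < f x.
    by apply: lt_trans fL; rewrite /L ltr_wpDr// divr_ge0 ?mulr_ge0 ?ltW.
  have dw : 32 * expR 1 / f x <= w.
    have : 32 * expR 1 / w < f x by apply: lt_trans fL; rewrite /L ltrDr.
    by rewrite ltr_pdivrMr// ler_pdivrMr// [w * _]mulrC => /ltW.
  have conc := density_concentration fx.
  (* Beyond [T + w] the interval misses [[-T, T]] and is contained in [A 0]; otherwise the grid
     point just left of [x] gives a containing interval. *)
  have [j jN hj] : exists2 j, (j < N.+1)%N & `[x - 32 * expR 1 / f x, x + 32 * expR 1 / f x]%classic `<=` A j.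
    have [xT|xT] := leP `|x| (T + w); last first.
      exists 0%N => // y; rewrite /A/= !in_itv/= => /andP[y1 y2] /andP[y3 y4].
      suff : `|x| <= T + w by rewrite leNgt xT.
      by rewrite ler_norml; apply/andP; split; lra.
    move: xT; rewrite ler_norml => /andP[x1 x2].
    have u0 : 0 <= (x + T + w) / w by rewrite divr_ge0 ?(ltW w0)//; lra.
    pose k := Num.truncn ((x + T + w) / w).
    have /andP[k1 k2] := truncn_itv u0; rewrite -/k in k1 k2.
    rewrite ler_pdivlMr// in k1; rewrite ltr_pdivrMr// -natr1 in k2.
    exists k.+1.
      rewrite /N !ltnS le_truncn// ler_pM2r ?invr_gt0//; lra.
    move=> y; rewrite /A/= !in_itv/= /a => /andP[y1 y2].
    by apply/andP; split; lra.
  have := hA j jN; rewrite ltNge => /negP; apply.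
  apply: (@le_trans _ _ (1 / 2)%:E); first by rewrite lee_fin; lra.
  apply: (le_trans conc); apply: (le_measure (lc_law f)) hj; rewrite inE; last exact: mA.
  exact: measurable_itv.
- have := hA 0%N (ltn0Sn _).
  rewrite /A lc_law_setC; last exact: measurable_itv.
  rewrite -[(\int[_]_(x in _) _)%E]/(lc_law f `[(- T)%R, T]%classic).
  have : (lc_law f `[(- T)%R, T]%classic <= 1)%E by exact: lc_law_le1.
  have : (0 <= lc_law f `[(- T)%R, T]%classic)%E by exact: lc_law_ge0.
  case: (lc_law f _) => [b| |]// _ _.
  by rewrite lte_fin lee_fin => ?; lra.
Qed.

End far_tests.

(** * Joint measurability of evaluation *)

Section joint_measurability.
Variable R : realType.
Let mu := @lebesgue_measure R.
Implicit Types f : lc_density R.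

(** A density cannot live on a single point. Concavity along the segment to a second positive point
    will bound [f] from below near [x]. *)
Let positive_elsewhere f x : exists2 y, y != x & 0 < f y.
Proof.
apply: contrapT => ny; have [mf f0 f1] := lc_is_density f.
have fE y : f y = f x * \1_[set x] y.
  rewrite indicE; have [->|yx] := eqVneq y x; first by rewrite mem_set// mulr1.
  rewrite memNset ?mulr0//; last by move=> /= /eqP; apply/negP.
  apply/eqP; rewrite eq_le f0 andbT leNgt; apply/negP => fy; apply: ny.
  by exists y.
have : (\int[mu]_y (f y)%:E = 0)%E.
  under eq_integral do rewrite fE EFinM.
  rewrite ge0_integralZl_EFin//; last by apply/measurable_EFinP; exact: measurable_indic.
  rewrite integral_indic// setIT [X in (_ * X)%E](_ : _ = 0%E) ?mule0//.
  exact: lebesgue_measure_set1.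
by rewrite f1 => -[] /eqP; rewrite oner_eq0.
Qed.

(** Upper semi-continuity alone would allow an isolated peak at [x]. On the way from [x] to a second
    positive point, however, [ln f] decreases at most linearly, so nearby rationals on that side
    almost keep the value. *)
Let near_value f x a k : 0 < a -> a <= f x ->
  exists q : rat, `|ratr q - x| < k.+1%:R^-1 /\ a - k.+1%:R^-1 < f (ratr q).
Proof.
move=> a0 ax; have [y yx fy] := positive_elsewhere f x.
have fx : 0 < f x by exact: lt_le_trans ax.
pose e : R := k.+1%:R^-1; have e0 : 0 < e by rewrite invr_gt0.
(* The alternative [a / 2] keeps [b] positive, so that [ln b] is meaningful. *)
pose b := Num.max (a - e) (a / 2).
have ba : b < a by rewrite gt_max; apply/andP; split; lra.
have b0 : 0 < b by rewrite lt_max divr_gt0// orbT.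
pose C := `|ln (f x) - ln (f y)| + 1.
have C0 : 0 < C by rewrite ltr_wpDl.
pose D := ln (f x) - ln b.
have D0 : 0 < D by rewrite subr_gt0 ltr_ln// (lt_le_trans ba).
have d0 : 0 < `|y - x| by rewrite normr_gt0 subr_eq0.
(* [D / C] limits the loss in [ln f], and the quotient by the distance of [x] and [y] keeps the
   point within [e] of [x]. *)
pose s0 := Num.min 1 (Num.min (D / C) (e / `|y - x|)).
have s00 : 0 < s0 by rewrite !lt_min ltr01 !divr_gt0.
have inside z : (exists2 s, 0 < s < s0 & z = x + s * (y - x)) -> `|z - x| < e /\ b < f z.
  move=> [s /andP[s1]]; rewrite !lt_min => /andP[s2 /andP[s3 s4]] ->.
  split.
    rewrite addrAC subrr add0r normrM (gtr0_norm s1).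
    by rewrite -ltr_pdivlMr.
  have t01 : 0 <= 1 - s <= 1 by apply/andP; split; lra.
  have [] := lc_ln_concave t01 fx fy.
  have -> : (1 - s) * x + (1 - (1 - s)) * y = x + s * (y - x) by ring.
  move=> fz h; rewrite -ltr_ln ?posrE//; apply: lt_le_trans h.
  have h1 : ln (f x) - ln (f y) < C by rewrite /C (le_lt_trans (ler_norm _))// ltrDl.
  have h2 : s * C < D by rewrite -ltr_pdivlMr.
  have h3 : s * (ln (f x) - ln (f y)) <= s * C by rewrite ler_wpM2l// ltW.
  by rewrite /D in h2; lra.
have [q [q1 q2]] : exists q : rat, `|ratr q - x| < e /\ b < f (ratr q).
  have s2 : 0 < s0 / 2 by rewrite divr_gt0.
  have [xy|yx'] := ltP x y.
    have : x < x + s0 / 2 * (y - x) by rewrite ltrDl mulr_gt0// subr_gt0.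
    move=> /rat_in_itvoo[q]; rewrite in_itv/= => /andP[q1 q2]; exists q; apply: inside.
    have yx0 : 0 < y - x by rewrite subr_gt0.
    exists ((ratr q - x) / (y - x)); last by field; rewrite gt_eqF.
    apply/andP; split; first by rewrite divr_gt0// subr_gt0.
    rewrite ltr_pdivrMr//.
    have : 0 < s0 / 2 * (y - x) by rewrite mulr_gt0.
    by lra.
  have yx0 : 0 < x - y by rewrite subr_gt0 lt_neqAle yx.
  have : x - s0 / 2 * (x - y) < x by rewrite gtrBl mulr_gt0.
  move=> /rat_in_itvoo[q]; rewrite in_itv/= => /andP[q1 q2]; exists q; apply: inside.
  exists ((x - ratr q) / (x - y)).
    apply/andP; split; first by rewrite divr_gt0// subr_gt0.
    rewrite ltr_pdivrMr//.
    have : 0 < s0 / 2 * (x - y) by rewrite mulr_gt0.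
    by lra.
  by field; rewrite gt_eqF.
exists q; split=> //; apply: le_lt_trans q2.
by rewrite /b le_max lexx.
Qed.

Let value_of_near f x a :
  (forall k, exists q : rat, `|ratr q - x| < k.+1%:R^-1 /\ a - k.+1%:R^-1 < f (ratr q)) ->
  a <= f x.
Proof.
move=> h; rewrite leNgt; apply/negP => fxa.
pose b := (f x + a) / 2.
have fb : ((- b)%:E < (- f x)%:E)%E by rewrite lte_fin /b; lra.
have [V nV hV] := @lc_usc _ f _ _ fb.
have [e /= e0 heV] := nV.
pose d := Num.min e (a - b).
have d0 : 0 < d by rewrite lt_min e0/= /b; lra.
pose k := Num.truncn d^-1.
have kd : k.+1%:R^-1 < d.
  by rewrite -[ltRHS]invrK ltf_pV2 ?posrE ?invr_gt0// truncnS_gt.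
have [q [q1 q2]] := h k.
have kd' := kd; rewrite lt_min in kd'; have /andP[ke kab] := kd'.
have : V (ratr q) by apply: heV; rewrite /ball/= distrC (lt_trans q1).
move=> /hV; rewrite lte_fin ltrN2 => h2; have := lt_trans q2 h2.
by rewrite ltrBlDr -ltrBlDl ltNge (ltW kab).
Qed.

Lemma measurable_lc_eval_at (x : R) : measurable_fun setT (fun f => f x).
Proof.
move=> _ B mB; rewrite setTI; apply: sub_sigma_algebra.
by exists x => //; exists B => //; rewrite setTI.
Qed.

(* Upper semi-continuity, and log-concavity for the converse, reduce [a <= f x]
   to values of [f] at rational points near [x]. *)
Lemma measurable_lc_eval :
  measurable_fun setT (fun p : R * lc_density R => p.2 p.1).
Proof.
move=> mD; apply: (measurability _ (RGenCInfty.measurableE R)) => // _ [_ [a ->] <-].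
rewrite setTI; have [a0|a0] := leP a 0.
  rewrite (_ : _ @^-1` _ = setT); first exact: measurableT.
  apply/seteqP; split => // -[x f] _ /=; rewrite in_itv/= andbT (le_trans a0)//.
  by have [_ ? _] := lc_is_density f.
rewrite [X in measurable X](_ : _ = \bigcap_(k in [set: nat]) \bigcup_(q in [set: rat])
   ([set x : R | `|ratr q - x| < k.+1%:R^-1] `*`
    [set f : lc_density R | a - k.+1%:R^-1 < f (ratr q)])).
  apply: bigcapT_measurable => k; apply: bigcupT_measurable_rat => q.
  apply: measurableX.
    rewrite -[X in measurable X]setTI.
    apply: (measurable_fun_ltr (g := fun=> k.+1%:R^-1)) => //.
    by apply: measurableT_comp => //; apply: measurable_funB.
  rewrite -[X in measurable X]setTI.
  apply: (measurable_fun_ltr (f := fun=> a - k.+1%:R^-1)) => //.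
  exact: measurable_lc_eval_at.
apply/seteqP; split => -[x f] /=.
  rewrite in_itv/= andbT => afx k _.
  by have [q [q1 q2]] := near_value k a0 afx; exists q.
move=> h; rewrite in_itv/= andbT; apply: value_of_near => k.
by have [q _ [/= q1 q2]] := h k Logic.I; exists q.
Qed.

End joint_measurability.

(** * Integration against the law of a density and against i.i.d. laws *)

Section integral_lc_law.
Variable R : realType.
Let mu := @lebesgue_measure R.
Variable f : lc_density R.
Local Open Scope ereal_scope.

Let mf : measurable_fun setT f. Proof. by case: (lc_is_density f). Qed.
Let f0 x : (0 <= f x)%R. Proof. by case: (lc_is_density f). Qed.

Import HBNNSimple.

Let integral_lc_law_nnsfun (g : {nnsfun R >-> R}) :
  \int[lc_law f]_x (g x)%:E = \int[mu]_x ((f x)%:E * (g x)%:E).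
Proof.
have mE r : measurable (g @^-1` [set r]) by exact: measurable_sfunP.
under [LHS]eq_integral do rewrite fimfunE -fsumEFin//.
rewrite [LHS]ge0_integral_fsum//; last 2 first.
- by move=> r; exact/measurable_EFinP/measurableT_comp.
- by move=> n x _; rewrite EFinM nnfun_muleindic_ge0.
under [RHS]eq_integral.
  move=> x xD; rewrite fimfunE -fsumEFin// ge0_mule_fsumr; last first.
    by move=> r; rewrite EFinM nnfun_muleindic_ge0.
  over.
rewrite [RHS]ge0_integral_fsum//; last 2 first.
- move=> r; apply: emeasurable_funM; first exact/measurable_EFinP.
  by apply/measurable_EFinP/measurable_funM; [exact: measurable_cst|apply: measurable_indic; exact: mE].
- move=> n x _; rewrite EFinM; apply: mule_ge0; first by rewrite lee_fin.
  exact: nnfun_muleindic_ge0.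
apply: eq_fsbigr => r _.
rewrite integralZl_indic_nnsfun//= integral_indic// setIT.
have [r0|r0] := leP 0%R r; last first.
  rewrite preimage_nnfun0// measure0 mule0; apply/esym/integral0_eq => x _.
  by rewrite indicE in_set0 mulr0 mule0.
have mI : measurable_fun setT (\1_(g @^-1` [set r]) : R -> R).
  by apply: measurable_indic; exact: mE.
transitivity (r%:E * \int[mu]_x (f x * \1_(g @^-1` [set r]) x)%:E).
  congr (_ * _); transitivity (\int[mu]_(x in g @^-1` [set r]) (f x)%:E) => //.
  by rewrite integral_mkcond; apply: eq_integral => x _; rewrite epatch_indic.
rewrite -ge0_integralZl_EFin//; last 2 first.
- by move=> x _; rewrite lee_fin mulr_ge0.
- by apply/measurable_EFinP/measurable_funM.
by apply: eq_integral => x _; rewrite -!EFinM mulrCA.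
Qed.

Lemma integral_lc_law (h : R -> \bar R) : measurable_fun setT h -> (forall x, 0 <= h x) ->
  \int[lc_law f]_x h x = \int[mu]_x ((f x)%:E * h x).
Proof.
move=> mh h0; pose g := nnsfun_approx measurableT mh.
transitivity (lim (\int[lc_law f]_x (g n x)%:E @[n --> \oo])).
  rewrite -monotone_convergence//=.
  - apply: eq_integral => ? /[!inE] xD; apply/esym/cvg_lim => //=.
    exact: cvg_nnsfun_approx.
  - by move=> n; exact/measurable_EFinP.
  - by move=> n ? _; rewrite lee_fin.
  - by move=> ? _ ? ? mn; rewrite lee_fin; exact/lefP/nd_nnsfun_approx.
transitivity (lim (\int[mu]_x ((f x)%:E * (g n x)%:E) @[n --> \oo])).
  by apply: congr_lim; apply/funext => n; exact: integral_lc_law_nnsfun.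
rewrite -monotone_convergence//=.
- apply: eq_integral => x _; apply/cvg_lim => //; apply: cvgeZl => //.
  exact: cvg_nnsfun_approx.
- move=> n; apply: emeasurable_funM; apply/measurable_EFinP; first exact: mf.
  exact: (measurable_funPT (g n)).
- by move=> n x _; apply: mule_ge0; rewrite lee_fin.
- move=> x _ a b ab; apply: lee_wpmul2l; first by rewrite lee_fin.
  by rewrite lee_fin; have /lefP/(_ x) := nd_nnsfun_approx measurableT mh ab.
Qed.

End integral_lc_law.

Section iid_product.
Context d (T : measurableType d) (R : realType) (P : probability T R).
Local Open Scope ereal_scope.

Lemma measurable_tuple_rect n (A : set T) : measurable A ->
  measurable [set x : n.-tuple T | forall i, A (tnth x i)].
Proof.
move=> mA; rewrite (_ : mkset _ = \bigcap_(i in [set: 'I_n]) ((@tnth _ T ^~ i) @^-1` A)).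
  apply: fin_bigcap_measurable => // i _.
  by rewrite -[X in measurable X]setTI; exact: measurable_tnth.
by apply/seteqP; split => x /= h i => [_|]; exact: h.
Qed.

Lemma measurable_tuple_prod n (h : T -> R) : measurable_fun setT h ->
  measurable_fun setT (fun x : n.-tuple T => \prod_(i < n) h (tnth x i))%R.
Proof.
move=> mh; apply: measurable_prod => i _; apply: measurableT_comp => //.
exact: measurable_tnth.
Qed.

(** By induction on [n]: the law of the tuple is the image of a product measure under [cons_pair],
    and Tonelli's theorem splits off the first coordinate. *)
Lemma integral_iid_prod n (h : T -> R) : measurable_fun setT h -> (forall x, 0 <= h x)%R ->
  \int[iid_law P n]_x (\prod_(i < n) h (tnth x i))%:E = (\int[P]_x (h x)%:E) ^+ n.
Proof.
move=> mh h0; elim: n => [|n ih].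
  rewrite /=; under eq_integral do rewrite big_ord0.
  by rewrite integral_cst// mul1e; exact: probability_setT.
have mp m := @measurable_tuple_prod m h mh.
rewrite expeS /= /cons_law ge0_integral_pushforward//; last 3 first.
- exact: measurable_cons_pair.
- by apply/measurable_EFinP; exact: mp.
- by move=> x _; rewrite lee_fin prodr_ge0.
rewrite preimage_setT.
pose G (p : T * n.-tuple T) := (h p.1 * \prod_(i < n) h (tnth p.2 i))%:E.
have mG : measurable_fun setT G.
  apply/measurable_EFinP/measurable_funM; first exact: measurableT_comp.
  exact: (measurableT_comp (mp n) measurable_snd).
have G0 p : 0 <= G p by rewrite lee_fin mulr_ge0// prodr_ge0.
transitivity (\int[P \x iid_law P n]_p G p).
  apply: eq_integral => p _; rewrite /= big_ord_recl tnth0; congr (_ * _)%:E.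
  by apply: eq_bigr => i _; rewrite tnthS.
rewrite (fubini_tonelli1 G mG G0) /fubini_F /G/=.
under eq_integral.
  move=> x _; under eq_integral do rewrite EFinM.
  rewrite ge0_integralZl_EFin//; last 2 first.
  - by move=> y _; rewrite lee_fin prodr_ge0.
  - by apply/measurable_EFinP; exact: mp.
  rewrite ih muleC.
  over.
rewrite /= ge0_integralZl//; last 3 first.
- exact/measurable_EFinP.
- by move=> x _; rewrite lee_fin.
- by rewrite expe_ge0// integral_ge0// => x _; rewrite lee_fin.
by rewrite muleC.
Qed.

End iid_product.

(** * Measurability of divergences, neighbourhoods and the posterior *)

Section log_ratio.
Variable R : realType.
Implicit Types a b : R.

Lemma log_ratioE a b : 0 <= a -> 0 <= b -> a != 0 ->
  lne (a%:E / b%:E)%E = if b == 0 then +oo%E else (ln (a / b))%:E.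
Proof.
move=> a0 b0 an; have agt0 : 0 < a by rewrite lt0r an.
case: eqVneq => [->|bn].
  by rewrite inve0 gt0_muley// lte_fin.
rewrite inver (negbTE bn) -EFinM /= leNgt divr_gt0//.
by rewrite lt0r bn.
Qed.

Lemma kl_integrandE a b : 0 <= a -> 0 <= b ->
  (a%:E * lne (a%:E / b%:E))%E =
    if a == 0 then 0%E else if b == 0 then +oo%E else (a * ln (a / b))%:E.
Proof.
move=> a0 b0; case: eqVneq => [->|an]; first by rewrite mul0e.
rewrite log_ratioE//; case: ifP => _ //.
by rewrite gt0_muley// lte_fin lt0r an.
Qed.

Lemma kl2_integrandE a b : 0 <= a -> 0 <= b ->
  (a%:E * lne (a%:E / b%:E) ^+ 2)%E =
    if a == 0 then 0%E else if b == 0 then +oo%E else (a * ln (a / b) ^+ 2)%:E.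
Proof.
move=> a0 b0; case: eqVneq => [->|an]; first by rewrite mul0e.
rewrite log_ratioE//; case: ifP => _ //.
by rewrite expe2 /= gt0_muley// lte_fin lt0r an.
Qed.

Lemma measurable_log_ratio d (T : measurableType d) (u v : T -> R) :
  measurable_fun setT u -> measurable_fun setT v ->
  measurable_fun setT (fun t => ln (u t / v t)).
Proof.
move=> mu mv; apply: (@measurableT_comp _ _ _ _ _ _ (@ln R)); first exact: measurable_ln.
by apply: measurable_funM => //; exact: measurable_funV.
Qed.

Let measurable_ifs d (T : measurableType d) (u v h : T -> R) :
  measurable_fun setT u -> measurable_fun setT v -> measurable_fun setT h ->
  measurable_fun setT (fun t =>
    if u t == 0 then 0%E else if v t == 0 then +oo%E else (h t)%:E).
Proof.
move=> mu mv mh; apply: measurable_fun_ifT.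
- by apply: measurable_fun_eqr => //; exact: measurable_cst.
- exact: measurable_cst.
apply: measurable_fun_ifT.
- by apply: measurable_fun_eqr => //; exact: measurable_cst.
- exact: measurable_cst.
- by apply/measurable_EFinP; exact: mh.
Qed.

Lemma measurable_kl_integrand d (T : measurableType d) (u v : T -> R) :
  (forall t, 0 <= u t) -> (forall t, 0 <= v t) ->
  measurable_fun setT u -> measurable_fun setT v ->
  measurable_fun setT (fun t => (u t)%:E * lne ((u t)%:E / (v t)%:E))%E.
Proof.
move=> u0 v0 mu mv; under eq_fun do rewrite kl_integrandE//.
apply: measurable_ifs => //; apply: measurable_funM => //.
exact: measurable_log_ratio.
Qed.

Lemma measurable_kl2_integrand d (T : measurableType d) (u v : T -> R) :
  (forall t, 0 <= u t) -> (forall t, 0 <= v t) ->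
  measurable_fun setT u -> measurable_fun setT v ->
  measurable_fun setT (fun t => (u t)%:E * lne ((u t)%:E / (v t)%:E) ^+ 2)%E.
Proof.
move=> u0 v0 mu mv; under eq_fun do rewrite kl2_integrandE//.
apply: measurable_ifs => //; apply: measurable_funM => //; apply: measurable_funX.
exact: measurable_log_ratio.
Qed.

End log_ratio.

Section prior_measurability.
Variable R : realType.
Variable f0 : lc_density R.
Let mu := @lebesgue_measure R.

Let p0 (f : lc_density R) x : 0 <= f x. Proof. by case: (lc_is_density f). Qed.
Let m0 (f : lc_density R) : measurable_fun setT f. Proof. by case: (lc_is_density f). Qed.

Let mf0 : measurable_fun setT (fun p : R * lc_density R => f0 p.1).
Proof. exact: (measurableT_comp (m0 f0) measurable_fst). Qed.

Let meval := @measurable_lc_eval R.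

(** The integrand may change sign; Tonelli's theorem applies to its positive and negative parts
    separately. *)
Let measurable_integral (F : R * lc_density R -> \bar R) : measurable_fun setT F ->
  measurable_fun setT (fun f : lc_density R => \int[mu]_x F (x, f))%E.
Proof.
move=> mF.
have -> : (fun f => \int[mu]_x F (x, f))%E =
    (fun f => fubini_G mu (F^\+)%E f - fubini_G mu (F^\-)%E f)%E.
  apply/funext => f; rewrite integralE /fubini_G.
  by congr (_ - _)%E; apply: eq_integral => x _; rewrite ?funeposE ?funenegE.
apply: emeasurable_funB; apply: measurable_fun_fubini_tonelli_G => //.
- exact: measurable_funepos.
- exact: measurable_funeneg.
Qed.

Let measurable_sqrt_dist_integral :
  measurable_fun setT (fun f : lc_density R => \int[mu]_x (sqrt_dist f f0 x)%:E)%E.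
Proof.
apply: (measurable_integral (F := fun p => (sqrt_dist p.2 f0 p.1)%:E)).
apply/measurable_EFinP; apply: measurable_funX; apply: measurable_funB.
- apply: (@measurableT_comp _ _ _ _ _ _ (@Num.sqrt R)) meval.
  by apply: continuous_measurable_fun => x; exact: sqrt_continuous.
- apply: (@measurableT_comp _ _ _ _ _ _ (@Num.sqrt R)) mf0.
  by apply: continuous_measurable_fun => x; exact: sqrt_continuous.
Qed.

Lemma measurable_hellinger_ge (c : R) :
  measurable [set f : lc_density R | c <= hellinger f f0].
Proof.
have mh : measurable_fun setT (fun f : lc_density R => hellinger f f0).
  apply: (@measurableT_comp _ _ _ _ _ _ (@Num.sqrt R)).
    by apply: continuous_measurable_fun => x; exact: sqrt_continuous.
  exact: (measurableT_comp (fine_measurable measurableT) measurable_sqrt_dist_integral).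
rewrite -[X in measurable X]setTI.
exact: (measurable_fun_ler (f := fun=> c) (measurable_cst _) mh measurableT).
Qed.

Lemma measurable_kl_neighbourhood (c c' : \bar R) :
  measurable [set f : lc_density R | (kl_div f0 f <= c /\ kl_div2 f0 f <= c')%E].
Proof.
have m1 : measurable_fun setT (fun f : lc_density R => kl_div f0 f).
  apply: (measurable_integral (F := fun p =>
    (f0 p.1)%:E * lne ((f0 p.1)%:E / (p.2 p.1)%:E))%E).
  exact: measurable_kl_integrand.
have m2 : measurable_fun setT (fun f : lc_density R => kl_div2 f0 f).
  apply: (measurable_integral (F := fun p =>
    (f0 p.1)%:E * lne ((f0 p.1)%:E / (p.2 p.1)%:E) ^+ 2)%E).
  exact: measurable_kl2_integrand.
change (measurable ([set f : lc_density R | kl_div f0 f <= c]%E `&` [set f : lc_density R | kl_div2 f0 f <= c']%E)).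
apply: measurableI; rewrite -[X in measurable X]setTI.
  exact: (emeasurable_fun_infty_c measurableT m1).
exact: (emeasurable_fun_infty_c measurableT m2).
Qed.

End prior_measurability.

Section likelihood_measurability.
Variables (R : realType) (n : nat).

Lemma measurable_likelihood :
  measurable_fun setT (fun p : n.-tuple R * lc_density R => likelihood p.1 p.2).
Proof.
apply: measurable_prod => i _.
apply: (measurableT_comp (@measurable_lc_eval R)
  (g := fun p : n.-tuple R * lc_density R => (tnth p.1 i, p.2))).
apply: measurable_fun_pair => //.
exact: (measurableT_comp (measurable_tnth i) measurable_fst).
Qed.

Lemma likelihood_ge0 (x : n.-tuple R) (f : lc_density R) : 0 <= likelihood x f.
Proof. by apply: prodr_ge0 => i _; case: (lc_is_density f). Qed.

Variable Pi : probability (lc_density R) R.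
Local Open Scope ereal_scope.

Lemma measurable_evidence (B : set (lc_density R)) : measurable B ->
  measurable_fun setT (fun x : n.-tuple R => \int[Pi]_(f in B) (likelihood x f)%:E).
Proof.
move=> mB; under eq_fun do rewrite integral_mkcond.
pose F (p : n.-tuple R * lc_density R) := (likelihood p.1 p.2 * \1_B p.2)%:E.
have mF : measurable_fun setT F.
  apply/measurable_EFinP/measurable_funM; first exact: measurable_likelihood.
  exact: (measurableT_comp (measurable_indic mB) measurable_snd).
have F0 p : 0 <= F p by rewrite lee_fin mulr_ge0// likelihood_ge0.
have -> : (fun x : n.-tuple R => \int[Pi]_f ((fun f => (likelihood x f)%:E) \_ B) f) =
    fubini_F Pi F.
  by apply/funext => x; apply: eq_integral => f _; rewrite epatch_indic.
exact: measurable_fun_fubini_tonelli_F.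
Qed.

(** Where the evidence is positive and finite, clearing the quotient turns the condition into
    [0 < N x - delta%:E * E x]; elsewhere the posterior is the constant [Pi B]. *)
Lemma measurable_posterior_gt (B : set (lc_density R)) (delta : R) : measurable B ->
  measurable [set x : n.-tuple R | delta%:E < posterior Pi x B].
Proof.
move=> mB; have mN := measurable_evidence mB; have mE := measurable_evidence measurableT.
pose N (x : n.-tuple R) := \int[Pi]_(f in B) (likelihood x f)%:E.
pose E (x : n.-tuple R) := \int[Pi]_f (likelihood x f)%:E.
have E0 x : 0 <= E x by apply: integral_ge0 => f _; rewrite lee_fin likelihood_ge0.
have -> : [set x | delta%:E < posterior Pi x B] =
    ([set x | E x <= 0] `|` [set x | +oo <= E x]) `&` [set x | delta%:E < Pi B] `|`
    ([set x | 0 < E x] `&` [set x | E x < +oo]) `&` [set x | 0 < N x - delta%:E * E x].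
  apply/seteqP; split => x /=; rewrite /posterior -/(E x) -/(N x).
    have := E0 x; case: (E x) => [e| |]//=.
    - rewrite lee_fin => e0; case: eqVneq => /= [[->]|en]; first by left; split=> //; left.
      have {}e0 : (0 < e)%R by rewrite lt0r e0 andbT; apply: contra_neq en => ->.
      move=> h; right; split; first by rewrite lte_fin e0 ltry.
      by move: h; rewrite inver gt_eqF// lte_pdivlMr// -sube_gt0.
    - by move=> _ ?; left; split=> //; right.
  move=> [[h hB]|[[h1 h2] h]].
    suff -> : (E x == 0) || (E x == +oo) by [].
    case: h => h; last by rewrite -leye_eq h orbT.
    by rewrite eq_le h E0.
  have -> : (E x == 0) = false by rewrite gt_eqF.
  have -> : (E x == +oo) = false by rewrite lt_eqF.
  move: h1 h2 h; case: (E x) => [e| |]//=; rewrite lte_fin => e0 _.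
  by rewrite inver gt_eqF// lte_pdivlMr// => h; rewrite -sube_gt0; exact: h.
have mset (c : bool) : measurable [set _ : n.-tuple R | c].
  case: c; first by rewrite (_ : [set _ | _] = setT) ?measurableT//; apply/seteqP; split.
  by rewrite (_ : [set _ | _] = set0) ?measurable0//; apply/seteqP; split.
apply: measurableU; apply: measurableI => //.
- apply: measurableU; rewrite -[X in measurable X]setTI.
    exact: (emeasurable_fun_infty_c measurableT mE).
  exact: (emeasurable_fun_c_infty measurableT mE).
- apply: measurableI; rewrite -[X in measurable X]setTI.
    exact: (emeasurable_fun_o_infty measurableT mE).
  exact: (emeasurable_fun_infty_o measurableT mE).
- have mD : measurable_fun setT (fun x => N x - delta%:E * E x).
    apply: emeasurable_funB => //; apply: emeasurable_funM => //; exact: measurable_cst.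
  by rewrite -[X in measurable X]setTI; exact: (emeasurable_fun_o_infty measurableT mD).
Qed.

End likelihood_measurability.

(** * Likelihood ratios in a Kullback-Leibler neighbourhood *)

Section markov.
Context d (T : measurableType d) (R : realType) (P : probability T R).
Local Open Scope ereal_scope.

Lemma markov_mul (h : T -> \bar R) (t : R) : measurable_fun setT h ->
  (forall x, 0 <= h x) -> (0 <= t)%R ->
  t%:E * P [set x | t%:E <= h x] <= \int[P]_x h x.
Proof.
move=> mh h0 t0; set A := [set x | _].
have mA : measurable A.
  by rewrite -[X in measurable X]setTI; exact: (emeasurable_fun_c_infty measurableT mh).
apply: (@le_trans _ _ (\int[P]_(x in A) h x)); last first.
  by apply: ge0_subset_integral => //; exact: measurable_funTS.
rewrite -integral_cst//.
by apply: ge0_le_integral => //; exact: measurable_funTS.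
Qed.

Lemma markov_le (h : T -> \bar R) (t a : R) : measurable_fun setT h ->
  (forall x, 0 <= h x) -> (0 < t)%R -> \int[P]_x h x <= a%:E ->
  P [set x | t%:E <= h x] <= (a / t)%:E.
Proof.
move=> mh h0 t0 ha; rewrite EFinM lee_pdivlMr//; apply: le_trans ha.
by rewrite muleC markov_mul// ltW.
Qed.

End markov.

Section truncated_chernoff.
Variable R : realType.
Let mu := @lebesgue_measure R.

(** Both sides are compared with [(1 - z)^-1]. No lower bound on [z] is required, so log-ratios need
    truncation from above only. *)
Lemma expR_le_quadratic (z : R) : z <= 2^-1 -> expR z <= 1 + z + 2 * z ^+ 2.
Proof.
move=> z1; have h : 0 < 1 - z by lra.
have hl : 1 - z <= expR (- z) by have := expR_ge1Dx (- z).
rewrite -[expR z]invrK -expRN.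
apply: (@le_trans _ _ (1 - z)^-1); first by rewrite lef_pV2// posrE// expR_gt0.
rewrite -[leLHS]mul1r ler_pdivrMr//.
have : 0 <= z ^+ 2 * (1 - 2 * z) by rewrite mulr_ge0 ?sqr_ge0//; lra.
by rewrite [X in _ -> _ <= X](_ : _ = 1 + z ^+ 2 * (1 - 2 * z)) ?lerDl//; ring.
Qed.

Lemma bernoulli_le (p : R) n : 0 <= p <= 1 -> 1 - p ^+ n <= n%:R * (1 - p).
Proof.
move=> /andP[p0 p1]; elim: n => [|n ih]; first by rewrite expr0 subrr mul0r.
have hq : 0 <= p ^+ n <= 1 by rewrite exprn_ge0//= exprn_ile1.
rewrite exprS -natr1 mulrDl mul1r.
by move: (p ^+ n) (n%:R * (1 - p)) hq ih => w v /andP[w0 w1] ih; nra.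
Qed.

(* Without the truncation at [expR t] the exponential moment could be infinite. *)
Definition tilted_ratio (t s : R) (f0 f : R -> R) (y : R) : R :=
  if (0 < f0 y) && (f0 y <= f y * expR t) then expR (s * ln (f0 y / f y)) else 0.

Lemma tilted_ratio_ge0 t s f0 f y : 0 <= tilted_ratio t s f0 f y.
Proof. by rewrite /tilted_ratio; case: ifP => // _; exact: expR_ge0. Qed.

Lemma measurable_tilted_ratio t s f0 f : measurable_fun setT f0 -> measurable_fun setT f ->
  measurable_fun setT (tilted_ratio t s f0 f).
Proof.
move=> m0 m; apply: measurable_fun_ifT.
- apply: measurable_and.
    by apply: measurable_fun_ltr => //; exact: measurable_cst.
  by apply: measurable_fun_ler => //; apply: measurable_funM => //; exact: measurable_cst.
- apply: (@measurableT_comp _ _ _ _ _ _ (@expR R)); first exact: measurable_expR.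
  apply: measurable_funM; first exact: measurable_cst.
  exact: measurable_log_ratio.
- exact: measurable_cst.
Qed.

(** This is [expR_le_quadratic] multiplied by [a]. The positive and negative parts of [k] stand on
    opposite sides, so that all terms are nonnegative and can be integrated one by one, even where
    [k] is infinite. *)
Lemma tilted_ratio_pointwise (t s a b : R) (u := tilted_ratio t s (fun=> a) (fun=> b) 0) :
  0 <= a -> 0 <= b -> 0 < s -> s * t <= 2^-1 -> 0 <= t ->
  let k := (a%:E * lne (a%:E / b%:E))%E in
  ((a * u)%:E + s%:E * maxe (- k) 0 <=
   a%:E + (s%:E * maxe k 0 + (2 * s ^+ 2)%:E * (a%:E * lne (a%:E / b%:E) ^+ 2)))%E.
Proof.
move=> a0 b0 s0 st t0; rewrite kl2_integrandE// /= kl_integrandE//.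
rewrite /u /tilted_ratio; case: eqVneq => [->|an].
  by rewrite ltxx /= !mul0r oppr0 maxxx !mule0 !adde0.
have {an}ap : 0 < a by rewrite lt0r an.
rewrite ap /=; case: eqVneq => [->|bn].
  have -> : (a <= 0 * expR t) = false by rewrite mul0r leNgt ap.
  have -> : (maxe (- +oo) 0 = 0 :> \bar R)%E by rewrite max_r// leNye.
  have -> : (maxe +oo 0 = +oo :> \bar R)%E by rewrite max_l// leey.
  rewrite gt0_muley ?lte_fin// gt0_muley ?lte_fin ?mulr_gt0 ?exprn_gt0//.
  by rewrite /= leey.
have {bn}bp : 0 < b by rewrite lt0r bn.
set L := ln (a / b).
have -> : (maxe (- (a * L)%:E) 0 = (Num.max (- (a * L)) 0)%:E)%E by rewrite EFin_max.
have -> : (maxe ((a * L)%:E) 0 = (Num.max (a * L) 0)%:E)%E by rewrite EFin_max.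
rewrite -!EFinM -!EFinD lee_fin.
have aL : Num.max (a * L) 0 = a * L + Num.max (- (a * L)) 0.
  by have [h|h] := leP 0 (a * L); [rewrite [RHS]addrC max_r ?add0r ?oppr_le0|rewrite max_l ?subrr ?oppr_ge0 ?ltW].
rewrite aL mulrDr; case: ifP => h.
  have Lt : L <= t.
    rewrite -[leRHS]expRK ler_ln ?posrE ?divr_gt0 ?expR_gt0//.
    by rewrite ler_pdivrMr// mulrC.
  have sL : s * L <= 2^-1 by apply: le_trans st; rewrite ler_wpM2l// ltW.
  have := ler_wpM2l a0 (expR_le_quadratic sL).
  rewrite exprMn; move: (expR _) (Num.max _ _) => e w.
  by move: (L ^+ 2) (s ^+ 2) => L2 s2; nra.
(* Beyond the truncation [u] vanishes, and [L >= t >= 0] leaves [k] without a negative part, so the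
   left side is 0. *)
have Lt : 0 <= L.
  apply: le_trans t0 _; rewrite -[leLHS]expRK ler_ln ?posrE ?divr_gt0 ?expR_gt0//.
  by rewrite ler_pdivlMr// mulrC; move: h => /negbT; rewrite -ltNge => /ltW.
have l0 : 0 <= a * L by rewrite mulr_ge0.
rewrite mulr0 add0r max_r ?oppr_le0// mulr0 addr0.
by rewrite addr_ge0// addr_ge0// !mulr_ge0// ?ltW// ?sqr_ge0// ltW.
Qed.

End truncated_chernoff.

Section evidence.
Variables (R : realType) (f0 f : lc_density R).
Let mu := @lebesgue_measure R.

Let p0 x : 0 <= f0 x. Proof. by case: (lc_is_density f0). Qed.
Let p x : 0 <= f x. Proof. by case: (lc_is_density f). Qed.
Let m0 : measurable_fun setT f0. Proof. by case: (lc_is_density f0). Qed.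
Let m : measurable_fun setT f. Proof. by case: (lc_is_density f). Qed.

Let k1 x := ((f0 x)%:E * lne ((f0 x)%:E / (f x)%:E))%E.
Let k2 x := ((f0 x)%:E * lne ((f0 x)%:E / (f x)%:E) ^+ 2)%E.

Let mk1 : measurable_fun setT k1.
Proof. exact: measurable_kl_integrand. Qed.

Let mk2 : measurable_fun setT k2.
Proof. exact: measurable_kl2_integrand. Qed.

Let k2_ge0 x : (0 <= k2 x)%E.
Proof.
rewrite /k2 kl2_integrandE//; case: ifP => // _; case: ifP => // _.
by rewrite lee_fin mulr_ge0// sqr_ge0.
Qed.

(** As [ln z < z], the negative part of the Kullback-Leibler integrand is dominated by [f]. Its
    integral is therefore finite and can be cancelled in [integral_tilted_ratio]. *)
Let k1_neg x : ((k1^\-)%E x <= (f x)%:E)%E.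
Proof.
rewrite funenegE /k1 kl_integrandE//; case: eqVneq => [|an].
  by rewrite oppe0 maxxx lee_fin.
case: eqVneq => [|bn]; first by rewrite max_r ?lee_fin// leNye.
rewrite ge_max; apply/andP; split; rewrite lee_fin//.
have f00 : 0 < f0 x by rewrite lt0r an p0.
have fx : 0 < f x by rewrite lt0r bn p.
have := ln_sublinear (divr_gt0 fx f00); rewrite !lnM ?posrE ?invr_gt0// !lnV ?posrE//.
rewrite ltr_pdivlMr// => h; nra.
Qed.

Let k1_neg_fin : (\int[mu]_x (k1^\-)%E x)%E \is a fin_num.
Proof.
rewrite ge0_fin_numE; last by apply: integral_ge0.
apply: (@le_lt_trans _ _ (\int[mu]_x (f x)%:E)%E).
  apply: ge0_le_integral => //.
  - exact: measurable_funeneg.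
  - by apply/measurable_EFinP; exact: m.
by have [_ _ ->] := lc_is_density f; rewrite ltry.
Qed.

Lemma integral_tilted_ratio (t s v : R) : 0 < s -> s * t <= 2^-1 -> 0 <= t ->
  (kl_div f0 f <= v%:E)%E -> (kl_div2 f0 f <= v%:E)%E ->
  (\int[lc_law f0]_x (tilted_ratio t s f0 f x)%:E <= (1 + s * v + 2 * s ^+ 2 * v)%:E)%E.
Proof.
move=> s0 st t0 h1 h2.
pose u := tilted_ratio t s f0 f.
have u0 x : 0 <= u x by exact: tilted_ratio_ge0.
have mu' : measurable_fun setT u by exact: measurable_tilted_ratio.
have mE : measurable_fun setT (fun x => (u x)%:E) by apply/measurable_EFinP; exact: mu'.
have uE x : (0 <= (u x)%:E)%E by rewrite lee_fin.
rewrite (integral_lc_law f0 mE uE).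
have mkn := measurable_funeneg mk1; have mkp := measurable_funepos mk1.
have s0' : (0 <= s%:E)%E by rewrite lee_fin ltW.
have ss0 : (0 <= (2 * s ^+ 2)%:E)%E by rewrite lee_fin mulr_ge0// sqr_ge0.
have mlu : measurable_fun setT (fun x => (f0 x * u x)%:E).
  by apply/measurable_EFinP; apply: measurable_funM.
have mf0 : measurable_fun setT (fun x => (f0 x)%:E) by apply/measurable_EFinP; exact: m0.
have mskn : measurable_fun setT (fun x => s%:E * (k1^\-)%E x)%E.
  by apply: emeasurable_funM => //; exact: measurable_cst.
have mskp : measurable_fun setT (fun x => s%:E * (k1^\+)%E x)%E.
  by apply: emeasurable_funM => //; exact: measurable_cst.
have msk2 : measurable_fun setT (fun x => (2 * s ^+ 2)%:E * k2 x)%E.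
  by apply: emeasurable_funM => //; exact: measurable_cst.
have lu0 x : (0 <= (f0 x * u x)%:E)%E by rewrite lee_fin mulr_ge0.
have f0E x : (0 <= (f0 x)%:E)%E by rewrite lee_fin.
have skn0 x : (0 <= s%:E * (k1^\-)%E x)%E by apply: mule_ge0.
have skp0 x : (0 <= s%:E * (k1^\+)%E x)%E by apply: mule_ge0.
have sk20 x : (0 <= (2 * s ^+ 2)%:E * k2 x)%E by apply: mule_ge0.
have : (\int[mu]_x ((f0 x * u x)%:E + s%:E * (k1^\-)%E x) <=
  \int[mu]_x ((f0 x)%:E + (s%:E * (k1^\+)%E x + (2 * s ^+ 2)%:E * k2 x)))%E.
  apply: ge0_le_integral => //.
  - by move=> x _; rewrite adde_ge0.
  - exact: emeasurable_funD.
  - by apply: emeasurable_funD => //; exact: emeasurable_funD.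
  move=> x _; rewrite funenegE funeposE.
  exact: (tilted_ratio_pointwise (p0 x) (p x) s0 st t0).
rewrite [leLHS]ge0_integralD// [leRHS]ge0_integralD//; last 2 first.
- by move=> x _; rewrite adde_ge0.
- exact: emeasurable_funD.
rewrite [(\int[mu]_x (_ + (2 * s ^+ 2)%:E * _))%E]ge0_integralD//.
rewrite !ge0_integralZl_EFin//.
have [_ _ ->] := lc_is_density f0.
under [in X in _ -> X]eq_integral do rewrite -EFinM.
rewrite -/mu -/u.
have U0 : (0 <= \int[mu]_x (f0 x * u x)%:E)%E by exact: integral_ge0.
have K0 : (0 <= \int[mu]_x k2 x)%E by exact: integral_ge0.
have P0 : (0 <= \int[mu]_x (k1^\+)%E x)%E by exact: integral_ge0.
have {}h1 : (\int[mu]_x (k1^\+)%E x - \int[mu]_x (k1^\-)%E x <= v%:E)%E.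
  by rewrite -integralE.
have {}h2 : (\int[mu]_x k2 x <= v%:E)%E by [].
move: h1 h2.
move: U0 K0 P0 k1_neg_fin.
move: (\int[mu]_x (f0 x * u x)%:E)%E (\int[mu]_x k2 x)%E => U K.
move: (\int[mu]_x (k1^\+)%E x)%E (\int[mu]_x (k1^\-)%E x)%E => KP KN.
case: KN => [kn| |]//; case: KP => [kp| |]//; case: K => [k| |]//.
  case: U => [w| |] //; rewrite -?EFinM -?EFinB -?EFinD !lee_fin => w0 k0 kp0 _ h1 h2 h.
  have := ler_wpM2l (ltW s0) h1.
  have : 2 * s ^+ 2 * k <= 2 * s ^+ 2 * v by rewrite ler_wpM2l// mulr_ge0// sqr_ge0.
  by move: h; move: (2 * s ^+ 2 * k) (2 * s ^+ 2 * v) => A B; lra.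
Qed.

(** Chebyshev's inequality for the log-ratio: on the complement it is at least [t], unless [f]
    vanishes and the second-moment integrand is +oo. *)
Lemma kl_tail (t v : R) : 0 < t -> (kl_div2 f0 f <= v%:E)%E ->
  (lc_law f0 (~` [set y | (f0 y <= f y * expR t)%R]) <= (v / t ^+ 2)%:E)%E.
Proof.
move=> t0 h2; set A := [set y | _].
have mA : measurable A.
  rewrite -[X in measurable X]setTI.
  by apply: measurable_fun_ler => //; apply: measurable_funM => //; exact: measurable_cst.
rewrite EFinM lee_pdivlMr ?exprn_gt0//; apply: le_trans h2.
rewrite /lc_law muleC -ge0_integralZl_EFin ?sqr_ge0//; last 3 first.
- exact: measurableC.
- by move=> x _; rewrite lee_fin.
- by apply/measurable_EFinP; apply: measurable_funTS; exact: m0.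
apply: (@le_trans _ _ (\int[mu]_(x in ~` A) k2 x)%E); last first.
  by apply: ge0_subset_integral => //; exact: measurableC.
apply: ge0_le_integral => //.
- exact: measurableC.
- by move=> x _; rewrite -EFinM lee_fin mulr_ge0// sqr_ge0.
- apply/measurable_EFinP; apply: measurable_funM; first exact: measurable_cst.
  by apply: measurable_funTS; exact: m0.
- exact: measurable_funTS.
move=> x; rewrite /A /= => /negP; rewrite -ltNge => hx.
rewrite /k2 kl2_integrandE//.
have f00 : 0 < f0 x by apply: le_lt_trans hx; rewrite mulr_ge0// expR_ge0.
rewrite (gt_eqF f00); case: eqVneq => [|bn]; first by rewrite leey.
have fx : 0 < f x by rewrite lt0r bn p.
rewrite -EFinM lee_fin mulrC ler_wpM2l//.
have h : t <= ln (f0 x / f x).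
  by rewrite -[leLHS]expRK ler_ln ?posrE ?expR_gt0 ?divr_gt0// ler_pdivlMr// mulrC ltW.
by rewrite lerXn2r// ?nnegrE ltW// (lt_le_trans t0).
Qed.

Lemma measurable_likelihood_at n :
  measurable_fun setT (fun x : n.-tuple R => likelihood x f).
Proof. exact: measurable_tuple_prod. Qed.

End evidence.

Section evidence_bound.
Variables (R : realType) (f0 f : lc_density R).

Let p0 x : 0 <= f0 x. Proof. by case: (lc_is_density f0). Qed.
Let p x : 0 <= f x. Proof. by case: (lc_is_density f). Qed.
Let m0 : measurable_fun setT f0. Proof. by case: (lc_is_density f0). Qed.
Let m : measurable_fun setT f. Proof. by case: (lc_is_density f). Qed.

(* The likelihood ratios are truncated at [exp (r ^ 3)] and Chernoff's bound is
   used with the exponent [1 / (2 r ^ 3)]. *)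
Lemma likelihood_ratio_tail n (v r : R) : 0 < r -> n%:R * v = r ^+ 4 -> 0 <= v ->
  (kl_div f0 f <= v%:E)%E -> (kl_div2 f0 f <= v%:E)%E ->
  (iid_law (lc_law f0) n
     [set x | (likelihood x f < expR (- (2 * r ^+ 4)) * likelihood x f0)%R] <=
   (r ^- 2 + expR (- (r / 2) + r ^- 2 / 2))%:E)%E.
Proof.
move=> r0 nv v0 h1 h2.
pose t := r ^+ 3; pose s := (2 * r ^+ 3)^-1.
have t0 : 0 < t by rewrite exprn_gt0.
have s0 : 0 < s by rewrite invr_gt0 mulr_gt0.
have rn : r != 0 by rewrite gt_eqF.
have st : s * t <= 2^-1 by rewrite /s /t invfM mulfVK// expf_neq0.
pose A := [set y | f0 y <= f y * expR t].
have mA : measurable A.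
  rewrite -[X in measurable X]setTI.
  by apply: measurable_fun_ler => //; apply: measurable_funM => //; exact: measurable_cst.
pose u := tilted_ratio t s f0 f.
have u0 x : 0 <= u x by exact: tilted_ratio_ge0.
have mu' : measurable_fun setT u by exact: measurable_tilted_ratio.
pose S := [set x : n.-tuple R | forall i, A (tnth x i)].
pose E := [set x : n.-tuple R | ((expR r)%:E <= (\prod_(i < n) u (tnth x i))%:E)%E].
have mS : measurable S by exact: measurable_tuple_rect.
have mP : measurable_fun setT (fun x : n.-tuple R => (\prod_(i < n) u (tnth x i))%:E).
  by apply/measurable_EFinP; exact: measurable_tuple_prod.
have mE : measurable E.
  by rewrite -[X in measurable X]setTI; exact: (emeasurable_fun_c_infty measurableT mP).
(* For a sample without tail observations the event forces the sum of [s * ln (f0 / f)] above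
   [s * 2 r ^ 4 = r]. *)
have sub : [set x : n.-tuple R | likelihood x f < expR (- (2 * r ^+ 4)) * likelihood x f0]
    `<=` ~` S `|` E.
  move=> x /= hx; have [xS|] := pselect (S x); last by left.
  right; rewrite /E /= lee_fin.
  have l0 : 0 < likelihood x f0.
    rewrite -(pmulr_rgt0 _ (expR_gt0 (- (2 * r ^+ 4)))).
    exact: le_lt_trans (likelihood_ge0 x f) hx.
  have f00 i : 0 < f0 (tnth x i).
    rewrite lt0r p0 andbT; apply: contraTneq l0 => fi.
    by rewrite /likelihood (bigD1 i)//= fi mul0r ltxx.
  have fp i : 0 < f (tnth x i).
    by rewrite -(pmulr_lgt0 _ (expR_gt0 t)); exact: lt_le_trans (f00 i) (xS i).
  have uE i : u (tnth x i) = expR (s * (ln (f0 (tnth x i)) - ln (f (tnth x i)))).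
    rewrite /u /tilted_ratio f00 (xS i : _ <= _) /=.
    by rewrite ln_div ?posrE.
  under eq_bigr do rewrite uE.
  rewrite -expR_sum ler_expR -mulr_sumr.
  have lnlik (g : lc_density R) : (forall i, 0 < g (tnth x i)) ->
      ln (likelihood x g) = \sum_(i < n) ln (g (tnth x i)).
    move=> gp; rewrite /likelihood -[RHS]expRK expR_sum; congr ln.
    by apply: eq_bigr => i _; rewrite lnK// posrE.
  rewrite sumrB -!lnlik//.
  have lf : 0 < likelihood x f by apply: prodr_gt0 => i _.
  move: hx; rewrite -ltr_ln ?posrE ?mulr_gt0 ?expR_gt0// lnM ?posrE ?expR_gt0// expRK => hx.
  have -> : r = s * (2 * r ^+ 4) by rewrite /s; field.
  by rewrite ler_wpM2l ?ltW//; lra.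
pose L : set (n.-tuple R) :=
  [set x : n.-tuple R | likelihood x f < expR (- (2 * r ^+ 4)) * likelihood x f0].
have mL : measurable L.
  rewrite -[X in measurable X]setTI.
  apply: measurable_fun_ltr => //; first exact: measurable_likelihood_at.
  by apply: measurable_funM; [exact: measurable_cst|exact: measurable_likelihood_at].
have mSC : measurable (~` S) by exact: measurableC.
have mSE : measurable (~` S `|` E) by exact: measurableU.
apply: le_trans (le_measure (iid_law (lc_law f0) n) (mem_set mL) (mem_set mSE) sub) _.
apply: le_trans (measureU2 (iid_law (lc_law f0) n) mSC mE) _.
rewrite EFinD; apply: leeD.
  have eC : iid_law (lc_law f0) n (~` S) = (1 - \prod_(i < n) lc_law f0 A)%E.
    by rewrite -(iid_law_rect (lc_law f0) (fun=> mA)); exact: probability_setC.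
  have leC : (iid_law (lc_law f0) n (~` S) <= 1 - \prod_(i < n) lc_law f0 A)%E.
    by rewrite eC.
  apply: le_trans leC _.
  have := kl_tail t0 h2; rewrite -/A lc_law_setC//.
  have := lc_law_le1 f0 mA; have := lc_law_ge0 f0 A.
  case: (lc_law f0 A) => [q| |]// q0 q1.
  rewrite -EFinB !lee_fin in q0 q1 * => h.
  rewrite prodEFin -EFinB lee_fin prodr_const card_ord.
  apply: le_trans (bernoulli_le _ _) _; first by rewrite q0.
  (* [n v / t ^ 2 = r ^ 4 / r ^ 6]. *)
  apply: (@le_trans _ _ (n%:R * (v / t ^+ 2))); first by rewrite ler_wpM2l.
  by rewrite mulrA nv /t le_eqVlt; apply/orP; left; apply/eqP; field.
apply: (le_trans (markov_le (a := expR (r / 2 + r ^- 2 / 2)) mP _ _ _)).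
- by move=> x; rewrite lee_fin prodr_ge0.
- exact: expR_gt0.
- rewrite integral_iid_prod//.
  have := integral_tilted_ratio s0 st (ltW t0) h1 h2; rewrite -/u.
  have : (0 <= \int[lc_law f0]_x (u x)%:E)%E by apply: integral_ge0 => x _; rewrite lee_fin.
  case: (\int[lc_law f0]_x _)%E => [w| |]//; rewrite !lee_fin -EFin_expe lee_fin => w0 hw.
  apply: (@le_trans _ _ (expR (s * v + 2 * s ^+ 2 * v) ^+ n)).
    rewrite lerXn2r ?nnegrE ?expR_ge0//; apply: le_trans hw _.
    by rewrite -addrA expR_ge1Dx.
  (* The exponent is [n v s + 2 n v s ^ 2] with [n v = r ^ 4], that is [r / 2 + r ^- 2 / 2]. *)
  rewrite -expRM_natl ler_expR le_eqVlt; apply/orP; left; apply/eqP.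
  have -> : n%:R * (s * v + 2 * s ^+ 2 * v) = (n%:R * v) * (s + 2 * s ^+ 2) by ring.
  by rewrite nv /s; field.
- rewrite lee_fin -expRN -expRD ler_expR.
  by rewrite le_eqVlt; apply/orP; left; apply/eqP; field.
Qed.

End evidence_bound.

(** * Tests against the complement of a Hellinger ball *)

Section hellinger_tests.
Variable R : realType.
Let mu := @lebesgue_measure R.

Lemma expe_le_fin (X : \bar R) (c : R) n : (0 <= X)%E -> (X <= c%:E)%E ->
  (X ^+ n <= (c ^+ n)%:E)%E.
Proof.
case: X => [x| |]//; rewrite !lee_fin => x0 xc.
by rewrite -EFin_expe lee_fin lerXn2r// nnegrE// (le_trans x0).
Qed.

Lemma hellinger_ge (f g : R -> R) (h : R) : 0 < h -> h <= hellinger f g ->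
  ((h ^+ 2)%:E <= \int[mu]_x (sqrt_dist f g x)%:E)%E.
Proof.
have -> : hellinger f g = Num.sqrt (fine (\int[mu]_x (sqrt_dist f g x)%:E)%E) by [].
move=> h0.
have : (0 <= \int[mu]_x (sqrt_dist f g x)%:E)%E.
  by apply: integral_ge0 => x _; rewrite lee_fin sqr_ge0.
case: (\int[mu]_x _)%E => [i| |]//; last by move=> _ _; exact: leey.
rewrite !lee_fin /= => i0 hi.
by rewrite -[leRHS]sqr_sqrtr// lerXn2r// ?nnegrE ?sqrtr_ge0// ltW.
Qed.

Let sum_le_cst (k : nat) (X : 'I_k -> \bar R) (c : R) :
  (forall j, X j <= c%:E)%E -> (\sum_(j < k) X j <= (k%:R * c)%:E)%E.
Proof.
move=> h; apply: (@le_trans _ _ (\sum_(j < k) c%:E)%E); first exact: lee_sum.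
by rewrite sumEFin sumr_const card_ord mulr_natl.
Qed.

(** Test [j] will reject when the product of [g j] over the sample reaches 1. The [n]-th powers are
    the moments for Markov's inequality, of the product under [f0] and of its inverse under [f].
    Indices below [N] hold the indicator tests, the others one Birge ratio per code. *)
Lemma hellinger_tests (f0 : lc_density R) : exists2 D : R, 0 <= D & exists N : nat,
  forall (h : R) (n : nat), 0 < h <= 1 -> exists (k : nat) (g : nat -> R -> R),
  [/\ forall j, measurable_fun setT (g j), forall j x, 0 < g j x,
      (\sum_(j < k) (\int[mu]_x (f0 x * g j x)%:E) ^+ n <=
        (N%:R * (175 / 176) ^+ n +
         expR (D * Num.sqrt (11 / h)) * (1 - h ^+ 2 / 6) ^+ n)%:E)%E &
      forall f : lc_density R, h <= hellinger f f0 -> exists2 j, (j < k)%N &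
        ((\int[mu]_x (f x / g j x)%:E) ^+ n <=
          ((175 / 176) ^+ n + (1 - h ^+ 2 / 16) ^+ n)%:E)%E].
Proof.
have [T [L [N [A [[T1 L1] mA A0 A1]]]]] := far_tests f0.
have [D D0 hD] := bounded_class_entropy T1 L1.
exists D => //; exists N => h n /andP[h0 h1].
(* [w ^- 4 = h ^ 2 / 121] is below the radius [h ^ 2 / 112] of [birge_alt] *)
pose w := Num.sqrt (11 / h).
have h11 : 1 <= 11 / h by rewrite ler_pdivlMr//; lra.
have h110 : 0 <= 11 / h by lra.
have w1 : 1 <= w by rewrite -sqrtr1 ler_sqrt//; lra.
have w4 : (w ^+ 4)^-1 = h ^+ 2 / 121.
  rewrite -[4%N]/(2 * 2)%N exprM sqr_sqrtr//.
  by field; rewrite gt_eqF.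
have hsq0 : 0 < h ^+ 2 by rewrite exprn_gt0.
have hsq1 : h ^+ 2 <= 1 by rewrite exprn_ile1// ltW.
pose S := [set f : lc_density R | bounded_class T L f /\ h <= hellinger f f0].
have [K [c [Kw cK cE]]] : entropy_le S (fun f g : lc_density R =>
    (\int[mu]_x (sqrt_dist f g x)%:E <= ((w ^+ 4)^-1)%:E)%E) (D * w).
  by apply: entropy_le_preimage (hD w w1) => f [].
have /choice[gB hgB] : forall i : nat, exists g : R -> R,
  [/\ measurable_fun setT g, forall x, 0 < g x,
      (\int[mu]_x (f0 x * g x)%:E <= (1 - h ^+ 2 / 6)%:E)%E &
      forall f, S f -> c f = i ->
        (\int[mu]_x (f x / g x)%:E <= (1 - h ^+ 2 / 16)%:E)%E].
  move=> i; have [[f1 [Sf1 cf1]]|ni] := pselect (exists f, S f /\ c f = i).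
    exists (birge_ratio f0 f1).
    have d0 := lc_is_density f0; have d1 := lc_is_density f1.
    have hf1 : ((h ^+ 2)%:E <= \int[mu]_x (sqrt_dist f1 f0 x)%:E)%E.
      by apply: hellinger_ge => //; case: Sf1.
    split.
    - by apply: measurable_birge_ratio; [case: d0|case: d1].
    - by move=> x; exact: birge_ratio_gt0.
    - exact: birge_null.
    - move=> f Sf cf; apply: birge_alt => //; first exact: lc_is_density.
      apply: le_trans (cE f f1 Sf Sf1 _) _; first by rewrite cf cf1.
      by rewrite w4 lee_fin ler_pM2l// lef_pV2// ?posrE; lra.
  (* A code without members still needs a ratio; this constant meets the null bound and has no
     alternative to serve. *)
  have k0 : 0 < 1 - h ^+ 2 / 6 by lra.
  have k0' := ltW k0.
  have [m0 p0 i0] := lc_is_density f0.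
  exists (fun=> 1 - h ^+ 2 / 6); split.
  - exact: measurable_cst.
  - by [].
  - under eq_integral do rewrite mulrC EFinM.
    rewrite ge0_integralZl_EFin//; last 2 first.
    + by move=> x _; rewrite lee_fin.
    + by apply/measurable_EFinP; exact: m0.
    by rewrite i0 mule1.
  - by move=> f Sf cf; exfalso; apply: ni; exists f.
exists (N + K)%N, (fun j => if (j < N)%N then indicator_ratio (A j) else gB (j - N)%N).
have q0 : 0 <= 175 / 176 :> R by rewrite divr_ge0.
have q1 : 0 <= 1 - h ^+ 2 / 16 by lra.
split.
- move=> j; case: ifPn => _; first exact: measurable_indicator_ratio.
  by case: (hgB (j - N)%N).
- move=> j x; case: ifPn => _; first exact: indicator_ratio_gt0.
  by case: (hgB (j - N)%N).
- have pos g : (forall x, 0 < g x) -> (0 <= \int[mu]_x (f0 x * g x)%:E)%E.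
    move=> g0; apply: integral_ge0 => x _; rewrite lee_fin.
    by apply: mulr_ge0; [case: (lc_is_density f0)|exact: ltW].
  rewrite big_split_ord EFinD /=; apply: leeD.
    apply: sum_le_cst => j; rewrite ltn_ord; apply: expe_le_fin.
      by apply: pos => x; exact: indicator_ratio_gt0.
    exact: indicator_null.
  apply: (@le_trans _ _ (K%:R * (1 - h ^+ 2 / 6) ^+ n)%:E).
    apply: sum_le_cst => j; rewrite ltnNge leq_addr /= addKn.
    by case: (hgB j) => _ g0 gn _; apply: expe_le_fin => //; exact: pos.
  by rewrite lee_fin ler_wpM2r// exprn_ge0//; lra.
move=> f hf; have pos g : (forall x, 0 < g x) -> (0 <= \int[mu]_x (f x / g x)%:E)%E.
  move=> g0; apply: integral_ge0 => x _; rewrite lee_fin.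
  by apply: divr_ge0; [case: (lc_is_density f)|exact: ltW].
have [fb|[j jN fj]] := A1 f.
  have Sf : S f by [].
  exists (N + c f)%N; first by rewrite ltn_add2l cK.
  rewrite ltnNge leq_addr /= addKn; have [_ g0 _ ga] := hgB (c f).
  apply: le_trans (expe_le_fin n (pos _ g0) (ga f Sf erefl)) _.
  by rewrite lee_fin lerDr exprn_ge0.
exists j; first exact: ltn_addr.
rewrite jN; apply: le_trans (expe_le_fin n _ (indicator_alt (mA j) fj)) _.
  by apply: pos => x; exact: indicator_ratio_gt0.
by rewrite lee_fin lerDl exprn_ge0.
Qed.

End hellinger_tests.

(** * Averaging over the prior *)

Section markov_average.
Context d1 d2 (T1 : measurableType d1) (T2 : measurableType d2) (R : realType).
Variables (P : probability T1 R) (Pi : probability T2 R).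
Local Open Scope ereal_scope.

(** Tonelli's theorem takes the expectation under the prior integral, so a bound for each single [f]
    passes to the average. The evidence from above, its badly explained part and the numerator are
    all treated by it. *)
Lemma markov_average (G : T1 * T2 -> \bar R) (K : set T2) (c t : R) :
  measurable_fun setT G -> (forall p, 0 <= G p) -> measurable K ->
  (0 <= c)%R -> (0 < t)%R ->
  (forall f, \int[P]_x G (x, f) <= (c * \1_K f)%:E) ->
  measurable [set x | t%:E <= \int[Pi]_f G (x, f)] /\
  P [set x | t%:E <= \int[Pi]_f G (x, f)] <= (c * fine (Pi K) / t)%:E.
Proof.
move=> mG G0 mK c0 t0 hG; have mh : measurable_fun setT (fubini_F Pi G) by exact: measurable_fun_fubini_tonelli_F.
have h0 x : 0 <= fubini_F Pi G x by apply: integral_ge0.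
split.
  by rewrite -[X in measurable X]setTI; exact: (emeasurable_fun_c_infty measurableT mh).
apply: (markov_le mh h0 t0); rewrite /fubini_F.
rewrite (fubini_tonelli G mG G0).
apply: (@le_trans _ _ (\int[Pi]_f (c%:E * (\1_K f)%:E))).
  apply: ge0_le_integral => //.
  - by move=> f _; apply: integral_ge0.
  - have mg : measurable_fun setT (fubini_G P G) by exact: measurable_fun_fubini_tonelli_G.
    exact: mg.
  - apply: emeasurable_funM; first exact: measurable_cst.
    by apply/measurable_EFinP; exact: measurable_indic.
rewrite ge0_integralZl_EFin//; last first.
  by apply/measurable_EFinP; exact: measurable_indic.
rewrite integral_indic// setIT EFinM fineK//.
exact: fin_num_measure.
Qed.

End markov_average.

Section likelihood_ratio.
Variables (R : realType) (f0 : lc_density R) (n : nat).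
Let mu := @lebesgue_measure R.
Let P := iid_law (lc_law f0) n.

Let p (f : lc_density R) x : 0 <= f x. Proof. by case: (lc_is_density f). Qed.
Let m (f : lc_density R) : measurable_fun setT f. Proof. by case: (lc_is_density f). Qed.

(** Almost surely all observations fall where [f0] is positive, which permits division by the
    likelihood of [f0]. *)
Lemma likelihood_gt0_ae : (P (~` [set x | 0 < likelihood x f0]%R) = 0)%E.
Proof.
pose A := [set y : R | 0 < f0 y].
have mA : measurable A.
  rewrite -[X in measurable X]setTI.
  by apply: measurable_fun_ltr => //; exact: measurable_cst.
have PA : lc_law f0 A = 1%E.
  have [_ _ <-] := lc_is_density f0.
  rewrite /lc_law integral_mkcond; apply: eq_integral => x _.
  rewrite patchE; case: ifPn => //.
  rewrite notin_setE /A /= => /negP; rewrite -leNgt => h.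
  by congr EFin; apply/eqP; rewrite eq_le p h.
have -> : [set x : n.-tuple R | 0 < likelihood x f0] = [set x | forall i, A (tnth x i)].
  apply/seteqP; split => x /=; last by move=> h; apply: prodr_gt0 => i _; exact: h.
  move=> l0 i; rewrite /A /= lt0r p andbT; apply: contraTneq l0 => fi.
  by rewrite /likelihood (bigD1 i)//= fi mul0r ltxx.
have mS := measurable_tuple_rect (n := n) mA.
have -> : P (~` [set x | forall i, A (tnth x i)]) = (1 - \prod_(i < n) lc_law f0 A)%E.
  by rewrite -(iid_law_rect (lc_law f0) (fun=> mA)); exact: probability_setC.
by rewrite PA big1// subee.
Qed.

(** The change of measure from [f0] to [f] is only an inequality, because the sample never meets the
    part of [f] where [f0] vanishes. *)
Lemma integral_iid_ratio (f : lc_density R) (g : R -> R) :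
  measurable_fun setT g -> (forall x, 0 < g x) ->
  (\int[P]_x (\prod_(i < n) (f (tnth x i) / (f0 (tnth x i) * g (tnth x i))))%:E <=
   (\int[mu]_x (f x / g x)%:E) ^+ n)%E.
Proof.
move=> mg g0.
have mh : measurable_fun setT (fun y => f y / (f0 y * g y)).
  by apply: measurable_funM; [exact: m|apply: measurable_funV; exact: measurable_funM].
have h0 y : 0 <= f y / (f0 y * g y) by rewrite divr_ge0// mulr_ge0// ltW.
rewrite (integral_iid_prod (lc_law f0) n mh h0) integral_lc_law//; last first.
  by apply/measurable_EFinP; exact: mh.
have le1 : (0 <= \int[mu]_x ((f0 x)%:E * (f x / (f0 x * g x))%:E) <=
    \int[mu]_x (f x / g x)%:E)%E.
  apply/andP; split.
    by apply: integral_ge0 => x _; rewrite -EFinM lee_fin mulr_ge0.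
  apply: ge0_le_integral => //.
  - by move=> x _; rewrite -EFinM lee_fin mulr_ge0.
  - by apply: emeasurable_funM; apply/measurable_EFinP; [exact: m|exact: mh].
  - by apply/measurable_EFinP; apply: measurable_funM; [exact: m|exact: measurable_funV].
  move=> x _; rewrite -EFinM lee_fin; have [->|fn] := eqVneq (f0 x) 0.
    by rewrite mul0r divr_ge0// ltW.
  rewrite le_eqVlt; apply/orP; left; apply/eqP; field.
  by rewrite fn gt_eqF.
have /andP[a0 ab] := le1; elim: (n) => [|k ih]; first by rewrite !expe0.
rewrite !expeS; apply: lee_pmul => //.
by rewrite expe_ge0.
Qed.

End likelihood_ratio.

Section posterior_tail.
Variables (R : realType) (f0 : lc_density R) (Pi : probability (lc_density R) R) (n : nat).
Let mu := @lebesgue_measure R.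
Let P := iid_law (lc_law f0) n.

Let p (f : lc_density R) x : 0 <= f x. Proof. by case: (lc_is_density f). Qed.
Let m (f : lc_density R) : measurable_fun setT f. Proof. by case: (lc_is_density f). Qed.

Let rho (q : n.-tuple R * lc_density R) : R := likelihood q.1 q.2 / likelihood q.1 f0.

Let rho_ge0 q : 0 <= rho q.
Proof. by rewrite divr_ge0// likelihood_ge0. Qed.

Let measurable_f0 : measurable_fun setT
  (fun q : n.-tuple R * lc_density R => likelihood q.1 f0).
Proof. exact: (measurableT_comp (measurable_likelihood_at f0 (n:=n)) measurable_fst). Qed.

Let measurable_rho : measurable_fun setT rho.
Proof.
apply: measurable_funM; first exact: measurable_likelihood.
exact: measurable_funV.
Qed.

Let measurable_rho_at x : measurable_fun setT (fun f => rho (x, f)).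
Proof.
rewrite /rho /=; have ml : measurable_fun setT (fun f : lc_density R => likelihood x f).
  by apply: measurable_prod => i _; exact: measurable_lc_eval_at.
exact: (measurable_funM ml (measurable_cst _)).
Qed.

(** Numerator and evidence are divided by the likelihood of [f0]. The two bounds on the evidence
    keep it away from 0 and +oo, where [posterior] returns the prior. *)
Lemma posterior_le (U : set (lc_density R)) (x : n.-tuple R) (c d : R) : measurable U ->
  0 < likelihood x f0 -> 0 < c -> 0 < d ->
  (c%:E <= \int[Pi]_f (likelihood x f / likelihood x f0)%:E < +oo)%E ->
  (\int[Pi]_(f in U) (likelihood x f / likelihood x f0)%:E <= (d * c)%:E)%E ->
  (posterior Pi x U <= d%:E)%E.
Proof.
move=> mU l0 c0 d0.
have E (V : set (lc_density R)) : measurable V ->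
    (\int[Pi]_(f in V) (likelihood x f)%:E =
     (likelihood x f0)%:E * \int[Pi]_(f in V) (likelihood x f / likelihood x f0)%:E)%E.
  move=> mV; rewrite -ge0_integralZl_EFin//; last 3 first.
  - by move=> f _; rewrite lee_fin (rho_ge0 (x, f)).
  - by apply/measurable_EFinP; apply: measurable_funTS; exact: (measurable_rho_at x).
  - exact: ltW.
  by apply: eq_integral => f _; rewrite -EFinM mulrC divfK// gt_eqF.
rewrite /posterior (E _ measurableT) (E _ mU).
have : (0 <= \int[Pi]_(f in U) (likelihood x f / likelihood x f0)%:E)%E.
  by apply: integral_ge0 => f _; rewrite lee_fin (rho_ge0 (x, f)).
move: (likelihood x f0) l0 => l l0.
case: (\int[Pi]_f _)%E => [i| |]; rewrite ?ltxx ?andbF//.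
case: (\int[Pi]_(f in U) _)%E => [j| |]//.
rewrite !lee_fin ltry andbT => j0 ci jd.
have i0 : 0 < i by exact: lt_le_trans ci.
have li : 0 < l * i by rewrite mulr_gt0.
rewrite -!EFinM orbF eqe gt_eqF// inver gt_eqF// -EFinM lee_fin ler_pdivrMr//.
rewrite mulrCA ler_pM2l//; apply: le_trans jd _.
by rewrite ler_pM2l.
Qed.

Variables (k : nat) (g : nat -> R -> R).
Hypothesis mg : forall j, measurable_fun setT (g j).
Hypothesis g0 : forall j x, 0 < g j x.

Let A (j : nat) := [set x : n.-tuple R | (1%:E <= (\prod_(i < n) g j (tnth x i))%:E)%E].

Let mprod j : measurable_fun setT (fun x : n.-tuple R => (\prod_(i < n) g j (tnth x i))%:E).
Proof. by apply/measurable_EFinP; exact: measurable_tuple_prod. Qed.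

Let mA j : measurable (A j).
Proof. by rewrite -[X in measurable X]setTI; exact: (emeasurable_fun_c_infty measurableT (mprod j)). Qed.

Let B := \big[setU/set0]_(j < k) A j.

Let mB : measurable B. Proof. by apply: bigsetU_measurable. Qed.

Let PB (a : R) : (\sum_(j < k) (\int[mu]_x (f0 x * g j x)%:E) ^+ n <= a%:E)%E ->
  (P B <= a%:E)%E.
Proof.
apply: le_trans; apply: le_trans (Boole_inequality P _) _ => //.
apply: lee_sum => j _.
have := @markov_mul _ _ _ P _ 1 (mprod j).
rewrite mul1e -/(A j) => /(_ _ _)/le_trans; apply => //.
  by move=> x; rewrite lee_fin prodr_ge0// => i _; rewrite ltW.
rewrite integral_iid_prod//; last by move=> x; rewrite ltW.
rewrite integral_lc_law//; last 2 first.
- by apply/measurable_EFinP; exact: mg.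
- by move=> x; rewrite lee_fin ltW.
Qed.

(** The prior average of the likelihood ratio has expectation at most 1. Its purpose is to exclude
    infinite evidence. *)
Let average_ratio (t : R) : 0 < t ->
  let S := [set x | (t%:E <= \int[Pi]_f (rho (x, f))%:E)%E] in
  measurable S /\ (P S <= (t^-1)%:E)%E.
Proof.
move=> t0; pose G q := (rho q)%:E.
have mG : measurable_fun setT G by apply/measurable_EFinP; exact: measurable_rho.
have G0 q : (0 <= G q)%E by rewrite lee_fin.
have hG f : (\int[P]_x G (x, f) <= (1 * \1_[set: lc_density R] f)%:E)%E.
  rewrite indicT mulr1.
  have := @integral_iid_ratio _ f0 n f (fun=> 1) (measurable_cst _) (fun=> ltr01).
  under [in X in (_ <= X)%E -> _]eq_integral do rewrite divr1.
  have [_ _ ->] := lc_is_density f; rewrite -EFin_expe expr1n; apply: le_trans.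
  rewrite le_eqVlt; apply/orP; left; apply/eqP; apply: eq_integral => x _.
  rewrite /G /rho /likelihood /= -prodf_div; congr EFin; apply: eq_bigr => i _.
  by rewrite mulr1.
have [mS hS] := markov_average Pi mG G0 measurableT ler01 t0 hG.
move=> S; split=> //; apply: le_trans hS _.
have -> : fine (Pi setT) = 1 by rewrite probability_setT.
by rewrite mul1r lee_fin mul1r.
Qed.

(** In expectation at most the fraction [c] of the prior mass of [K] has a small likelihood; by
    Markov's inequality more than half of [K] is well explained off an event of probability at most
    [2 * c]. *)
Let average_bad (K : set (lc_density R)) (e c : R) : measurable K -> 0 <= c ->
  0 < fine (Pi K) ->
  (forall f, K f -> (P [set x | (likelihood x f < e * likelihood x f0)%R] <= c%:E)%E) ->
  let S := [set x | ((fine (Pi K) / 2)%:E <=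
     \int[Pi]_f (\1_K f * \1_[set q | likelihood q.1 q.2 < e * likelihood q.1 f0]%R (x, f))%:E)%E] in
  measurable S /\ (P S <= (2 * c)%:E)%E.
Proof.
move=> mK c0 K0 hP.
pose L := [set q : n.-tuple R * lc_density R | likelihood q.1 q.2 < e * likelihood q.1 f0].
have mL : measurable L.
  rewrite -[X in measurable X]setTI; apply: measurable_fun_ltr => //.
    exact: measurable_likelihood.
  by apply: measurable_funM; [exact: measurable_cst|exact: measurable_f0].
pose G q := (\1_K q.2 * \1_L q : R)%:E.
have mG : measurable_fun setT G.
  apply/measurable_EFinP; apply: measurable_funM; last exact: measurable_indic.
  exact: (measurableT_comp (measurable_indic mK) measurable_snd).
have G0 q : (0 <= G q)%E by rewrite lee_fin mulr_ge0.
have hG f : (\int[P]_x G (x, f) <= (c * \1_K f)%:E)%E.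
  rewrite /G /= indicE; case: (boolP (f \in K)) => [|_]; last first.
    by under eq_integral do rewrite mul0r; rewrite integral0 mulr0.
  rewrite inE => /hP hf; under eq_integral do rewrite mul1r; rewrite mulr1.
  apply: le_trans hf; set Lf := [set x | _].
  have mLf : measurable Lf.
    rewrite -[X in measurable X]setTI; apply: measurable_fun_ltr => //.
      exact: measurable_likelihood_at.
    by apply: measurable_funM; [exact: measurable_cst|exact: measurable_likelihood_at].
  have <- : (\int[P]_x (\1_Lf x)%:E = P Lf)%E by rewrite integral_indic// setIT.
  rewrite le_eqVlt; apply/orP; left; apply/eqP; apply: eq_integral => x _.
  by rewrite !indicE; congr (_ %:R)%:E; congr nat_of_bool; apply/idP/idP; rewrite !inE.
have t0 : 0 < fine (Pi K) / 2 by rewrite divr_gt0.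
have [mS hS] := markov_average Pi mG G0 mK c0 t0 hG.
move=> S; split=> //; apply: le_trans hS _.
rewrite lee_fin le_eqVlt; apply/orP; left; apply/eqP; field.
by rewrite gt_eqF.
Qed.

(** Off the rejection region each product of [g j] is below 1, so dividing the likelihood ratio by
    it only increases it, and the expectation of the quotient is bounded through
    [integral_iid_ratio]. *)
Let average_far (U : set (lc_density R)) (b t : R) : measurable U -> 0 <= b -> 0 < t ->
  (forall f, U f -> exists2 j, (j < k)%N & ((\int[mu]_x (f x / g j x)%:E) ^+ n <= b%:E)%E) ->
  let S := [set x | (t%:E <= \int[Pi]_f (\1_U f * \1_(~` B) x * rho (x, f))%:E)%E] in
  measurable S /\ (P S <= (b / t)%:E)%E.
Proof.
move=> mU b0 t0 hU.
pose G (q : n.-tuple R * lc_density R) := (\1_U q.2 * \1_(~` B) q.1 * rho q)%:E.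
have mG : measurable_fun setT G.
  apply/measurable_EFinP; apply: measurable_funM; last exact: measurable_rho.
  apply: measurable_funM.
    exact: (measurableT_comp (measurable_indic mU) measurable_snd).
  exact: (measurableT_comp (measurable_indic (measurableC mB)) measurable_fst).
have G0 q : (0 <= G q)%E by rewrite lee_fin; apply: mulr_ge0 => //; apply: mulr_ge0.
have hG f : (\int[P]_x G (x, f) <= (b * \1_U f)%:E)%E.
  rewrite /G /= indicE; case: (boolP (f \in U)) => [|_]; last first.
    by under eq_integral do rewrite !mul0r; rewrite integral0 mulr0.
  rewrite inE => /hU[j jk hj]; under eq_integral do rewrite mul1r; rewrite mulr1.
  apply: le_trans hj; apply: le_trans (integral_iid_ratio f0 n f (mg j) (g0 j)).
  apply: ge0_le_integral => //.
  - by move=> x _; rewrite lee_fin mulr_ge0.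
  - apply/measurable_EFinP; apply: measurable_funM; first exact: measurable_indic (measurableC mB).
    apply: measurable_funM; first exact: measurable_likelihood_at.
    by apply: measurable_funV; exact: measurable_likelihood_at.
  - apply/measurable_EFinP.
    apply: (@measurable_tuple_prod _ _ R n (fun y => f y / (f0 y * g j y))).
    by apply: measurable_funM; [exact: m|apply: measurable_funV; exact: measurable_funM].
  move=> x _; rewrite lee_fin.
  have -> : \prod_(i < n) (f (tnth x i) / (f0 (tnth x i) * g j (tnth x i))) =
      rho (x, f) / \prod_(i < n) g j (tnth x i).
    rewrite /rho /likelihood /= -!prodf_div; apply: eq_bigr => i _.
    by rewrite invfM mulrA.
  rewrite mulrC ler_wpM2l// indicE; have gp : 0 < \prod_(i < n) g j (tnth x i).
    by apply: prodr_gt0 => i _.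
  case: (boolP (x \in _)) => [|_]; last by rewrite invr_ge0 ltW.
  rewrite inE /B -bigcup_mkord => xB; rewrite invf_ge1//.
  rewrite leNgt; apply/negP => h; apply: xB; exists j => //.
  by rewrite /A /= lee_fin ltW.
have [mS hS] := markov_average Pi mG G0 mU b0 t0 hG.
move=> S; split=> //; apply: le_trans hS _.
rewrite lee_fin ler_pdivrMr// divfK ?gt_eqF// ler_piMr//.
rewrite -lee_fin fineK ?fin_num_measure//; exact: probability_le1.
Qed.

(** The four terms stem from the rejections under [f0], from evidence ratios of at least [t], from
    [likelihood_ratio_tail] doubled by [average_bad], and from the numerator divided by the lower
    bound on the evidence. *)
Lemma posterior_tail (h v r C a b d t : R) :
  0 < r -> 0 <= v -> n%:R * v = r ^+ 4 -> 0 <= b -> 0 < d -> 0 < t ->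
  (\sum_(j < k) (\int[mu]_x (f0 x * g j x)%:E) ^+ n <= a%:E)%E ->
  (forall f : lc_density R, h <= hellinger f f0 -> exists2 j, (j < k)%N &
    ((\int[mu]_x (f x / g j x)%:E) ^+ n <= b%:E)%E) ->
  ((expR (- (C * r ^+ 4)))%:E <= Pi [set f : lc_density R |
    (kl_div f0 f <= v%:E)%E /\ (kl_div2 f0 f <= v%:E)%E])%E ->
  (P [set x | (d%:E < posterior Pi x [set f : lc_density R | (h <= hellinger f f0)%R])%E] <=
    (a + t^-1 + 2 * (r ^- 2 + expR (- (r / 2) + r ^- 2 / 2)) +
     2 * b * expR ((C + 2) * r ^+ 4) / d)%:E)%E.
Proof.
move=> r0 v0 nv b0 d0 t0 ha hb; set K := [set f | _] => hK.
set U := [set f : lc_density R | (h <= hellinger f f0)%R].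
have mU : measurable U by exact: measurable_hellinger_ge.
have mK : measurable K by exact: measurable_kl_neighbourhood.
pose N := r ^+ 4; pose e := expR (- (2 * N)).
pose q := r ^- 2 + expR (- (r / 2) + r ^- 2 / 2).
have q0 : 0 <= q by rewrite addr_ge0 ?invr_ge0 ?exprn_ge0 ?expR_ge0// ltW.
have pkE : Pi K = (fine (Pi K))%:E by rewrite fineK// fin_num_measure.
set pk := fine (Pi K) in pkE.
have hpk : expR (- (C * N)) <= pk by move: hK; rewrite pkE lee_fin.
have pk0 : 0 < pk by apply: lt_le_trans hpk; exact: expR_gt0.
(* Relative to the likelihood of [f0], the evidence will exceed [e] times half the prior mass of
   [K], hence [expR (- 2 N) expR (- C N) / 2]. *)
pose c := expR (- ((C + 2) * N)) / 2.
have c0 : 0 < c by rewrite divr_gt0// expR_gt0.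
have dc0 : 0 < d * c by rewrite mulr_gt0.
have ce : c <= e * (pk / 2).
  rewrite mulrA ler_pM2r// /e.
  apply: (@le_trans _ _ (expR (- (2 * N)) * expR (- (C * N)))).
    by rewrite -expRD ler_expR le_eqVlt; apply/orP; left; apply/eqP; ring.
  by rewrite ler_wpM2l// expR_ge0.
have := average_ratio t0; set S1 := [set x | _] => -[mS1 P1].
have := average_bad (e := e) mK q0 pk0 (fun f hf =>
  likelihood_ratio_tail r0 nv v0 (proj1 hf) (proj2 hf)).
set S2 := [set x | _] => -[mS2 P2].
have := average_far mU b0 dc0 hb; set S3 := [set x | _] => -[mS3 P3].
have P0 := likelihood_gt0_ae f0 n; set S0 := ~` _ in P0.
have P4 := PB ha.
set S := [set x | _].
have mS : measurable S by exact: measurable_posterior_gt.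
(* the likelihood of [f0] vanishes, a test rejects, the evidence is large, the
   prior mass near [f0] is badly explained, or the numerator is large *)
have sub : S `<=` S0 `|` (B `|` S1 `|` (S2 `|` S3)).
  move=> x Sx; apply: contrapT => /not_orP[n0 /not_orP[/not_orP[nB n1] /not_orP[n2 n3]]].
  have l0 : 0 < likelihood x f0 by apply: contrapT.
  move/negP: n1; rewrite -ltNge => n1.
  move/negP: n2; rewrite -ltNge => n2.
  move/negP: n3; rewrite -ltNge => n3.
  move: Sx; rewrite /S /=; apply/negP; rewrite -leNgt.
  apply: (posterior_le mU l0 c0 d0); last first.
    rewrite mulrC in n3 *; apply: le_trans (ltW n3).
    rewrite integral_mkcond le_eqVlt; apply/orP; left; apply/eqP.
    apply: eq_integral => f _; rewrite patchE [\1_U f]indicE.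
    have -> : \1_(~` B) x = 1 :> R by rewrite indicE mem_set.
    by case: ifPn => _; rewrite ?mul0r// !mul1r.
  rewrite (lt_trans n1) ?ltry// andbT.
  have mG : measurable_fun setT (fun f => (rho (x, f))%:E).
    by apply/measurable_EFinP; exact: measurable_rho_at.
  pose L := [set f : lc_density R | likelihood x f < e * likelihood x f0].
  have mL : measurable L.
    rewrite -[X in measurable X]setTI; apply: measurable_fun_ltr => //.
    by apply: measurable_prod => i _; exact: measurable_lc_eval_at.
  have mKL : measurable_fun setT (fun f => (\1_K f * \1_L f : R)%:E).
    by apply/measurable_EFinP; apply: measurable_funM; exact: measurable_indic.
  have e0 : 0 < e by exact: expR_gt0.
  (* Every [f] in [K] belongs to [L] or has likelihood ratio at least [e]. *)
  have h1 : (Pi K <= \int[Pi]_f (\1_K f * \1_L f)%:E + (e^-1)%:E * \int[Pi]_f (rho (x, f))%:E)%E.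
    have ei : 0 <= e^-1 by rewrite invr_ge0 ltW.
    have mEG : measurable_fun setT (fun f => (e^-1)%:E * (rho (x, f))%:E)%E.
      by apply: emeasurable_funM => //; exact: measurable_cst.
    have G0 f : (0 <= (rho (x, f))%:E)%E by rewrite lee_fin.
    have EG0 f : (0 <= (e^-1)%:E * (rho (x, f))%:E)%E by apply: mule_ge0.
    have KL0 f : (0 <= (\1_K f * \1_L f : R)%:E)%E by rewrite lee_fin mulr_ge0.
    rewrite -(ge0_integralZl_EFin Pi measurableT (fun f _ => G0 f) mG ei).
    rewrite -(ge0_integralD Pi measurableT (fun f _ => KL0 f) mKL (fun f _ => EG0 f) mEG).
    have -> : Pi K = (\int[Pi]_f (\1_K f)%:E)%E by rewrite integral_indic// setIT.
    apply: ge0_le_integral => //.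
    - by apply/measurable_EFinP; exact: measurable_indic.
    - exact: emeasurable_funD.
    move=> f _; rewrite -EFinM -EFinD lee_fin.
    have r1 := rho_ge0 (x, f).
    have [fL|fL] := pselect (L f).
      by rewrite [\1_L f]indicE mem_set// mulr1 lerDl; apply: mulr_ge0.
    rewrite [\1_L f]indicE memNset// mulr0 add0r.
    apply: (@le_trans _ _ 1); first by rewrite indicE lern1 leq_b1.
    rewrite mulrC ler_pdivlMr// mul1r /rho /= ler_pdivlMr//.
    by move/negP: fL; rewrite -leNgt.
  move: n1 n2 h1; rewrite pkE.
  have -> : (\int[Pi]_f (\1_K f * \1_[set q0 | likelihood q0.1 q0.2 < e * likelihood q0.1 f0] (x, f))%:E =
    \int[Pi]_f (\1_K f * \1_L f)%:E)%E.
    apply: eq_integral => f _; rewrite ![\1__ (x, f)]indicE [\1_L f]indicE.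
    by congr (_ * (_ %:R))%:E; congr nat_of_bool; apply/idP/idP; rewrite !inE.
  have I0 : (0 <= \int[Pi]_f (rho (x, f))%:E)%E by apply: integral_ge0 => f _; rewrite lee_fin.
  have J0 : (0 <= \int[Pi]_f (\1_K f * \1_L f)%:E)%E.
    by apply: integral_ge0 => f _; rewrite lee_fin mulr_ge0.
  move: I0 J0; rewrite /rho /=.
  case: (\int[Pi]_f (likelihood x f / _)%:E)%E => [i| |]//.
  case: (\int[Pi]_f _)%E => [j| |]//.
  rewrite -EFinM -EFinD !lte_fin !lee_fin => i0 j0 _ jp pj.
  apply: le_trans ce _; rewrite mulrC -ler_pdivlMr// mulrC; lra.
have mS0 : measurable S0.
  apply: measurableC; rewrite -[X in measurable X]setTI.
  by apply: measurable_fun_ltr => //; exact: measurable_likelihood_at.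
have m41 : measurable (B `|` S1) by exact: measurableU.
have m23 : measurable (S2 `|` S3) by exact: measurableU.
have m4123 : measurable (B `|` S1 `|` (S2 `|` S3)) by exact: measurableU.
have mall : measurable (S0 `|` (B `|` S1 `|` (S2 `|` S3))) by exact: measurableU.
apply: le_trans (le_measure P (mem_set mS) (mem_set mall) sub) _.
apply: le_trans (measureU2 P mS0 m4123) _.
have h41 := le_trans (measureU2 P mB mS1) (leeD P4 P1).
have h23 := le_trans (measureU2 P mS2 mS3) (leeD P2 P3).
have h0 : (P S0 <= 0)%E by rewrite P0.
apply: le_trans (leeD h0 (le_trans (measureU2 P m41 m23) (leeD h41 h23))) _.
rewrite add0e -!EFinD lee_fin -[leRHS]addrA lerD2l lerD2l.
rewrite le_eqVlt; apply/orP; left; apply/eqP.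
rewrite /c expRN; field.
by rewrite !gt_eqF// expR_gt0.
Qed.

End posterior_tail.

(** * Rate and conclusion *)

Section rate.
Variable R : realType.

Lemma expRN_le_inv (x : R) : 0 < x -> expR (- x) <= x^-1.
Proof.
move=> x0; rewrite expRN lef_pV2 ?posrE ?expR_gt0//.
by apply: le_trans (expR_ge1Dx x); rewrite lerDr.
Qed.

Lemma onem_exp_le (x : R) n : x <= 1 -> (1 - x) ^+ n <= expR (- (n%:R * x)).
Proof.
move=> x1; rewrite -mulrN expRM_natl lerXn2r ?nnegrE ?expR_ge0 ?subr_ge0//.
exact: expR_ge1Dx.
Qed.

Lemma powR_rate (K e : R) n : (0 < n)%N -> n%:R `^ (- (2 / 5)) <= K * e ->
  1 <= (K * e) ^+ 5 * n%:R ^+ 2.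
Proof.
move=> n0 h; have n0' : 0 < n%:R :> R by rewrite ltr0n.
have : (n%:R `^ (- (2 / 5))) ^+ 5 <= (K * e) ^+ 5.
  by rewrite lerXn2r ?nnegrE ?powR_ge0// (le_trans _ h)// powR_ge0.
rewrite -powR_mulrn ?powR_ge0// -powRrM.
have -> : - (2 / 5) * 5%:R = - 2%:R :> R by field.
rewrite powRN powR_mulrn ?ler0n// => h5.
have n2 : 0 < n%:R ^+ 2 :> R by rewrite exprn_gt0.
by have := ler_wpM2r (ltW n2) h5; rewrite mulVf// gt_eqF.
Qed.

(** Only convergence to 0 is wanted, so every exponential is reduced to a multiple of [n^-1] or
    [r^-1] by [expR (- x) <= x^-1]. [M ^ 2 / 6] has to exceed the entropy constant by 1, and
    [M ^ 2 / 16] has to exceed [C] by 3, namely 2 for the evidence and 1 for the remaining decay. *)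
Lemma posterior_rate (f0 : lc_density R) : exists (D : R) (N0 : nat), 0 <= D /\
  forall (Pi : probability (lc_density R) R) (n : nat) (K C M e d r : R),
  (0 < n)%N -> 0 < K -> 0 < C -> 0 < d -> 0 < e -> 1 <= M -> M * e <= 1 ->
  D * Num.sqrt (11 * K ^+ 5) + 1 <= M ^+ 2 / 6 -> C + 3 <= M ^+ 2 / 16 ->
  1 <= (K * e) ^+ 5 * n%:R ^+ 2 -> (C + 2) * e ^+ 2 <= ln (176 / 175) / 2 ->
  2 <= r -> r ^+ 4 = n%:R * e ^+ 2 ->
  ((expR (- (C * n%:R * e ^+ 2)))%:E <= Pi [set f : lc_density R |
    (kl_div f0 f <= (e ^+ 2)%:E)%E /\ (kl_div2 f0 f <= (e ^+ 2)%:E)%E])%E ->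
  (iid_law (lc_law f0) n [set x : n.-tuple R | (d%:E < posterior Pi x
     [set f : lc_density R | (M * e <= hellinger f f0)%R])%E] <=
    ((N0%:R / ln (176 / 175) + 4 / (d * ln (176 / 175))) * n%:R^-1 +
     (12 + 2 / d) * r^-1)%:E)%E.
Proof.
have [D D0 [N0 hT]] := hellinger_tests f0.
exists D, N0; split=> // Pi n K C M e d r n0 K0 C0 d0 e0 M1 Me MD MC Ke eC r2 rN hPi.
set lam := ln (176 / 175) in eC *.
have lam0 : 0 < lam by rewrite ln_gt0// ltr_pdivlMr//; lra.
have n0' : 0 < n%:R :> R by rewrite ltr0n.
have r0 : 0 < r by lra.
have M0 : 0 < M by lra.
have h01 : 0 < M * e <= 1 by rewrite mulr_gt0.
have hM1 : (M * e) ^+ 2 <= 1 by rewrite exprn_ile1// ltW//; case/andP: h01.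
have hM0 : 0 <= (M * e) ^+ 2 by rewrite sqr_ge0.
have [k [g [mg g0 gn ga]]] := hT (M * e) n h01.
have e2 : 0 <= e ^+ 2 by rewrite sqr_ge0.
have q0 : 0 <= 175 / 176 :> R by rewrite divr_ge0.
have b0 : 0 <= (175 / 176) ^+ n + (1 - (M * e) ^+ 2 / 16) ^+ n.
  by rewrite addr_ge0// exprn_ge0//; lra.
have hPi' : ((expR (- (C * r ^+ 4)))%:E <= Pi [set f : lc_density R |
    (kl_div f0 f <= (e ^+ 2)%:E)%E /\ (kl_div2 f0 f <= (e ^+ 2)%:E)%E])%E.
  by rewrite rN mulrA.
(* The level [t] for the evidence is taken to be [r]. *)
apply: le_trans (posterior_tail mg g0 r0 e2 (esym rN) b0 d0 r0 gn ga hPi') _.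
rewrite lee_fin.
pose N := r ^+ 4; have N0' : 0 < N by rewrite exprn_gt0.
have r1 : 1 <= r by lra.
have NV : N^-1 <= r^-1.
  by rewrite lef_pV2 ?posrE// ler_eXnr.
have r2V : r ^- 2 <= r^-1.
  by rewrite lef_pV2 ?posrE ?exprn_gt0// ler_eXnr.
have eN : expR (- N) <= r^-1 by apply: le_trans NV; exact: expRN_le_inv.
have qE : (175 / 176) ^+ n = expR (- (n%:R * lam)).
  have -> : 175 / 176 = expR (- lam) :> R.
    by rewrite expRN lnK ?posrE ?divr_gt0// invf_div.
  by rewrite -mulrN expRM_natl.
have nh : n%:R * (M * e) ^+ 2 = M ^+ 2 * N by rewrite /N rN exprMn; ring.
have a1 : (175 / 176) ^+ n <= lam^-1 * n%:R^-1.
  by rewrite qE -invfM mulrC; apply: expRN_le_inv; rewrite mulr_gt0.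
have a2 : expR (D * Num.sqrt (11 / (M * e))) * (1 - (M * e) ^+ 2 / 6) ^+ n <= r^-1.
  apply: le_trans eN; apply: (@le_trans _ _
    (expR (D * Num.sqrt (11 * K ^+ 5) * N) * expR (- (n%:R * ((M * e) ^+ 2 / 6))))).
    apply: ler_pM; rewrite ?expR_ge0 ?exprn_ge0//; [lra| |apply: onem_exp_le; lra].
    rewrite ler_expR -mulrA ler_wpM2l//.
    rewrite -[X in _ <= _ * X](ger0_norm (ltW N0')) -sqrtr_sqr -sqrtrM; last first.
      by rewrite mulr_ge0// exprn_ge0// ltW.
    rewrite ler_wsqrtr// ler_pdivrMr ?mulr_gt0//.
    (* the lower bound on the rate turns the entropy [e ^- (1/2)] into [O(N)] *)
    have h1 : 1 <= K ^+ 5 * N ^+ 2 * e.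
      by apply: le_trans Ke _; rewrite /N rN le_eqVlt; apply/orP; left; apply/eqP; ring.
    have h2 : K ^+ 5 * N ^+ 2 * e <= K ^+ 5 * N ^+ 2 * e * M by rewrite ler_peMr// (le_trans _ h1).
    have -> : 11 * K ^+ 5 * N ^+ 2 * (M * e) = 11 * (K ^+ 5 * N ^+ 2 * e * M) by ring.
    by move: (K ^+ 5 * N ^+ 2 * e * M) (le_trans h1 h2) => u; lra.
  rewrite -expRD ler_expR mulrA nh.
  have := ler_wpM2r (ltW N0') MD; rewrite mulrDl mul1r.
  by move: (M ^+ 2) => u; lra.
have a3 : expR (- (r / 2) + r ^- 2 / 2) <= 4 * r^-1.
  apply: (@le_trans _ _ (expR (- (r / 4)))).
    rewrite ler_expR; have : r^-1 <= 1 by rewrite invf_le1.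
    by move: r2V; move: (r ^- 2) (r^-1) => u v; lra.
  apply: le_trans (expRN_le_inv _) _; first by rewrite divr_gt0.
  by rewrite invf_div.
(* The error of the indicator tests is exponentially small in [n]; as [e] is small, half of its
   exponent compensates [expR ((C + 2) * N)]. *)
have nv : (C + 2) * N <= n%:R * lam / 2.
  have := ler_wpM2l (ltW n0') eC; rewrite /N rN.
  by move: (n%:R : R) (e ^+ 2) => u v; lra.
have a4 : (175 / 176) ^+ n * expR ((C + 2) * N) <= 2 * lam^-1 * n%:R^-1.
  rewrite qE -expRD; apply: (@le_trans _ _ (expR (- (n%:R * lam / 2)))).
    by rewrite ler_expR; lra.
  apply: le_trans (expRN_le_inv _) _; first by rewrite divr_gt0// mulr_gt0.
  by rewrite invf_div invfM -mulrA [_^-1 * _^-1]mulrC.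
have a5 : (1 - (M * e) ^+ 2 / 16) ^+ n * expR ((C + 2) * N) <= r^-1.
  apply: le_trans eN; apply: (@le_trans _ _
    (expR (- (n%:R * ((M * e) ^+ 2 / 16))) * expR ((C + 2) * N))).
    by rewrite ler_wpM2r ?expR_ge0//; apply: onem_exp_le; lra.
  rewrite -expRD ler_expR mulrA nh.
  have := ler_wpM2r (ltW N0') MC.
  by move: (M ^+ 2) => u; lra.
rewrite -/N.
have -> : 2 * ((175 / 176) ^+ n + (1 - (M * e) ^+ 2 / 16) ^+ n) * expR ((C + 2) * N) / d =
    2 / d * ((175 / 176) ^+ n * expR ((C + 2) * N) +
             (1 - (M * e) ^+ 2 / 16) ^+ n * expR ((C + 2) * N)) by ring.
(* In the constant 12, the Birge tests [a2] and the evidence level [r] count 1 each, [2 * r ^- 2]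
   counts 2 and [a3] counts [2 * 4]. *)
have a6 := lerD a4 a5.
have d2 : 0 <= 2 / d by rewrite divr_ge0// ltW.
have a7 := ler_wpM2l d2 a6.
have a8 := ler_wpM2l (ler0n R N0) a1.
have -> : 4 / (d * lam) = 2 / d * (2 * lam^-1) by field; rewrite !gt_eqF.
move: a7 a8 a2 a3 r2V.
move: (_ ^+ n * expR _ + _) (2 / d) (lam^-1) (n%:R^-1 : R) (r^-1) (r ^- 2) => A B l m s s2.
move: (expR _) (expR _ * _) (N0%:R * (175 / 176) ^+ n) => E1 E2 E3.
by move: (N0%:R : R) => z; lra.
Qed.

End rate.

Theorem theorem1 (R : realType) (f0 : lc_density R)
    (Pi : forall n : nat, probability (lc_density R) R) (eps : nat -> R)
    (eps_cvg0 : eps n @[n --> \oo] --> 0)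
    (eps_lower : lesssim (fun n => n%:R `^ (- (2 / 5))) eps)
    (eps_upper : exists2 rho : R, 0 < rho &
       lesssim eps (fun n => n%:R `^ (- (3 / 8) - rho)))
    (prior_mass : exists2 C : R, 0 < C & forall n : nat, (0 < n)%N ->
       ((expR (- (C * n%:R * eps n ^+ 2)))%:E <=
        Pi n [set f : lc_density R |
                kl_div f0 f <= (eps n ^+ 2)%:E /\
                kl_div2 f0 f <= (eps n ^+ 2)%:E])%E) :
  \forall M \near +oo, forall delta : R, 0 < delta ->
    iid_law (lc_law f0) n
      [set x : n.-tuple R |
         (delta%:E < posterior (Pi n) x
            [set f : lc_density R | (M * eps n <= hellinger f f0)%R])%E]
      @[n --> \oo] --> 0%E.
Proof.
have [K K0 hK] := eps_lower; have [C C0 hC] := prior_mass.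
have [D [N0 [D0 hP]]] := posterior_rate f0.
(* As [M0 >= 1], any [M >= M0] has [M ^ 2 >= M0], which contains both requirements on [M ^ 2]. *)
pose M0 := 1 + 6 * (D * Num.sqrt (11 * K ^+ 5) + 1) + 16 * (C + 3).
have DK0 : 0 <= D * Num.sqrt (11 * K ^+ 5) by rewrite mulr_ge0.
have rate n : (0 < n)%N -> 1 <= (K * eps n) ^+ 5 * n%:R ^+ 2.
  by move=> n0; apply: powR_rate => //; exact: hK.
have eps0 n : (0 < n)%N -> 0 < eps n.
  move=> n0; rewrite -(pmulr_rgt0 _ K0); apply: lt_le_trans (hK n n0).
  by rewrite powR_gt0// ltr0n.
near=> M; move=> d d0.
have MM0 : M0 <= M by near: M; apply: nbhs_pinfty_ge; exact: num_real.
have M1 : 1 <= M by apply: le_trans MM0; rewrite /M0; lra.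
have M2 : M0 <= M ^+ 2 by apply: le_trans MM0 _; rewrite ler_eXnr.
have MD : D * Num.sqrt (11 * K ^+ 5) + 1 <= M ^+ 2 / 6.
  by move: M2; rewrite /M0; move: (M ^+ 2) => u; lra.
have MC : C + 3 <= M ^+ 2 / 16.
  by move: M2; rewrite /M0; move: (M ^+ 2) => u; lra.
pose r n := Num.sqrt (Num.sqrt (n%:R * eps n ^+ 2)).
have rN n : r n ^+ 4 = n%:R * eps n ^+ 2.
  by rewrite -[4%N]/(2 * 2)%N exprM !sqr_sqrtr// mulr_ge0// sqr_ge0.
have r_ge0 n : 0 <= r n by exact: sqrtr_ge0.
(* The lower bound on the rate reads [1 <= K ^ 5 * r n ^ 8 * eps n], so [r n] cannot stay bounded
   while [eps n] tends to 0. *)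
have r_cvg : r n @[n --> \oo] --> +oo.
  apply/cvgryPge => A; pose B := Num.max A 1.
  have B0 : 0 < B by rewrite lt_max ltr01 orbT.
  have KB0 : 0 < K ^+ 5 * B ^+ 8 by rewrite mulr_gt0// exprn_gt0.
  near=> n; have n0 : (0 < n)%N by near: n; exact: nbhs_infty_gt.
  have hn : eps n < (K ^+ 5 * B ^+ 8)^-1.
    by near: n; apply: cvgr_lt eps_cvg0 _ _; rewrite invr_gt0.
  apply: (@le_trans _ _ B); first by rewrite /B le_max lexx.
  rewrite leNgt; apply/negP => rB.
  have : 1 <= K ^+ 5 * r n ^+ 8 * eps n.
    apply: le_trans (rate n n0) _; rewrite -[8%N]/(4 * 2)%N exprM rN.
    by rewrite le_eqVlt; apply/orP; left; apply/eqP; ring.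
  apply/negP; rewrite -ltNge.
  apply: (@le_lt_trans _ _ (K ^+ 5 * B ^+ 8 * eps n)).
    apply: ler_wpM2r; first exact: ltW (eps0 n n0).
    rewrite ler_pM2l ?exprn_gt0//.
    by apply: lerXn2r; rewrite ?nnegrE// ltW.
  by rewrite mulrC -ltr_pdivlMr// div1r.
have lam0 : 0 < ln (176 / 175) :> R by rewrite ln_gt0// ltr_pdivlMr//; lra.
pose c1 := N0%:R / ln (176 / 175) + 4 / (d * ln (176 / 175)) : R.
pose c2 := 12 + 2 / d : R.
apply: (@squeeze_cvge _ _ _ _ (fun=> 0%E) _ (fun n => (c1 * n%:R^-1 + c2 * (r n)^-1)%:E)).
- near=> n; apply/andP; split; first exact: measure_ge0.
  have n0 : (0 < n)%N by near: n; exact: nbhs_infty_gt.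
  apply: (hP (Pi n) n K C M (eps n) d (r n)) => //.
  + exact: eps0.
  + rewrite mulrC -ler_pdivlMr ?(lt_le_trans _ M1)// div1r.
    by near: n; apply: cvgr_le eps_cvg0 _ _; rewrite invr_gt0 (lt_le_trans _ M1).
  + exact: rate.
  + have C2 : 0 < C + 2 by lra.
    have e0 := ltW (eps0 n n0).
    apply: (@le_trans _ _ ((C + 2) * eps n)).
      apply: ler_wpM2l; first exact: ltW.
      by rewrite expr2 ler_piMr//; near: n; apply: cvgr_le eps_cvg0 _ _.
    rewrite mulrC -ler_pdivlMr//; near: n; apply: cvgr_le eps_cvg0 _ _.
    by apply: divr_gt0; [exact: divr_gt0|lra].
  + by near: n; exact: (cvgry_ge r_cvg).
  + exact: hC.
- exact: cvg_cst.
- apply: cvg_EFin; first by near=> n.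
  rewrite [X in _ --> X](_ : _ = c1 * 0 + c2 * 0); last by rewrite !mulr0 addr0.
  apply: cvgD; apply: cvgM; try exact: cvg_cst.
    apply/(gtr0_cvgV0 (f := fun n => n%:R)); last exact: cvgr_idn.
    by near=> n; rewrite ltr0n; near: n; exact: nbhs_infty_gt.
  apply/(gtr0_cvgV0 (f := r)) => //.
  by near=> n; near: n; exact: (cvgry_gt r_cvg).
Unshelve. all: by end_near.
Qed.
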